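(* Let $M=\{(z,w)\in\mathbb{C}^3\times\mathbb{C}:\ \operatorname{Im} w=|z_1|^2+|z_2|^2\}$ (that is, $\operatorname{Im}w=\sum_{j=1}^3\sigma_j|z_j|^2$ with $\sigma_1=\sigma_2=1$, $\sigma_3=0$), whose points are identified with $(z,t)\in\mathbb{C}^3\times\mathbb{R}$, $t=\operatorname{Re}w$. Write $z'=(z_1,z_2)$. Then, on the space of differential $(0,1)$-forms spanned by $d\bar z_1$ and $d\bar z_2$, $\Box_b$ is solvable via convolution with the kernel $$N(z,t)=\frac{8}{\pi^4}\int_0^1\frac{dr}{|\ln r|(1-r)^2}\operatorname{Re}\left\{\frac{1}{\left[|z'|^2\left(\frac{1+r}{1-r}\right)+|z_3|^2\frac{2}{|\ln r|}+it\right]^3}\right\}.$$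
   Context: Group structure: $G=\mathbb{C}^3\times\mathbb{R}$ carries the group law $(z,t)(\tilde z,\tilde t)=(z+\tilde z,\,t+\tilde t+2\operatorname{Im}\phi(z,\tilde z))$ with $\phi(z,\tilde z)=z_1\overline{\tilde z_1}+z_2\overline{\tilde z_2}$; the inverse of $(z,t)$ is $(-z,-t)$. Haar measure is Lebesgue measure $dx\,dy\,dt$, $z=x+iy$. Vector fields: with $\sigma_1=\sigma_2=1,\ \sigma_3=0$, the right invariant vector fields used to define the CR structure and $\Box_b$ are $$Z_j=\partial_{z_j}-i\sigma_j\bar z_j\,\partial_t,\qquad \bar Z_j=\partial_{\bar z_j}+i\sigma_jz_j\,\partial_t,\qquad [Z_j,\bar Z_k]=2i\delta_{jk}\sigma_j\partial_t .$$ Kohn Laplacian on $(0,1)$-forms: $\Box_b$ is diagonal, $\Box_b\big(\sum_kf_k\,d\bar z_k\big)=\sum_k(\Box_kf_k)\,d\bar z_k$, where $$\Box_k=-\frac12\sum_{j=1}^3(\bar Z_jZ_j+Z_j\bar Z_j)+\frac12\Big([Z_k,\bar Z_k]-\sum_{j\neq k}[Z_j,\bar Z_j]\Big).$$ ''Solvable via convolution with the kernel $N$'' on forms spanned by $d\bar z_1,d\bar z_2$ means that $N$ (defined almost everywhere by the formula) is a fundamental solution, $\Box_kN=\delta_0$ in the sense of distributions for $k=1,2$; equivalently, for $f\in C_c^\infty(G)$ the function $(N*f)(g)=\int_GN(gh^{-1})f(h)\,dh$ satisfies $\Box_b\big((N*f)\,d\bar z_k\big)=f\,d\bar z_k$ for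 $k=1,2$. *)

(* Defs.v *)
From HB Require Import structures.
From mathcomp Require Import all_boot all_order all_algebra.
From mathcomp Require Import complex.
From mathcomp Require Import all_classical all_reals all_analysis.

Set Implicit Arguments.
Unset Strict Implicit.
Unset Printing Implicit Defensive.

Import Order.TTheory GRing.Theory Num.Theory.
Import numFieldNormedType.Exports.
Local Open Scope classical_set_scope.
Local Open Scope ring_scope.
Local Open Scope complex_scope.

(* C^3 x R in real coordinates (x1, y1, x2, y2, x3, y3, t), z_j = x_j + i y_j,
   so that the library's product topology, norm and Borel sigma-algebra apply.
   The indices 1, 2, 3 of z_1, z_2, z_3 are the elements 0, 1, 2 of 'I_3. *)
Definition G (R : realType) : Type := (R * R * R * R * R * R * R)%type.

Definition pt (R : realType) (z : 'I_3 -> R[i]) (t : R) : G R :=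
  (complex.Re (z 0), complex.Im (z 0), complex.Re (z 1), complex.Im (z 1),
   complex.Re (z 2), complex.Im (z 2), t).

Definition zc (R : realType) (g : G R) (j : 'I_3) : R[i] :=
  let: (x1, y1, x2, y2, x3, y3, _) := g in
  nth 0 [:: x1 +i* y1; x2 +i* y2; x3 +i* y3] j.

Definition tc (R : realType) (g : G R) : R := g.2.

Definition sigma (R : realType) (j : 'I_3) : R := if (j < 2)%N then 1 else 0.

Definition M (R : realType) : set (('I_3 -> R[i]) * R[i]) :=
  [set p | complex.Im p.2 = \sum_(j < 3) sigma R j * Normc.normc (p.1 j) ^+ 2].

(* The identification (z, w) |-> (z, Re w) of M with C^3 x R; chart_bij below
   justifies working on G only. *)
Definition chart (R : realType) (p : ('I_3 -> R[i]) * R[i]) : G R :=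
  pt p.1 (complex.Re p.2).

Lemma zc_pt (R : realType) (z : 'I_3 -> R[i]) (t : R) : zc (pt z t) = z.
Proof.
apply/funext => -[[|[|[|//]]] ij]; rewrite /zc /=.
- by rewrite (_ : Ordinal ij = 0); [case: (z _) | exact/val_inj].
- by rewrite (_ : Ordinal ij = 1); [case: (z _) | exact/val_inj].
- by rewrite (_ : Ordinal ij = 2); [case: (z _) | exact/val_inj].
Qed.

Lemma pt_zc (R : realType) (g : G R) : pt (zc g) (tc g) = g.
Proof. by case: g => -[[[[[x1 y1] x2] y2] x3] y3] t. Qed.

Lemma chart_bij (R : realType) : set_bij (@M R) setT (@chart R).
Proof.
split => //.
- move=> [z [u v]] [z' [u' v']]; rewrite !inE /M /chart /= => -> -> e.
  have ez : z = z' by rewrite -(zc_pt z u) -(zc_pt z' u') e.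
  by move: e => /(congr1 (@tc R)); rewrite ez /tc /= => ->.
- move=> g _; exists (zc g, tc g +i* \sum_(j < 3) sigma R j *
    Normc.normc (zc g j) ^+ 2) => //.
  exact: pt_zc.
Qed.

Definition mulG (R : realType) (g h : G R) : G R :=
  pt (fun j => zc g j + zc h j)
     (tc g + tc h
      + 2 * complex.Im (\sum_(j < 3) (sigma R j)%:C * (zc g j * conjc (zc h j)))).

Definition invG (R : realType) (g : G R) : G R :=
  pt (fun j => - zc g j) (- tc g).

Definition haar (R : realType) : set (G R) -> \bar R :=
  (let leb := @lebesgue_measure R in
   leb \x leb \x leb \x leb \x leb \x leb \x leb)%E.

Definition intG (R : realType) (f : G R -> R[i]) : R[i] :=
  Rintegral (@haar R) setT (fun g => complex.Re (f g))
  +i* Rintegral (@haar R) setT (fun g => complex.Im (f g)).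

Definition loc_integrable (R : realType) (f : G R -> R) : Prop :=
  measurable_fun setT f /\
  forall K : set (G R), compact K -> (@haar R).-integrable K (EFin \o f).

Fixpoint iter_derive (R : realType) (vs : seq (G R)) (f : G R -> R) :
    G R -> R :=
  if vs is v :: vs' then fun g => 'D_v (iter_derive vs' f) g else f.

Definition smooth_real (R : realType) (f : G R -> R) : Prop :=
  forall vs : seq (G R), continuous (iter_derive vs f) /\
    forall v g, derivable (iter_derive vs f) g v.

Definition smooth (R : realType) (f : G R -> R[i]) : Prop :=
  smooth_real (fun g => complex.Re (f g)) /\
  smooth_real (fun g => complex.Im (f g)).

Definition test_fun (R : realType) (f : G R -> R[i]) : Prop :=
  smooth f /\ compact (closure [set g | f g != 0]).

(* R[i] is not a normed module over R in the library, hence the real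
   derivative is taken on the real and imaginary parts. *)
Definition dv (R : realType) (v : G R) (f : G R -> R[i]) (g : G R) : R[i] :=
  'D_v (fun h => complex.Re (f h)) g +i* 'D_v (fun h => complex.Im (f h)) g.

Definition dx (R : realType) (j : 'I_3) : (G R -> R[i]) -> G R -> R[i] :=
  dv (pt (fun k => if k == j then 1 else 0) 0).

Definition dy (R : realType) (j : 'I_3) : (G R -> R[i]) -> G R -> R[i] :=
  dv (pt (fun k => if k == j then 'i%C else 0) 0).

Definition dt (R : realType) : (G R -> R[i]) -> G R -> R[i] :=
  dv (pt (fun=> 0) 1).

Definition dz (R : realType) (j : 'I_3) (f : G R -> R[i]) (g : G R) : R[i] :=
  2^-1 * (dx j f g - 'i%C * dy j f g).

Definition dzbar (R : realType) (j : 'I_3) (f : G R -> R[i]) (g : G R) :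
    R[i] :=
  2^-1 * (dx j f g + 'i%C * dy j f g).

(* Z and Zbar are the fields invariant under the right translations of mulG. *)
Definition Zcoef (R : realType) (j : 'I_3) (g : G R) : R[i] :=
  'i%C * (sigma R j)%:C * conjc (zc g j).

Definition Zbarcoef (R : realType) (j : 'I_3) (g : G R) : R[i] :=
  'i%C * (sigma R j)%:C * zc g j.

Definition Z (R : realType) (j : 'I_3) (f : G R -> R[i]) (g : G R) : R[i] :=
  dz j f g - Zcoef j g * dt f g.

Definition Zbar (R : realType) (j : 'I_3) (f : G R -> R[i]) (g : G R) : R[i] :=
  dzbar j f g + Zbarcoef j g * dt f g.

(* The expression of Box_k in terms of operators A_j, B_j standing for Z_j and
   \bar Z_j; it is used on functions (T = G) and on distributions, i.e.
   functionals on test functions (T = G -> C). *)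
Definition box_expr (R : realType) (T : Type)
    (A B : 'I_3 -> (T -> R[i]) -> T -> R[i])
    (k : 'I_3) (u : T -> R[i]) (x : T) : R[i] :=
  let bracket j := A j (B j u) x - B j (A j u) x in
  - 2^-1 * (\sum_(j < 3) (B j (A j u) x + A j (B j u) x))
  + 2^-1 * (bracket k - \sum_(j < 3 | j != k) bracket j).

Definition box (R : realType) (k : 'I_3) (f : G R -> R[i]) : G R -> R[i] :=
  box_expr (@Z R) (@Zbar R) k f.

(* The (0,1)-form \sum_k w_k d\bar z_k is the family w of its coefficients. *)
Definition box_b (R : realType) (w : 'I_3 -> G R -> R[i]) :
    'I_3 -> G R -> R[i] :=
  fun k => box k (w k).

Definition form_dzbar (R : realType) (k : 'I_3) (f : G R -> R[i]) :
    'I_3 -> G R -> R[i] :=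
  fun j g => if j == k then f g else 0.

Definition functional (R : realType) : Type := (G R -> R[i]) -> R[i].

(* Derivatives of a distribution, and its product with a smooth function, by
   transposition in the bilinear pairing <u, phi> = \int_G u phi. *)
Definition ddz (R : realType) (j : 'I_3) (T : functional R) : functional R :=
  fun phi => - T (dz j phi).

Definition ddzbar (R : realType) (j : 'I_3) (T : functional R) :
    functional R :=
  fun phi => - T (dzbar j phi).

Definition ddt (R : realType) (T : functional R) : functional R :=
  fun phi => - T (dt phi).

Definition dmul (R : realType) (a : G R -> R[i]) (T : functional R) :
    functional R :=
  fun phi => T (fun g => a g * phi g).

Definition dZ (R : realType) (j : 'I_3) (T : functional R) : functional R :=
  fun phi => ddz j T phi - dmul (Zcoef j) (ddt T) phi.

Definition dZbar (R : realType) (j : 'I_3) (T : functional R) : functional R :=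
  fun phi => ddzbar j T phi + dmul (Zbarcoef j) (ddt T) phi.

Definition dbox (R : realType) (k : 'I_3) (T : functional R) : functional R :=
  box_expr (@dZ R) (@dZbar R) k T.

Definition functional_of (R : realType) (u : G R -> R) : functional R :=
  fun phi => intG (fun g => (u g)%:C * phi g).

Definition fundamental_solution (R : realType) (k : 'I_3) (u : G R -> R) :
    Prop :=
  loc_integrable u /\
  forall phi, test_fun phi ->
    dbox k (functional_of u) phi = phi (pt (fun=> 0) 0).

Definition conv (R : realType) (u : G R -> R) (f : G R -> R[i]) (g : G R) :
    R[i] :=
  intG (fun h => (u (mulG g (invG h)))%:C * f h).

Definition solvable_by_conv (R : realType) (k : 'I_3) (u : G R -> R) : Prop :=
  forall f, test_fun f ->
    smooth (conv u f) /\
    box_b (form_dzbar k (conv u f)) = form_dzbar k f.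

Definition kernel_integrand (R : realType) (g : G R) (r : R) : R :=
  let z'2 := Normc.normc (zc g 0) ^+ 2 + Normc.normc (zc g 1) ^+ 2 in
  let z32 := Normc.normc (zc g 2) ^+ 2 in
  (`|ln r| * (1 - r) ^+ 2)^-1 *
  complex.Re
    (((z'2 * ((1 + r) / (1 - r)) + z32 * (2 / `|ln r|)) +i* tc g) ^- 3).

Definition N (R : realType) (g : G R) : R :=
  8 / pi ^+ 4 *
  Rintegral (@lebesgue_measure R) `]0, 1[ (kernel_integrand g).

(* Main.v *)
Require Import Defs.
From HB Require Import structures.
From mathcomp Require Import all_boot all_order all_algebra.
From mathcomp Require Import complex.
From mathcomp Require Import all_classical all_reals all_analysis.
From mathcomp Require Import measurable_realfun.
From mathcomp Require Import ring lra.
Set Implicit Arguments.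
Unset Strict Implicit.
Unset Printing Implicit Defensive.
Import Order.TTheory GRing.Theory Num.Theory.
Import numFieldNormedType.Exports.
Local Open Scope classical_set_scope.
Local Open Scope ring_scope.

(** For k < 2 the brackets [Z_j, Zbar_j] = 2i sigma_j d/dt cancel in Box_k: two of
them enter with opposite signs and the third one is 0. What remains is the
real operator

    L = - 1/4 sum_v (D_v + c_v D_t)^2,

the sum being over the six coordinate directions v of C^3, with linear
coefficients c_v that make D_v + c_v D_t invariant under right translations.
It acts separately on real and imaginary parts, so that it suffices to show
that the integral of N (L f) is f(0) for a real test function f.

Put l = - ln r, a = (1 + r) / (1 - r), b = 2 / l, w = 1 / (l (1 - r)^2) and
P = a |z'|^2 + b |z_3|^2. The kernel comes from the Mehler formula, and this is
visible in one identity (L_Ecos, is_derive_Q): for every frequency tau,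

    L (w tau^2 e^(-tau P) cos (tau t)) =
      d/dr (tau^3 (2 r w) e^(-tau P) cos (tau t)).

Integrate it against f over the slab p < r < q, moving L onto f by parts
(segment_identity). Only the two ends of the slab remain. At r -> 0 the
boundary term vanishes (heat_slice_near0); at r -> 1 the Gaussian concentrates
on the axis z = 0 (heat_slice_near1). Hence (fixed_tau)

    tau^2 int_0^1 int_G w e^(-tau P) cos (tau t) L f = (pi^3 / 4) fhat(tau),

where fhat(tau) is the integral of cos (tau t) f(0, t). Now multiply by
e^(-eps tau) and integrate over tau > 0 (eps_identity). On the left the Laplace
transform of tau^2 cos (tau t) produces 2 Re (P + eps + i t)^-3, on the right
that of cos (tau t) produces the Poisson kernel eps / (eps^2 + t^2). For
eps -> 0 the right side tends to pi^4 / 4 times f(0), and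
int_0^1 int_G w Re (P + i t)^-3 L f = (pi^4 / 8) f(0): this is N_pairing, with
the constant 8 / pi^4.

All exchanges of limits and integrals rest on one majorant, a product of
functions of one variable with the integrable singularity |x|^(-3/4). Since
b <= a and |Re (A + i t)^-3| <= A^(-9/4) |t|^(-3/4), the integrand of the kernel
is at most w b^(-9/4) |z|^(-9/2) |t|^(-3/4), where |z|^(-9/2) is at most the
product of the |x_i|^(-3/4) over the six real coordinates of z, and elementary
bounds on ln r give w b^(-9/4) <= r^(-3/4) (1 - r)^(-3/4) (weight_beta,
core_domination, dom_re3). This also shows that N is locally integrable.

For the convolution, h |-> g h^-1 preserves the measure, so N * f at g is the
integral of N(w) f(w^-1 g) in w: derivatives fall on f and N * f is smooth. As
a function of g or as a function of w, f(w^-1 g) has the same image under the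
square of a right-invariant field (fld2_right, fld2_left); hence L (N * f) at g
is the pairing of N with L of w |-> f(w^-1 g), which is f(g) (L_gconv). *)

(** * Measure-preserving maps and products of measures *)

Section mpres.
Context d (T : measurableType d) (R : realType).

Definition mpres (mu : set T -> \bar R) (phi : T -> T) : Prop :=
  measurable_fun setT phi /\
  forall A, measurable A -> mu (phi @^-1` A) = mu A.

Lemma mpres_comp (mu : set T -> \bar R) (p q : T -> T) :
  mpres mu p -> mpres mu q -> mpres mu (p \o q).
Proof.
move=> [mp pE] [mq qE]; split; first exact: measurableT_comp.
move=> A mA; rewrite comp_preimage qE ?pE//.
by rewrite -[X in measurable X]setTI; exact: mp.
Qed.

Lemma mpres_ge0_integral (mu : {measure set T -> \bar R}) phi (f : T -> \bar R) :
  mpres mu phi -> measurable_fun [set: T] f -> (forall x, 0 <= f x)%E ->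
  (\int[mu]_x f (phi x) = \int[mu]_x f x)%E.
Proof.
move=> [mphi phiE] mf f0.
have := @ge0_integral_pushforward _ _ _ _ R _ mphi mu setT f measurableT mf
  (fun y _ => f0 y).
rewrite preimage_setT => <-; apply: eq_measure_integral => A mA _.
exact: phiE.
Qed.

Lemma mpres_integral (mu : {measure set T -> \bar R}) phi (f : T -> \bar R) :
  mpres mu phi -> measurable_fun [set: T] f ->
  (\int[mu]_x f (phi x) = \int[mu]_x f x)%E.
Proof.
move=> H mf; rewrite integralE [RHS]integralE; congr (_ - _)%E.
- have -> : (fun x => f (phi x))^\+%E = (f^\+ \o phi)%E.
    by exact: (funepos_comp f phi).
  by apply: (@mpres_ge0_integral mu phi (f^\+)%E H) => //; exact: measurable_funepos.
- have -> : (fun x => f (phi x))^\-%E = (f^\- \o phi)%E.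
    by exact: (funeneg_comp f phi).
  by apply: (@mpres_ge0_integral mu phi (f^\-)%E H) => //; exact: measurable_funeneg.
Qed.

Lemma mpres_Rintegral (mu : {measure set T -> \bar R}) phi (f : T -> R) :
  mpres mu phi -> measurable_fun setT f ->
  Rintegral mu setT (fun x => f (phi x)) = Rintegral mu setT f.
Proof.
move=> H mf; congr fine.
apply: (@mpres_integral _ _ (EFin \o f) H); exact/measurable_EFinP.
Qed.

Lemma mpres_integrable (mu : {measure set T -> \bar R}) phi (f : T -> R) :
  mpres mu phi -> mu.-integrable setT (EFin \o f) ->
  mu.-integrable setT (EFin \o (fun x => f (phi x))).
Proof.
move=> H /integrableP[/= mf fi]; apply/integrableP; split.
  by apply: (measurableT_comp (f := EFin \o f)) => //; case: H.
rewrite (@mpres_ge0_integral _ _ (fun x => `|(f x)%:E|)%E H) //.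
exact: measurableT_comp.
Qed.

End mpres.

Section mpres_prod.
Context d1 d2 (T1 : measurableType d1) (T2 : measurableType d2) (R : realType).
Variables (m1 : {sigma_finite_measure set T1 -> \bar R})
          (m2 : {sigma_finite_measure set T2 -> \bar R}).

(** Fubini for skew products: the second coordinate may be moved by a map
    that depends on the first one, as the translations of the group do with t. *)
Lemma mpres_prod (p : T1 -> T1) (q : T1 -> T2 -> T2) :
  mpres m1 p -> measurable_fun setT (fun z : T1 * T2 => q z.1 z.2) ->
  (forall x, mpres m2 (q x)) ->
  mpres (m1 \x m2)%E (fun z : T1 * T2 => (p z.1, q z.1 z.2)).
Proof.
move=> [mp pE] mq qE.
have mphi : measurable_fun setT (fun z : T1 * T2 => (p z.1, q z.1 z.2)).
  apply/measurable_fun_pairP; split => //=.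
  by apply: (measurableT_comp mp); exact: measurable_fst.
split => // A mA; rewrite /product_measure1/=.
rewrite -(@mpres_ge0_integral _ _ _ m1 p (m2 \o xsection A)) //.
- apply: eq_integral => x _ /=.
  have mx : measurable (xsection A (p x)) by exact: measurable_xsection.
  rewrite -((qE x).2 _ mx).
  by congr (m2 _); apply/seteqP; split => y; rewrite /xsection /= !inE /=.
- exact: measurable_fun_xsection.
Qed.

Lemma integrable_prod (f : T1 -> R) (g : T2 -> R) :
  m1.-integrable setT (EFin \o f) -> m2.-integrable setT (EFin \o g) ->
  (m1 \x m2)%E.-integrable setT (EFin \o (fun z => f z.1 * g z.2)).
Proof.
move=> /integrableP[/= mf fi] /integrableP[/= mg gi].
have m : measurable_fun setT (EFin \o (fun z : T1 * T2 => f z.1 * g z.2)).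
  apply/measurable_EFinP; apply: measurable_funM.
    by apply: (measurableT_comp (f := f)); [exact/measurable_EFinP|exact: measurable_fst].
  by apply: (measurableT_comp (f := g)); [exact/measurable_EFinP|exact: measurable_snd].
apply/integrable12ltyP => //=.
have E x : (\int[m2]_y `|f x * g y|%:E = `|f x|%:E * \int[m2]_y `|g y|%:E)%E.
  under eq_integral => y _ do rewrite normrM EFinM.
  rewrite ge0_integralZl //.
  by apply/measurable_EFinP; apply: measurableT_comp => //; exact/measurable_EFinP.
under eq_integral do rewrite E.
rewrite ge0_integralZr //; first last.
- exact: integral_ge0.
- by apply/measurable_EFinP; apply: measurableT_comp => //; exact/measurable_EFinP.
by apply: lte_mul_pinfty => //; [exact: integral_ge0|rewrite ge0_fin_numE//; exact: integral_ge0].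
Qed.

Lemma Rintegral_prod12 (F : T1 * T2 -> R) :
  (m1 \x m2)%E.-integrable setT (EFin \o F) ->
  Rintegral (m1 \x m2)%E setT F =
  Rintegral m1 setT (fun x => Rintegral m2 setT (fun y => F (x, y))).
Proof.
move=> iF; rewrite /Rintegral -integral12_prod_meas1 //; congr fine.
apply: ae_eq_integral => //.
- exact: (measurable_int _ (integrable_fubini_F iF)).
- apply/measurable_EFinP.
  apply: (measurableT_comp (f := fine)); first exact: fine_measurable.
  exact: (measurable_int _ (integrable_fubini_F iF)).
have := ae_integrable1 iF; apply: filterS => x /= ix _.
rewrite fineK //; exact: integrable_fin_num.
Qed.

Lemma Rintegral_prod21 (F : T1 * T2 -> R) :
  (m1 \x m2)%E.-integrable setT (EFin \o F) ->
  Rintegral (m1 \x m2)%E setT F =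
  Rintegral m2 setT (fun y => Rintegral m1 setT (fun x => F (x, y))).
Proof.
move=> iF; rewrite /Rintegral -integral21_prod_meas1 //; congr fine.
apply: ae_eq_integral => //.
- exact: (measurable_fubini_G iF).
- apply/measurable_EFinP.
  apply: (measurableT_comp (f := fine)); first exact: fine_measurable.
  exact: (measurable_fubini_G iF).
have := ae_integrable2 iF; apply: filterS => x /= ix _.
rewrite fineK //; exact: integrable_fin_num.
Qed.

Lemma Rintegral_prod (f : T1 -> R) (g : T2 -> R) :
  m1.-integrable setT (EFin \o f) -> m2.-integrable setT (EFin \o g) ->
  Rintegral (m1 \x m2)%E setT (fun z => f z.1 * g z.2) =
  Rintegral m1 setT f * Rintegral m2 setT g.
Proof.
move=> fi gi; rewrite Rintegral_prod12; last exact: integrable_prod.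
under eq_Rintegral => x _ do rewrite /= RintegralZl//.
by rewrite RintegralZr.
Qed.

End mpres_prod.

Section prodm.
Context d1 d2 (T1 : measurableType d1) (T2 : measurableType d2) (R : realType).
Variables (m1 : {sigma_finite_measure set T1 -> \bar R})
          (m2 : {sigma_finite_measure set T2 -> \bar R}).

(** The product under a name of its own, which carries the sigma-finite
    structure that iterated products require. *)
Definition prodm : set (T1 * T2) -> \bar R := (m1 \x m2)%E.

HB.instance Definition _ := Measure.on prodm.

Lemma prodm_sigma_finite : sigma_finite setT prodm.
Proof.
have [F FT Foo] := sigma_finiteT m1; have [H HT Hoo] := sigma_finiteT m2.
pose K (k : nat) : set (T1 * T2) :=
  if unpickle k is Some p then F (p : nat * nat).1 `*` H p.2 else set0.
exists K.
  apply/seteqP; split => // -[x y] _.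
  have : setT x by []. rewrite FT => -[i _ Fx].
  have : setT y by []. rewrite HT => -[j _ Hy].
  by exists (pickle (i, j)) => //; rewrite /K pickleK.
move=> k; rewrite /K; case: unpickle => [[i j]|] /=; last by split => //; rewrite measure0.
have [mF ltF] := Foo i; have [mH ltH] := Hoo j.
split; first exact: measurableX.
rewrite [X in (X < _)%E]product_measure1E //; apply: lte_mul_pinfty => //.
by rewrite ge0_fin_numE.
Qed.

HB.instance Definition _ :=
  Measure_isSigmaFinite.Build _ _ _ prodm prodm_sigma_finite.
End prodm.

Section leb_mpres.
Context (R : realType).
Notation leb := (@lebesgue_measure R).

Lemma mpres_shift (c : R) : mpres leb (fun x : R => x + c).
Proof.
have mphi : measurable_fun setT (fun x : R => x + c) by exact: measurable_funD.
split => // A mA.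
pose mu := [the {measure set (measurableTypeR R) -> \bar R} of @pushforward _ _ (measurableTypeR R) (measurableTypeR R) R leb (fun x : R => x + c : measurableTypeR R)].
apply/esym; apply: (@lebesgue_measure_unique R (mu mphi)) => // X [[a b] /= _ <-].
rewrite /pushforward (_ : _ @^-1` _ = `]a - c, b - c]%classic); last first.
  by apply/seteqP; split => x /=; rewrite !in_itv /= ltrBlDr lerBrDr.
by rewrite !lebesgue_measure_itv /= !lte_fin ltrD2r -!EFinB opprB addrA subrK.
Qed.

Lemma mpres_opp : mpres leb (fun x : R => - x).
Proof.
have mphi : measurable_fun setT (fun x : R => - x) by exact: measurableT_comp.
split => // A mA.
pose mu := [the {measure set (measurableTypeR R) -> \bar R} of @pushforward _ _ (measurableTypeR R) (measurableTypeR R) R leb (fun x : R => - x : measurableTypeR R)].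
apply/esym; apply: (@lebesgue_measure_unique R (mu mphi)) => // X [[a b] /= _ <-].
rewrite /pushforward (_ : _ @^-1` _ = `[- b, - a[%classic); last first.
  by apply/seteqP; split => x /=; rewrite !in_itv /= ltrNr lerNl andbC.
by rewrite !lebesgue_measure_itv /= !lte_fin ltrN2 -!EFinB opprK addrC.
Qed.

End leb_mpres.

Section caratheodory.
Context d (T : measurableType d) (R : realType).

(** The limit of the functions f (x, floor (n y) / n), each of which is
    measurable because the second argument takes countably many values. *)
Lemma measurable_caratheodory (f : T * R -> R) :
  (forall q, measurable_fun setT (fun x => f (x, q))) ->
  (forall x, continuous (fun y : R => f (x, y))) ->
  measurable_fun setT f.
Proof.
move=> mf cf.
(* y rounded down to a multiple of 1 / (n + 1) *)
pose fn (n : nat) (z : T * R) : R :=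
  f (z.1, (Num.floor (z.2 * n.+1%:R))%:~R / n.+1%:R).
apply: (@measurable_fun_cvg _ _ _ _ fn f).
- move=> n _ A mA; rewrite setTI.
  rewrite (_ : _ @^-1` _ = \bigcup_(k : int)
     ([set x | A (f (x, k%:~R / n.+1%:R))] `*`
      [set y : R | Num.floor (y * n.+1%:R) = k])); last first.
    apply/seteqP; split => [[x y] /= Axy|[x y] [k _ [/= Axk kE]]].
      by exists (Num.floor (y * n.+1%:R)) => //; split.
    by rewrite /fn /= kE.
  apply: countable_bigcupT_measurable => // k; apply: measurableX.
    by rewrite -[X in measurable X]setTI; exact: mf.
  rewrite (_ : [set y | _] = `[k%:~R / n.+1%:R, (k + 1)%:~R / n.+1%:R[%classic) //.
  apply/seteqP; split => y /=; rewrite in_itv /=.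
    move=> kE; rewrite ler_pdivrMr // ltr_pdivlMr //.
    by rewrite -kE floor_le_tmp floorD1_gt.
  rewrite ler_pdivrMr // ltr_pdivlMr // => H.
  exact: floor_def.
- move=> [x y] _; rewrite /fn /=.
  apply: (@cvg_comp _ _ _ (fun n : nat => (Num.floor (y * n.+1%:R))%:~R / n.+1%:R)
    (fun q => f (x, q)) _ (nbhs y)); last exact: cf.
  apply/cvgrPdist_le => e e0.
  near=> n.
  have n0 : 0 < n.+1%:R :> R by [].
  have -> : y - (Num.floor (y * n.+1%:R))%:~R / n.+1%:R =
    (y * n.+1%:R - (Num.floor (y * n.+1%:R))%:~R) / n.+1%:R.
    by rewrite mulrBl mulfK // gt_eqF.
  rewrite ger0_norm; last by rewrite divr_ge0 // subr_ge0 floor_le.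
  rewrite ler_pdivrMr //.
  apply: (@le_trans _ _ 1).
    rewrite lerBlDr addrC -(intrD _ _ 1) ltW// floorD1_gt //.
  rewrite -ler_pdivrMl // mulr1; near: n.
  exists (Num.trunc e^-1) => // n /= ln.
  apply/ltW/(lt_le_trans (truncnS_gt _)).
  by rewrite ler_nat ltnS.
Unshelve. all: by end_near.
Qed.
End caratheodory.

(** * Directional calculus in a normed space *)

Lemma norm_diff_le (R : realFieldType) (e p q r t : R) :
  `|p - q| < e / 2 -> `|r - t| < e / 2 -> q = t -> `|p - r| <= e.
Proof.
move=> Hp Hr qt; rewrite -(subrKA q) {2}qt.
apply: (le_trans (ler_normD _ _)); rewrite [`|t - r|]distrC.
by rewrite [leRHS]splitr lerD // ltW.
Qed.

Section dircalc.
Context (R : realType) (V : normedModType R).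
Implicit Types (f g : V -> R) (u v w x : V).

Lemma is_deriveE f x v (l : R) : is_derive x v f l -> 'D_v f x = l.
Proof. by move=> H; exact: derive_val. Qed.

Lemma is_derive_ex f x v (l : R) : is_derive x v f l -> derivable f x v.
Proof. by move=> H; exact: ex_derive. Qed.

Lemma line_is_derive f x v (s : R) : derivable f (x + s *: v) v ->
  is_derive s 1 (fun s => f (x + s *: v)) ('D_v f (x + s *: v)).
Proof.
move=> df.
have E : (fun h : R => h^-1 *: (f (x + (h *: 1 + s) *: v) - f (x + s *: v))) =
   (fun h : R => h^-1 *: (f (h *: v + (x + s *: v)) - f (x + s *: v))).
  apply/funext => h; congr (_ *: (f _ - _)).
  by rewrite scalerDl /GRing.scale /= mulr1 addrCA.
split.
- by rewrite /derivable /= E; exact: df.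
- by rewrite /derive /= E.
Qed.

Lemma mvt_line f x v (h : R) : (forall y, derivable f y v) ->
  exists2 c : R, `|c| <= `|h| & f (x + h *: v) - f x = h * 'D_v f (x + c *: v).
Proof.
move=> df.
pose F s := f (x + s *: v).
have dF (s : R) : is_derive s 1 F ('D_v f (x + s *: v)) by exact: line_is_derive.
have cF : continuous F.
  move=> s; apply: differentiable_continuous; apply/derivable1_diffP.
  by case: (dF s).
have F0 : F 0 = f x by rewrite /F scale0r addr0.
have [h0|h0] := leP 0 h.
  have [c] := MVT_segment h0 (fun s _ => dF s) (continuous_subspaceT cF).
  rewrite F0 subr0 in_itv /= => /andP[c0 ch] E; exists c.
    by rewrite !ger0_norm.
  by rewrite mulrC.
have [c] := MVT_segment (ltW h0) (fun s _ => dF s) (continuous_subspaceT cF).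
rewrite F0 sub0r in_itv /= => /andP[c0 ch] E; exists c.
  by rewrite (ler0_norm ch) ler0_norm ?lerN2 // ltW.
by rewrite -[LHS]opprB E mulrN opprK mulrC.
Qed.

Lemma is_derive_lim f x v (l : R) :
  (forall e, 0 < e -> exists2 d, 0 < d & forall h : R, h != 0 -> `|h| < d ->
     `|l - h^-1 * (f (h *: v + x) - f x)| <= e) ->
  is_derive x v f l.
Proof.
move=> H.
have cv : h^-1 *: (f (h *: v + x) - f x) @[h --> 0^'] --> l.
  apply/cvgrPdist_le => e e0; have [d d0 Hd] := H _ e0.
  exists d => //= h /= + h0; rewrite sub0r normrN => hd.
  exact: Hd.
split; first by apply/cvg_ex; exists l.
by apply: cvg_lim.
Qed.

Lemma is_derive_affine f (A : V -> V) x v L : derivable f (A x) L ->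
  (forall h : R, A (h *: v + x) = h *: L + A x) ->
  is_derive x v (fun y => f (A y)) ('D_L f (A x)).
Proof.
move=> df AE.
have E : (fun h : R => h^-1 *: (f (A (h *: v + x)) - f (A x))) =
   (fun h : R => h^-1 *: (f (h *: L + A x) - f (A x))).
  by apply/funext => h; rewrite AE.
split.
- by rewrite /derivable /= E; exact: df.
- by rewrite /derive /= E.
Qed.

Lemma continuous_dist f x (e : R) : {for x, continuous f} -> 0 < e ->
  exists2 d : R, 0 < d & forall y, `|y - x| < d -> `|f x - f y| < e.
Proof.
move=> cf e0.
move/cvgrPdist_lt : (cf) => /(_ _ e0) /nbhs_normP [d /= d0 Hd]; exists d => //.
by move=> y yd; apply: Hd; rewrite /= distrC.
Qed.

Definition C1 f := forall v, (forall y, derivable f y v) /\ continuous ('D_v f).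

(** Two applications of the mean value theorem, along v and along w, turn the
    difference quotient into values of the derivatives at points near x. This
    avoids total differentiability. *)
Lemma derive_lin f x v w (a b : R) : C1 f ->
  is_derive x (a *: v + b *: w) f (a * 'D_v f x + b * 'D_w f x).
Proof.
move=> C1f; have [dv cv] := C1f v; have [dw cw] := C1f w.
apply: is_derive_lim => e e0.
have K0 : 0 < 1 + `|a| + `|b| by rewrite ltr_wpDr // ltr_wpDr.
have M0 : 0 < 1 + `|a| * `|v| + `|b| * `|w|.
  by rewrite ltr_wpDr ?mulr_ge0 // ltr_wpDr // mulr_ge0.
have e'0 : 0 < e / (1 + `|a| + `|b|) by rewrite divr_gt0.
have [d1 d10 H1] := continuous_dist (cv x) e'0.
have [d2 d20 H2] := continuous_dist (cw x) e'0.
(* both intermediate points are within |h| (|a| |v| + |b| |w|) of x *)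
exists (Num.min d1 d2 / (1 + `|a| * `|v| + `|b| * `|w|)).
  by rewrite divr_gt0 // lt_min d10 d20.
move=> h h0; rewrite ltr_pdivlMr // lt_min => /andP[hd1 hd2].
have [c1 c1h E1] := mvt_line (x + (h * b) *: w) (h * a) dv.
have [c2 c2h E2] := mvt_line x (h * b) dw.
have -> : h^-1 * (f (h *: (a *: v + b *: w) + x) - f x) =
    a * 'D_v f (x + (h * b) *: w + c1 *: v) + b * 'D_w f (x + c2 *: w).
  have -> : h *: (a *: v + b *: w) + x = x + (h * b) *: w + (h * a) *: v.
    by rewrite scalerDr !scalerA addrC -addrA [_ *: v + _]addrC.
  rewrite -[f _ - f x](subrKA (f (x + (h * b) *: w))) E1 E2 -!mulrA -mulrDr.
  by rewrite mulKf.
have y1 : `|(x + (h * b) *: w + c1 *: v) - x| < d1.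
  apply: le_lt_trans hd1.
  rewrite addrAC [x + _ - x]addrAC subrr add0r.
  apply: (le_trans (ler_normD _ _)); rewrite !normrZ !mulrDr mulr1.
  have : `|c1| * `|v| <= `|h| * (`|a| * `|v|).
    by rewrite mulrA -normrM ler_wpM2r.
  rewrite -mulrA; have := normr_ge0 h; lra.
have y2 : `|(x + c2 *: w) - x| < d2.
  apply: le_lt_trans hd2.
  rewrite addrAC subrr add0r normrZ !mulrDr mulr1.
  have : `|c2| * `|w| <= `|h| * (`|b| * `|w|).
    by rewrite mulrA -normrM ler_wpM2r.
  have : 0 <= `|h| * (`|a| * `|v|) by rewrite !mulr_ge0.
  have := normr_ge0 h; lra.
have {}H1 := H1 _ y1; have {}H2 := H2 _ y2.
rewrite opprD addrACA -!mulrBr.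
apply: (le_trans (ler_normD _ _)); rewrite !normrM.
have {}H1 := ler_wpM2l (normr_ge0 a) (ltW H1).
have {}H2 := ler_wpM2l (normr_ge0 b) (ltW H2).
apply: (le_trans (lerD H1 H2)); rewrite -mulrDl mulrCA ger_pMr //.
rewrite ler_pdivrMr // mul1r; lra.
Qed.

Lemma derive_scale f x v (a : R) : C1 f -> 'D_(a *: v) f x = a * 'D_v f x.
Proof.
move=> C1f; have := derive_lin x v v a 0 C1f.
rewrite scale0r addr0 mul0r addr0 => H; exact: derive_val.
Qed.

Lemma derive_add f x v w : C1 f -> 'D_(v + w) f x = 'D_v f x + 'D_w f x.
Proof.
move=> C1f; have := derive_lin x v w 1 1 C1f.
rewrite !scale1r !mul1r => H; exact: derive_val.
Qed.

(** The mean value theorem along v for the first difference along w, then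
    along w for the derivative. *)
Lemma second_difference f x v w (h : R) : h != 0 -> C1 f -> C1 ('D_v f) ->
  exists2 y, `|y - x| <= `|h| * (`|v| + `|w|) &
    (f (x + h *: v + h *: w) - f (x + h *: v)) - (f (x + h *: w) - f x)
    = h * (h * 'D_w ('D_v f) y).
Proof.
move=> h0 C1f C1Df.
pose F y := f (y + h *: w) - f y.
have dF y : is_derive y v F ('D_v f (y + h *: w) - 'D_v f y).
  apply: is_deriveB.
    apply: (@is_derive_affine f (fun y => y + h *: w)).
      exact: (C1f v).1.
    by move=> k; rewrite addrA.
  by apply: DeriveDef => //; exact: (C1f v).1.
have [c1 c1h E1] := mvt_line x h (fun y => is_derive_ex (dF y)).
have [c2 c2h E2] := mvt_line (x + c1 *: v) h (C1Df w).1.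
exists (x + c1 *: v + c2 *: w); last first.
  move: E1; rewrite /F => ->.
  by rewrite (is_deriveE (dF _)) E2.
rewrite addrAC [x + _ - x]addrAC subrr add0r mulrDr.
apply: (le_trans (ler_normD _ _)); rewrite !normrZ.
by apply: lerD; rewrite ler_wpM2r.
Qed.

(** The second difference is symmetric in v and w, and it is h^2 times a value
    of either mixed derivative at a point near x. *)
Lemma derive_sym f x v w : C1 f -> C1 ('D_v f) -> C1 ('D_w f) ->
  'D_w ('D_v f) x = 'D_v ('D_w f) x.
Proof.
move=> C1f Cv Cw; apply/eqP; rewrite -subr_eq0 -normr_le0.
apply/ler_addgt0Pl => e e0; rewrite addr0.
have e2 : 0 < e / 2 by rewrite divr_gt0.
have [d1 d10 H1] := continuous_dist ((Cv w).2 x) e2.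
have [d2 d20 H2] := continuous_dist ((Cw v).2 x) e2.
have M0 : 0 < 1 + `|v| + `|w| by rewrite ltr_wpDr // ltr_wpDr.
have m0 : 0 < Num.min d1 d2 by rewrite lt_min d10 d20.
have [h h0 hM] : exists2 h : R, 0 < h & h * (`|v| + `|w|) < Num.min d1 d2.
  exists (Num.min d1 d2 / (1 + `|v| + `|w|)); first by rewrite divr_gt0.
  by rewrite mulrAC ltr_pdivrMr // ltr_pM2l // -addrA ltrDr.
have [y1 y1h E1] := second_difference x w (lt0r_neq0 h0) C1f Cv.
have [y2 y2h E2] := second_difference x v (lt0r_neq0 h0) C1f Cw.
have E : 'D_w ('D_v f) y1 = 'D_v ('D_w f) y2.
  apply: (mulfI (lt0r_neq0 h0)); apply: (mulfI (lt0r_neq0 h0)).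
  have E0 (p q r t : R) : (p - q) - (r - t) = (p - r) - (q - t) by ring.
  have Ex : x + h *: v + h *: w = x + h *: w + h *: v by rewrite addrAC.
  exact: (etrans (esym E1) (etrans (etrans (congr1 (fun z => f z - _ - _) Ex) (E0 _ _ _ _)) E2)).
move: hM; rewrite lt_min => /andP[hd1 hd2].
rewrite (ger0_norm (ltW h0)) in y1h; rewrite (ger0_norm (ltW h0)) [`|w| + _]addrC in y2h.
have {}H1 := H1 _ (le_lt_trans y1h hd1).
have {}H2 := H2 _ (le_lt_trans y2h hd2).
exact: (norm_diff_le H1 H2 E).
Qed.

Fixpoint Ck (n : nat) f : Prop :=
  continuous f /\
  if n is n'.+1 then forall v, (forall y, derivable f y v) /\ Ck n' ('D_v f)
  else True.

(** Smoothness by iterated directional derivatives, as for test functions; the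
    grading by [Ck] is what inductions on the order run on. *)
Definition Coo f := forall n, Ck n f.

Lemma CkW n f : Ck n.+1 f -> Ck n f.
Proof.
elim: n f => [|n IH] f [cf H]; split => // v; have [dv Hv] := H v.
by split => //; exact: IH.
Qed.

Lemma CooP f : Coo f <->
  continuous f /\ forall v, (forall y, derivable f y v) /\ Coo ('D_v f).
Proof.
split => [H|[cf H]].
  split; first by have [] := H 0%N.
  move=> v; split; first by have [_ /(_ v) []] := H 1%N.
  by move=> n; have [_ /(_ v) []] := H n.+1.
case => [|n]; split => // v; have [dv Hv] := H v; split => //.
Qed.

Lemma Coo_cont f : Coo f -> continuous f. Proof. by move/CooP => []. Qed.
Lemma Coo_derivable f v y : Coo f -> derivable f y v.
Proof. by move/CooP => [_ /(_ v) []]. Qed.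
Lemma Coo_D f v : Coo f -> Coo ('D_v f).
Proof. by move/CooP => [_ /(_ v) []]. Qed.
Lemma Coo_C1 f : Coo f -> C1 f.
Proof.
move=> H v; split; first by move=> y; exact: Coo_derivable.
exact/Coo_cont/Coo_D.
Qed.

Lemma CkD n f g : Ck n f -> Ck n g -> Ck n (f \+ g).
Proof.
elim: n f g => [|n IH] f g [cf Hf] [cg Hg]; split => //;
  try by move=> x; apply: continuousD; [exact: cf|exact: cg].
move=> v; have [df Df] := Hf v; have [dg Dg] := Hg v.
split; first by move=> y; exact: derivableD.
rewrite (_ : 'D_v _ = 'D_v f \+ 'D_v g); first exact: IH.
by apply/funext => y /=; rewrite -deriveD.
Qed.

Lemma CkM n f g : Ck n f -> Ck n g -> Ck n (f \* g).
Proof.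
elim: n f g => [|n IH] f g Hf Hg.
  split => // x; apply: continuousM; [exact: Hf.1|exact: Hg.1].
split; first by move=> x; apply: continuousM; [exact: Hf.1|exact: Hg.1].
have f' := CkW Hf; have g' := CkW Hg.
move: Hf Hg => [cf Hf] [cg Hg].
move=> v; have [df Df] := Hf v; have [dg Dg] := Hg v.
split; first by move=> y; exact: derivableM.
rewrite (_ : 'D_v _ = (f \* 'D_v g) \+ (g \* 'D_v f)).
  by apply: CkD; apply: IH.
by apply/funext => y /=; rewrite (deriveM (df y) (dg y)).
Qed.

Lemma Ck_cst n (c : R) : Ck n (fun=> c).
Proof.
elim: n c => [|n IH] c; split => //; try by move=> x; exact: cvg_cst.
move=> v; split; first by move=> y; exact: derivable_cst.
by rewrite (_ : 'D_v _ = fun=> 0) //; apply/funext => y; rewrite derive_cst.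
Qed.

Lemma CooD f g : Coo f -> Coo g -> Coo (f \+ g).
Proof. by move=> Hf Hg n; apply: CkD. Qed.
Lemma CooM f g : Coo f -> Coo g -> Coo (f \* g).
Proof. by move=> Hf Hg n; apply: CkM. Qed.
Lemma Coo_cst (c : R) : Coo (fun=> c).
Proof. by move=> n; exact: Ck_cst. Qed.

Lemma is_derive_linear (l : V -> R) x v :
  (forall (h : R) u, l (h *: v + u) = h * l v + l u) -> is_derive x v l (l v).
Proof.
move=> lE; apply: is_derive_lim => e e0; exists 1 => // h h0 _.
by rewrite lE addrK mulKf // subrr normr0 ltW.
Qed.

Lemma Coo_linear (l : V -> R) :
  continuous l -> (forall (h : R) u v, l (h *: v + u) = h * l v + l u) ->
  Coo l.
Proof.
move=> cl lE; apply/CooP; split => // v.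
have H y : is_derive y v l (l v) by apply: is_derive_linear => h u; exact: lE.
split => //; rewrite (_ : 'D_v l = fun=> l v); first exact: Coo_cst.
by apply/funext => y; rewrite derive_val.
Qed.

(** The direction v of the variable x becomes the fixed direction L v of f,
    whence an induction over the order. *)
Lemma Coo_affine f (A L : V -> V) : Coo f -> continuous A ->
  (forall (h : R) u v, A (h *: v + u) = h *: L v + A u) ->
  Coo (fun x => f (A x)).
Proof.
move=> + cA AE n; elim: n f => [|n IH] f Cf; split => //;
  try by move=> x; apply: continuous_comp; [exact: cA|exact: Coo_cont].
move=> v.
have H y : is_derive y v (fun x => f (A x)) ('D_(L v) f (A y)).
  by apply: is_derive_affine => [|h]; [exact: Coo_derivable|exact: AE].
split => //; rewrite (_ : 'D_v _ = fun x => 'D_(L v) f (A x)).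
  by apply: (IH ('D_(L v) f)); exact: Coo_D.
by apply/funext => y; rewrite derive_val.
Qed.

Definition bsupp f := exists M : R, forall x, M < `|x| -> f x = 0.

Lemma bsuppD f g : bsupp f -> bsupp g -> bsupp (f \+ g).
Proof.
move=> [M HM] [N HN]; exists (Num.max M N) => x; rewrite gt_max => /andP[h1 h2].
by rewrite /= HM // HN // addr0.
Qed.

Lemma bsuppMr f g : bsupp g -> bsupp (f \* g).
Proof. by move=> [M HM]; exists M => x h; rewrite /= HM // mulr0. Qed.

Lemma bsupp_derive f v : bsupp f -> bsupp ('D_v f).
Proof.
move=> [M HM]; exists M => x Mx.
have H : is_derive x v f 0.
  apply: is_derive_lim => e e0.
  have v0 : 0 < 1 + `|v| by rewrite ltr_wpDr.
  (* f vanishes at the points h v + x with |h| below this bound *)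
  exists ((`|x| - M) / (1 + `|v|)); first by rewrite divr_gt0 // subr_gt0.
  move=> h h0; rewrite ltr_pdivlMr // mulrDr mulr1 => hd.
  rewrite (HM x) // HM ?subrr ?mulr0 ?subrr ?normr0 ?ltW //.
  have := lerB_normD x (h *: v); rewrite normrZ [x + _]addrC.
  have := normr_ge0 h; lra.
exact: derive_val.
Qed.

End dircalc.

(** * Haar measure in coordinates *)

Local Open Scope complex_scope.
Section haar.
Context (R : realType).
Notation leb := (@lebesgue_measure R).
Notation RM := (measurableTypeR R).
(** Lebesgue measure with its sigma-finite structure. The products below build
    Haar measure one coordinate at a time, so that Fubini applies at each step. *)
Definition m1 : {sigma_finite_measure set RM -> \bar R} :=
  [the {sigma_finite_measure set _ -> \bar R} of leb].
Definition m2 := [the {sigma_finite_measure set _ -> \bar R} of prodm m1 m1].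
Definition m3 := [the {sigma_finite_measure set _ -> \bar R} of prodm m2 m1].
Definition m4 := [the {sigma_finite_measure set _ -> \bar R} of prodm m3 m1].
Definition m5 := [the {sigma_finite_measure set _ -> \bar R} of prodm m4 m1].
Definition m6 := [the {sigma_finite_measure set _ -> \bar R} of prodm m5 m1].
Definition hm := [the {sigma_finite_measure set _ -> \bar R} of prodm m6 m1].

Lemma haarE : @haar R = hm. Proof. by []. Qed.

(** Tensor products of seven functions of one variable: Gaussians and all the
    majorants have this form, which reduces their integrals to the line. *)
Definition tens7 (f1 f2 f3 f4 f5 f6 f7 : R -> R) (g : G R) : R :=
  f1 g.1.1.1.1.1.1 * f2 g.1.1.1.1.1.2 * f3 g.1.1.1.1.2 * f4 g.1.1.1.2
  * f5 g.1.1.2 * f6 g.1.2 * f7 g.2.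

Notation intble f := (m1.-integrable setT (EFin \o f)).

Section tens.
Variables f1 f2 f3 f4 f5 f6 f7 : R -> R.
Hypotheses (i1 : intble f1) (i2 : intble f2) (i3 : intble f3) (i4 : intble f4)
  (i5 : intble f5) (i6 : intble f6) (i7 : intble f7).

Let t2 (g : R * R) := f1 g.1 * f2 g.2.
Let t3 (g : R * R * R) := t2 g.1 * f3 g.2.
Let t4 (g : R * R * R * R) := t3 g.1 * f4 g.2.
Let t5 (g : R * R * R * R * R) := t4 g.1 * f5 g.2.
Let t6 (g : R * R * R * R * R * R) := t5 g.1 * f6 g.2.

Let it2 : m2.-integrable setT (EFin \o t2).
Proof. by apply: (@integrable_prod _ _ _ _ R m1 m1 f1 f2). Qed.
Let it3 : m3.-integrable setT (EFin \o t3).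
Proof. by apply: (@integrable_prod _ _ _ _ R m2 m1 t2 f3). Qed.
Let it4 : m4.-integrable setT (EFin \o t4).
Proof. by apply: (@integrable_prod _ _ _ _ R m3 m1 t3 f4). Qed.
Let it5 : m5.-integrable setT (EFin \o t5).
Proof. by apply: (@integrable_prod _ _ _ _ R m4 m1 t4 f5). Qed.
Let it6 : m6.-integrable setT (EFin \o t6).
Proof. by apply: (@integrable_prod _ _ _ _ R m5 m1 t5 f6). Qed.

Lemma integrable_tens7 : hm.-integrable setT (EFin \o tens7 f1 f2 f3 f4 f5 f6 f7).
Proof. by apply: (@integrable_prod _ _ _ _ R m6 m1 t6 f7). Qed.

Lemma Rintegral_tens7 : Rintegral hm setT (tens7 f1 f2 f3 f4 f5 f6 f7) =
  Rintegral m1 setT f1 * Rintegral m1 setT f2 * Rintegral m1 setT f3 *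
  Rintegral m1 setT f4 * Rintegral m1 setT f5 * Rintegral m1 setT f6 *
  Rintegral m1 setT f7.
Proof.
rewrite [LHS](@Rintegral_prod _ _ _ _ R m6 m1 t6 f7) //; congr (_ * _).
rewrite [LHS](@Rintegral_prod _ _ _ _ R m5 m1 t5 f6) //; congr (_ * _).
rewrite [LHS](@Rintegral_prod _ _ _ _ R m4 m1 t4 f5) //; congr (_ * _).
rewrite [LHS](@Rintegral_prod _ _ _ _ R m3 m1 t3 f4) //; congr (_ * _).
rewrite [LHS](@Rintegral_prod _ _ _ _ R m2 m1 t2 f3) //; congr (_ * _).
by rewrite [LHS](@Rintegral_prod _ _ _ _ R m1 m1 f1 f2).
Qed.
End tens.

Lemma pair_continuous (U V : topologicalType) (x : U) :
  continuous (fun y : V => (x, y)).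
Proof. by move=> y; apply: cvg_pair; [exact: cvg_cst|exact: cvg_id]. Qed.

Lemma pair_continuousl (U V : topologicalType) (y : V) :
  continuous (fun x : U => (x, y)).
Proof. by move=> x; apply: cvg_pair; [exact: cvg_id|exact: cvg_cst]. Qed.

(** The sigma-algebra is a product one, so measurable_caratheodory is applied
    to one coordinate after the other. *)
Lemma measurable_continuous (f : G R -> R) :
  continuous f -> measurable_fun setT f.
Proof.
have comp (U V W : topologicalType) (p : U -> V) (q : V -> W) :
  continuous p -> continuous q -> continuous (q \o p).
  by move=> cp cq x; apply: continuous_comp; [exact: cp|exact: cq].
move=> cf.
have M1 := @continuous_measurable_fun R.
have M2 (h : R * R -> R) : continuous h -> measurable_fun setT h.
  by move=> ch; apply: measurable_caratheodory => [q|x]; [apply: M1; exact: (comp _ _ _ _ _ (@pair_continuousl _ _ q) ch)|exact: (comp _ _ _ _ _ (@pair_continuous _ _ x) ch)].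
have M3 (h : R * R * R -> R) : continuous h -> measurable_fun setT h.
  by move=> ch; apply: measurable_caratheodory => [q|x]; [apply: M2; exact: (comp _ _ _ _ _ (@pair_continuousl _ _ q) ch)|exact: (comp _ _ _ _ _ (@pair_continuous _ _ x) ch)].
have M4 (h : R * R * R * R -> R) : continuous h -> measurable_fun setT h.
  by move=> ch; apply: measurable_caratheodory => [q|x]; [apply: M3; exact: (comp _ _ _ _ _ (@pair_continuousl _ _ q) ch)|exact: (comp _ _ _ _ _ (@pair_continuous _ _ x) ch)].
have M5 (h : R * R * R * R * R -> R) : continuous h -> measurable_fun setT h.
  by move=> ch; apply: measurable_caratheodory => [q|x]; [apply: M4; exact: (comp _ _ _ _ _ (@pair_continuousl _ _ q) ch)|exact: (comp _ _ _ _ _ (@pair_continuous _ _ x) ch)].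
have M6 (h : R * R * R * R * R * R -> R) : continuous h -> measurable_fun setT h.
  by move=> ch; apply: measurable_caratheodory => [q|x]; [apply: M5; exact: (comp _ _ _ _ _ (@pair_continuousl _ _ q) ch)|exact: (comp _ _ _ _ _ (@pair_continuous _ _ x) ch)].
have M7 (h : R * R * R * R * R * R * R -> R) : continuous h -> measurable_fun setT h.
  by move=> ch; apply: measurable_caratheodory => [q|x]; [apply: M6; exact: (comp _ _ _ _ _ (@pair_continuousl _ _ q) ch)|exact: (comp _ _ _ _ _ (@pair_continuous _ _ x) ch)].
exact: M7.
Qed.

Definition cube (M : R) : set (G R) :=
  (`[-M, M] `*` `[-M, M] `*` `[-M, M] `*` `[-M, M] `*` `[-M, M] `*` `[-M, M]
   `*` `[-M, M])%classic.

Lemma compact_cube M : compact (cube M).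
Proof. by rewrite /cube; repeat apply: compact_setX; apply: segment_compact. Qed.

Lemma normG_le (g : G R) M : `|g| <= M <-> cube M g.
Proof.
rewrite /cube; move: g => [[[[[[x1 x2] x3] x4] x5] x6] x7].
rewrite !prod_normE /= !ge_max !ler_norml !in_itv /=.
by split => [/andP[/andP[/andP[/andP[/andP[/andP[? ?] ?] ?] ?] ?] ?]|[[[[[[-> ->] ->] ->] ->] ->] ->]].
Qed.

Definition ind (M x : R) : R := \1_(`[-M, M]%classic) x.
Definition cube_ind M := tens7 (ind M) (ind M) (ind M) (ind M) (ind M) (ind M) (ind M).

Lemma indE M x : ind M x = if - M <= x <= M then 1 else 0.
Proof. by rewrite /ind indicE mem_setE in_itv /=; case: ifP. Qed.

Lemma ind_ge0 M x : 0 <= ind M x. Proof. by rewrite /ind indicE. Qed.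

Lemma integrable_ind M : intble (ind M).
Proof. exact: (integrable_indic_itv (- M) M true false). Qed.

Lemma cube_indE M g : cube M g -> cube_ind M g = 1.
Proof.
rewrite /cube /cube_ind /tens7 /ind; move: g => [[[[[[x1 x2] x3] x4] x5] x6] x7].
move=> [[[[[[h1 h2] h3] h4] h5] h6] h7]; rewrite !indicE /=.
by rewrite !mem_set //= !mulr1.
Qed.

Lemma cube_ind_ge0 M g : 0 <= cube_ind M g.
Proof. by rewrite /cube_ind /tens7; do 6! (rewrite mulr_ge0 ?ind_ge0 //). Qed.

Lemma bsupp_bounded (f : G R -> R) : continuous f -> bsupp f ->
  exists2 C, 0 <= C & forall g, `|f g| <= C.
Proof.
move=> cf [M HM].
have M0 : cube (Num.max M 0) !=set0.
  by exists 0; apply/normG_le; rewrite normr0 le_max lexx orbT.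
have cnf : {within cube (Num.max M 0), continuous (fun g => `|f g|)}.
  apply: continuous_subspaceT => x; apply: continuous_comp; first exact: cf.
  exact: norm_continuous.
have [c _ Hc] := compact_EVT_max M0 (@compact_cube _) cnf.
exists `|f c| => // g; have [gM|gM] := leP `|g| (Num.max M 0).
  by apply: Hc; apply/mem_set/normG_le.
by rewrite HM ?normr0 // (le_lt_trans _ gM) // le_max lexx.
Qed.

Lemma cube_ind_le (f : G R -> R) C M : 0 <= C -> (forall g, `|f g| <= C) ->
  (forall g, M < `|g| -> f g = 0) -> forall g, `|f g| <= C * cube_ind M g.
Proof.
move=> C0 fC fM g; have [gM|gM] := leP `|g| M.
  by rewrite cube_indE ?mulr1 //; apply/normG_le.
by rewrite fM // normr0 mulr_ge0 // cube_ind_ge0.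
Qed.

Lemma bsupp_dominated (f : G R -> R) : continuous f -> bsupp f ->
  exists C M : R, [/\ 0 <= C, 0 < M & forall g, `|f g| <= C * cube_ind M g].
Proof.
move=> cf [M HM]; have [C C0 HC] := bsupp_bounded cf (ex_intro _ M HM).
exists C, (`|M| + 1); split=> //.
apply: cube_ind_le => // g Mg; apply: HM; apply: le_lt_trans Mg.
by rewrite (le_trans (ler_norm M)) // lerDl.
Qed.

Lemma integrable_dom d (T : measurableType d) (mu : {measure set T -> \bar R})
  (f h : T -> R) : measurable_fun setT f -> (forall x, `|f x| <= h x) ->
  mu.-integrable setT (EFin \o h) -> mu.-integrable setT (EFin \o f).
Proof.
move=> mf fh; apply: le_integrable => //; first exact/measurable_EFinP.
by move=> x _ /=; rewrite lee_fin (le_trans (fh x)) // ler_norm.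
Qed.

Lemma integrable_cube_ind M : hm.-integrable setT (EFin \o cube_ind M).
Proof. by apply: integrable_tens7; exact: integrable_ind. Qed.

Lemma integrable_scale d (T : measurableType d) (mu : {measure set T -> \bar R})
  (c : R) (f : T -> R) : mu.-integrable setT (EFin \o f) ->
  mu.-integrable setT (EFin \o (fun x => c * f x)).
Proof. by move=> fi; have := integrableZl measurableT c fi. Qed.

Lemma integrable_bsupp (f : G R -> R) : continuous f -> bsupp f ->
  hm.-integrable setT (EFin \o f).
Proof.
move=> cf bf; have [C [M [C0 M0 H]]] := bsupp_dominated cf bf.
apply: (@integrable_dom _ _ hm _ _ _ H); first exact: measurable_continuous.
exact/integrable_scale/integrable_cube_ind.
Qed.

Lemma mpres_addG (v : G R) : mpres hm (fun g => g + v).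
Proof.
move: v => [[[[[[v1 v2] v3] v4] v5] v6] v7].
pose p1 (x : R) := x + v1.
pose q (T : Type) (c : R) (x : T) (y : R) := y + c.
have H d (T : measurableType d) (m : {sigma_finite_measure set T -> \bar R}) (p : T -> T) (c : R) :
  mpres m p -> mpres (m \x m1)%E (fun z : T * R => (p z.1, z.2 + c)).
  move=> Hp; apply: (@mpres_prod _ _ _ _ R m m1 p (fun _ y => y + c)) => //.
    exact: measurable_funD.
  by move=> _; exact: mpres_shift.
have := H _ _ m6 _ v7 (H _ _ m5 _ v6 (H _ _ m4 _ v5 (H _ _ m3 _ v4 (H _ _ m2 _ v3
  (H _ _ m1 _ v2 (mpres_shift v1)))))).
by congr mpres; apply/funext => -[[[[[[x1 x2] x3] x4] x5] x6] x7].
Qed.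

Notation L1 f := (hm.-integrable setT (EFin \o f)).
Notation I7 f := (Rintegral hm setT f).

Lemma RhaarE (h : G R -> R) : Rintegral (@haar R) setT h = I7 h.
Proof.
rewrite /Rintegral.
apply: (f_equal fine).
apply: eq_measure_integral.
move=> A mA _.
exact: (f_equal (fun mu => mu A) haarE).
Qed.
Lemma intGE (f : G R -> R[i]) :
  intG f = I7 (fun g => complex.Re (f g)) +i* I7 (fun g => complex.Im (f g)).
Proof.
rewrite /intG.
apply: f_equal2.
exact: RhaarE.
exact: RhaarE.
Qed.

Lemma subset_integral d (T : measurableType d) (mu : {measure set T -> \bar R})
    (A B : set T) (f : T -> \bar R) : (forall x, 0 <= f x)%E -> A `<=` B ->
  (\int[mu]_(x in A) f x <= \int[mu]_(x in B) f x)%E.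
Proof.
move=> f0 AB; rewrite !ge0_integralE //.
apply: le_ereal_sup => _ [h hf <-]; exists h => // x.
apply: (le_trans (hf x)); rewrite !patchE.
case: ifPn => [/set_mem/AB/mem_set -> //|_].
by case: ifPn.
Qed.

Lemma integrable_pushforward d1 d2 (T1 : measurableType d1)
    (T2 : measurableType d2) (mu : {measure set T1 -> \bar R})
    (nu : set T2 -> \bar R) (phi : T1 -> T2) (D : set T2) (f : T2 -> R) :
  measurable_fun setT phi -> (forall A, nu A = mu (phi @^-1` A)) ->
  measurable_fun setT f -> mu.-integrable setT (EFin \o (f \o phi)) ->
  nu.-integrable D (EFin \o f).
Proof.
move=> mphi nuE mf /integrableP[_ fi].
have -> : nu = pushforward mu phi by apply/funext => A; rewrite nuE.
have mfD : measurable_fun D (EFin \o f).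
  by apply: (@measurable_funS _ _ _ _ setT) => //; exact/measurable_EFinP.
apply/integrableP; split => //.
apply: le_lt_trans (subset_integral _ _ (@subsetT _ D)) _ => //.
rewrite ge0_integral_pushforward //.
by apply: measurableT_comp => //; exact/measurable_EFinP.
Qed.

Lemma haar_integrable (D : set (G R)) (f : G R -> R) :
  measurable_fun setT f ->
  L1 f -> (@haar R).-integrable D (EFin \o f).
Proof.
move=> mf fi.
apply: (@integrable_pushforward _ _ _ _ hm (@haar R) idfun D f).
- by move=> _ A mA; rewrite setTI; exact: mA.
- by move=> A; exact: (f_equal (fun mu => mu A) haarE).
- exact: mf.
- exact: fi.
Qed.

Lemma haar_ae (P : G R -> Prop) :
  {ae hm, forall g, P g} -> \forall g \ae @haar R, P g.
Proof.
move=> [A [mA A0 AP]].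
by exists A.
Qed.

Lemma measurable_L1 f : L1 f -> measurable_fun setT f.
Proof. by move/measurable_int/measurable_EFinP. Qed.

(** Restricts to the line s |-> x + s v and applies the theorem in one real
    variable. *)
Lemma derive_under_integral d (T : measurableType d)
  (mu : {measure set T -> \bar R}) (V : normedModType R)
  (f df : T -> V -> R) (x v : V) (b : T -> R) :
  (forall s : R, `|s| < 1 -> mu.-integrable setT (EFin \o (fun w => f w (x + s *: v)))) ->
  (forall w y, is_derive y v (f w) (df w y)) ->
  mu.-integrable setT (EFin \o b) ->
  (forall w (s : R), `|s| < 1 -> `|df w (x + s *: v)| <= b w) ->
  is_derive x v (fun y => Rintegral mu setT (fun w => f w y))
    (Rintegral mu setT (fun w => df w x)).
Proof.
move=> fi fd bi fb.
have I01 : `](-1), 1[%classic (0 : R) by rewrite /= in_itv /= ltrN10 ltr01.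
have dline w (s : R) : is_derive s 1 (fun s => f w (x + s *: v)) (df w (x + s *: v)).
  have H := fd w (x + s *: v).
  have := line_is_derive (is_derive_ex H).
  by rewrite (is_deriveE H).
have pE (s : R) (w : T) : partial1of2 (fun (s : R) (w : T) => f w (x + s *: v)) s w = df w (x + s *: v).
  by rewrite partial1of2E; rewrite (is_deriveE (dline w s)).
have inorm (s : R) : `](-1), 1[%classic s -> `|s| < 1.
  by rewrite /= in_itv /= ltr_norml.
have b0 w : 0 <= b w by apply: le_trans (fb w 0 _); rewrite ?normr0.
have pb (s : R) (w : T) : `](-1), 1[%classic s -> [set: T] w ->
    `|partial1of2 (fun (s : R) (w : T) => f w (x + s *: v)) s w| <= b w.
  by move=> /inorm Hs _; rewrite pE fb.
have := @cvg_differentiation_under_integral R _ T mu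
  (fun (s : R) (w : T) => f w (x + s *: v)) setT measurableT 0 (-1) 1 I01
  (fun s Hs => fi s (inorm s Hs))
  (fun s w _ _ => is_derive_ex (dline w s)) b b0 bi
  (fun s w Hs _ => pb s w Hs I).
set F := fun y => Rintegral mu setT (fun w => f w y).
under [X in _ --> X -> _]eq_Rintegral do rewrite pE scale0r addr0.
move=> H.
have E : (fun h : R => h^-1 *: (F (h *: v + x) - F x)) =
  (fun h : R => h^-1 *: (F (x + (h + 0) *: v) - F (x + 0 *: v))).
  apply/funext => h; congr (_ *: (F _ - F _)); first by rewrite addr0 addrC.
  by rewrite scale0r addr0.
split.
- by apply/cvg_ex; exists (Rintegral mu setT (fun w => df w x)); rewrite /= E; exact: H.
- by rewrite /derive /= E; apply: cvg_lim => //; exact: H.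
Qed.

(** The integral of the translates of h does not depend on the translation;
    differentiate it under the integral. *)
Lemma integral_derive0 (h : G R -> R) (v : G R) : Coo h -> bsupp h ->
  I7 ('D_v h) = 0.
Proof.
move=> Ch bh.
have CD := Coo_D v Ch; have bD := bsupp_derive v bh.
have [C C0 HC] := bsupp_bounded (Coo_cont CD) bD; have [M HM] := bD.
have ih := integrable_bsupp (Coo_cont Ch) bh.
have D : is_derive (0 : G R) v (fun y => I7 (fun w => h (w + y)))
    (I7 (fun w => 'D_v h (w + 0))).
  apply: (@derive_under_integral _ _ hm (G R) (fun w y => h (w + y))
     (fun w y => 'D_v h (w + y)) 0 v (fun w => C * cube_ind (M + `|v|) w)).
  - by move=> s _; apply: (mpres_integrable (@mpres_addG _) ih).
  - move=> w y; apply: (@is_derive_affine _ _ h (fun y => w + y)).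
      exact: Coo_derivable.
    by move=> k; rewrite addrCA.
  - exact/integrable_scale/integrable_cube_ind.
  - move=> w s s1; apply: (@cube_ind_le (fun w => 'D_v h (w + (0 + s *: v)))) => //.
    move=> g gM; apply: HM; rewrite add0r.
    have := lerB_normD g (s *: v); rewrite normrZ.
    have : `|s| * `|v| <= `|v| by rewrite ler_piMl // ltW.
    move: gM; lra.
have E : (fun y => I7 (fun w => h (w + y))) = (fun=> I7 h).
  apply/funext => y; apply: (mpres_Rintegral (@mpres_addG y)).
  exact: (measurable_L1 ih).
have := is_deriveE D; rewrite E derive_cst => /esym.
by under eq_Rintegral do rewrite addr0.
Qed.

Lemma zc0 (x1 y1 x2 y2 x3 y3 t : R) : zc (x1, y1, x2, y2, x3, y3, t) 0 = x1 +i* y1.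
Proof. by []. Qed.
Lemma zc1 (x1 y1 x2 y2 x3 y3 t : R) : zc (x1, y1, x2, y2, x3, y3, t) 1 = x2 +i* y2.
Proof. by []. Qed.
Lemma zc2 (x1 y1 x2 y2 x3 y3 t : R) : zc (x1, y1, x2, y2, x3, y3, t) 2 = x3 +i* y3.
Proof. by []. Qed.

Lemma sum3 (T : nmodType) (F : 'I_3 -> T) : \sum_(j < 3) F j = F 0 + F 1 + F 2.
Proof.
rewrite !big_ord_recl big_ord0 addr0 addrA; congr (F _ + F _ + F _); exact: val_inj.
Qed.

Lemma mulGE (x1 y1 x2 y2 x3 y3 t u1 v1 u2 v2 u3 v3 s : R) :
  mulG (x1, y1, x2, y2, x3, y3, t) (u1, v1, u2, v2, u3, v3, s) =
  (x1 + u1, y1 + v1, x2 + u2, y2 + v2, x3 + u3, y3 + v3,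
   t + s + 2 * ((y1 * u1 - x1 * v1) + (y2 * u2 - x2 * v2))).
Proof.
rewrite /mulG /pt sum3 !(zc0, zc1, zc2) /tc /sigma /=.
by congr (_, _); ring.
Qed.

Lemma invGE (x1 y1 x2 y2 x3 y3 t : R) :
  invG (x1, y1, x2, y2, x3, y3, t) = (- x1, - y1, - x2, - y2, - x3, - y3, - t).
Proof. by []. Qed.

Lemma eq_mulG (g h : G R) : mulG g h =
  (g.1.1.1.1.1.1 + h.1.1.1.1.1.1, g.1.1.1.1.1.2 + h.1.1.1.1.1.2,
   g.1.1.1.1.2 + h.1.1.1.1.2, g.1.1.1.2 + h.1.1.1.2, g.1.1.2 + h.1.1.2,
   g.1.2 + h.1.2,
   g.2 + h.2 + 2 * ((g.1.1.1.1.1.2 * h.1.1.1.1.1.1 - g.1.1.1.1.1.1 * h.1.1.1.1.1.2)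
     + (g.1.1.1.2 * h.1.1.1.1.2 - g.1.1.1.1.2 * h.1.1.1.2))).
Proof.
move: g h => [[[[[[x1 y1] x2] y2] x3] y3] t] [[[[[[u1 v1] u2] v2] u3] v3] s].
exact: mulGE.
Qed.

Lemma eq_invG (g : G R) : invG g =
  (- g.1.1.1.1.1.1, - g.1.1.1.1.1.2, - g.1.1.1.1.2, - g.1.1.1.2, - g.1.1.2,
   - g.1.2, - g.2).
Proof. by move: g => [[[[[[x1 y1] x2] y2] x3] y3] t]. Qed.

Lemma invG_mul (g h : G R) : mulG (invG (mulG g (invG h))) g = h.
Proof.
move: g h => [[[[[[x1 y1] x2] y2] x3] y3] t] [[[[[[u1 v1] u2] v2] u3] v3] s].
rewrite eq_mulG eq_invG eq_mulG eq_invG /=.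
by do 6! (congr (_, _); last by ring); ring.
Qed.

Lemma continuous_fst (U V : topologicalType) : continuous (fst : U * V -> U).
Proof. by move=> ?; exact: cvg_fst. Qed.
Lemma continuous_snd (U V : topologicalType) : continuous (snd : U * V -> V).
Proof. by move=> ?; exact: cvg_snd. Qed.

Lemma continuous_coords :
  [/\ [/\ continuous (fun g : G R => g.1.1.1.1.1.1),
          continuous (fun g : G R => g.1.1.1.1.1.2) &
          continuous (fun g : G R => g.1.1.1.1.2)],
      [/\ continuous (fun g : G R => g.1.1.1.2),
          continuous (fun g : G R => g.1.1.2) &
          continuous (fun g : G R => g.1.2)] &
      continuous (fun g : G R => g.2)].
Proof.
have comp (U V W : topologicalType) (p : U -> V) (q : V -> W) :
  continuous p -> continuous q -> continuous (fun x => q (p x)).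
  by move=> cp cq x; apply: continuous_comp; [exact: cp|exact: cq].
have c1 : continuous (fun g : G R => g.1) := @continuous_fst _ _.
have c2 : continuous (fun g : G R => g.1.1) := comp _ _ _ _ _ c1 (@continuous_fst _ _).
have c3 : continuous (fun g : G R => g.1.1.1) := comp _ _ _ _ _ c2 (@continuous_fst _ _).
have c4 : continuous (fun g : G R => g.1.1.1.1) := comp _ _ _ _ _ c3 (@continuous_fst _ _).
have c5 : continuous (fun g : G R => g.1.1.1.1.1) := comp _ _ _ _ _ c4 (@continuous_fst _ _).
split; last exact: continuous_snd.
  split; [exact: comp _ _ _ _ _ c5 (@continuous_fst _ _)|exact: comp _ _ _ _ _ c5 (@continuous_snd _ _)|exact: comp _ _ _ _ _ c4 (@continuous_snd _ _)].
split; [exact: comp _ _ _ _ _ c3 (@continuous_snd _ _)|exact: comp _ _ _ _ _ c2 (@continuous_snd _ _)|exact: comp _ _ _ _ _ c1 (@continuous_snd _ _)].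
Qed.

(** In coordinates h |-> g h^-1 is a reflection in each variable, followed in
    the last one by a translation that depends on the others. *)
Lemma mpres_div (g : G R) : mpres hm (fun h => mulG g (invG h)).
Proof.
have refl (c : R) : mpres m1 (fun x : R => - x + c).
  exact: (mpres_comp (mpres_shift c) (mpres_opp R)).
move: g => [[[[[[x1 y1] x2] y2] x3] y3] t].
have H d (T : measurableType d) (m : {sigma_finite_measure set T -> \bar R}) (p : T -> T) (c : R) :
  mpres m p -> mpres (m \x m1)%E (fun z : T * R => (p z.1, - z.2 + c)).
  move=> Hp; apply: (@mpres_prod _ _ _ _ R m m1 p (fun _ y => - y + c)) => //.
  apply: measurable_funD => //; apply: measurableT_comp => //.
have H6 := H _ _ m5 _ y3 (H _ _ m4 _ x3 (H _ _ m3 _ y2 (H _ _ m2 _ x2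
  (H _ _ m1 _ y1 (refl x1))))).
pose q (z : R * R * R * R * R * R) (s : R) := - s + (t +
  2 * ((x1 * z.1.1.1.1.2 - y1 * z.1.1.1.1.1) + (x2 * z.1.1.2 - y2 * z.1.1.1.2))).
have mq : measurable_fun setT (fun z : G R => q z.1 z.2).
  apply: measurable_continuous => z.
  have [[k1 k2 k3] [k4 k5 k6] k7] := continuous_coords.
  rewrite /q; apply: cvgD; first by apply: cvgN; exact: k7.
  apply: cvgD; first exact: cvg_cst.
  apply: cvgM; first exact: cvg_cst.
  apply: cvgD; apply: cvgB; (apply: cvgM; first exact: cvg_cst).
  - exact: k2.
  - exact: k1.
  - exact: k4.
  - exact: k3.
have := @mpres_prod _ _ _ _ R m6 m1 _ q H6 mq (fun z => refl _).
congr mpres; apply/funext => -[[[[[[u1 v1] u2] v2] u3] v3] s].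
rewrite invGE mulGE /q /=.
by do 6! (congr (_, _); last by ring); ring.
Qed.
End haar.

(** * One-variable derivatives and integrals *)

Section der.
Context (R : realType) (V : normedModType R).
Implicit Types (f g : V -> R) (x v : V).

Lemma is_derive_of_line f x v (l : R) :
  is_derive (0 : R) (1 : R) (fun s : R => f (x + s *: v)) l -> is_derive x v f l.
Proof.
move=> [dF dE].
have E : (fun h : R => h^-1 *: (f (h *: v + x) - f x)) =
   (fun h : R => h^-1 *: (f (x + (h * 1 + 0) *: v) - f (x + (0 : R) *: v))).
  apply/funext => h; congr (_ *: (f _ - f _)).
    by rewrite addr0 mulr1 addrC.
  by rewrite scale0r addr0.
split; first by rewrite /derivable /= E; exact: dF.
by rewrite /derive /= E; exact: dE.
Qed.

Lemma dcst (c : R) x v : is_derive x v (fun _ : V => c) 0.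
Proof. exact: is_derive_cst. Qed.
Lemma dD f g x v (df dg : R) : is_derive x v f df -> is_derive x v g dg ->
  is_derive x v (fun y => f y + g y) (df + dg).
Proof. by move=> Hf Hg; exact: is_deriveD. Qed.
Lemma dN f x v (df : R) : is_derive x v f df ->
  is_derive x v (fun y => - f y) (- df).
Proof. by move=> Hf; exact: is_deriveN. Qed.
Lemma dM f g x v (df dg : R) : is_derive x v f df -> is_derive x v g dg ->
  is_derive x v (fun y => f y * g y) (f x * dg + g x * df).
Proof. by move=> Hf Hg; exact: is_deriveM. Qed.
Lemma dX f n x v (df : R) : is_derive x v f df ->
  is_derive x v (fun y => f y ^+ n) (n%:R * f x ^+ n.-1 * df).
Proof.
move=> Hf; have := is_deriveX n Hf.
by congr is_derive; apply/funext => y; rewrite exprfctE.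
Qed.
Lemma dcomp f (h dh : R -> R) x v (df : R) :
  is_derive (f x) (1 : R) h (dh (f x)) -> is_derive x v f df ->
  is_derive x v (fun y => h (f y)) (dh (f x) * df).
Proof.
move=> Hh Hf; apply: is_derive_of_line.
have Hl : is_derive (0 : R) (1 : R) (fun s : R => f (x + s *: v)) df.
  have Hf' : is_derive (x + (0 : R) *: v) v f df by rewrite scale0r addr0.
  have := line_is_derive (is_derive_ex Hf').
  by rewrite (is_deriveE Hf').
apply: (@is_derive1_comp R h (fun s : R => f (x + s *: v))).
by rewrite scale0r addr0.
Qed.
Lemma dexp f x v (df : R) : is_derive x v f df ->
  is_derive x v (fun y => expR (f y)) (expR (f x) * df).
Proof. by apply: dcomp; exact: is_derive_expR. Qed.
Lemma dcos f x v (df : R) : is_derive x v f df ->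
  is_derive x v (fun y => cos (f y)) (- sin (f x) * df).
Proof. by apply: (@dcomp _ cos (fun y => - sin y)); exact: is_derive_cos. Qed.
Lemma dsin f x v (df : R) : is_derive x v f df ->
  is_derive x v (fun y => sin (f y)) (cos (f x) * df).
Proof. by apply: dcomp; exact: is_derive_sin. Qed.
End der.

Section der1.
Context (R : realType).
Implicit Types (f g : R -> R) (x : R).
Lemma did x : is_derive x (1 : R) (fun y : R => y) 1.
Proof. exact: is_derive_id. Qed.
Lemma dV f x (df : R) : f x != 0 -> is_derive x (1 : R) f df ->
  is_derive x (1 : R) (fun y => (f y)^-1) (- f x ^- 2 * df).
Proof. by move=> f0 Hf; exact: is_deriveV. Qed.
Lemma dln f x (df : R) : 0 < f x -> is_derive x (1 : R) f df ->
  is_derive x (1 : R) (fun y => ln (f y)) ((f x)^-1 * df).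
Proof. by move=> f0; apply: (@dcomp _ _ _ (@ln R) (fun y => y^-1)); exact: is_derive1_ln. Qed.
Lemma datan f x (df : R) : is_derive x (1 : R) f df ->
  is_derive x (1 : R) (fun y => atan (f y)) ((1 + f x ^+ 2)^-1 * df).
Proof. by apply: (@dcomp _ _ _ (@atan R) (fun y => (1 + y ^+ 2)^-1)); exact: is_derive1_atan. Qed.

Lemma derive_cont f x (df : R) : is_derive x (1 : R) f df -> {for x, continuous f}.
Proof.
by move=> [H _]; apply: differentiable_continuous; apply/derivable1_diffP.
Qed.
End der1.

(** Differentiates an expression along its syntax; the conditions of
    denominators and logarithms are left as goals. *)
Ltac der := lazymatch goal with
  | |- is_derive _ _ (fun _ => ?c) _ => exact: dcst
  | |- is_derive _ _ (fun y => y) _ => exact: did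
  | |- is_derive _ _ (fun y => GRing.add (@?f y) (@?g y)) _ =>
      simple notypeclasses refine (@dD _ _ f g _ _ _ _ _ _); [| |der|der]
  | |- is_derive _ _ (fun y => GRing.opp (@?f y)) _ =>
      simple notypeclasses refine (@dN _ _ f _ _ _ _); [|der]
  | |- is_derive _ _ (fun y => GRing.mul (@?f y) (@?g y)) _ =>
      simple notypeclasses refine (@dM _ _ f g _ _ _ _ _ _); [| |der|der]
  | |- is_derive _ _ (fun y => GRing.exp (@?f y) ?n) _ =>
      simple notypeclasses refine (@dX _ _ f n _ _ _ _); [|der]
  | |- is_derive _ _ (fun y => GRing.inv (@?f y)) _ =>
      simple notypeclasses refine (@dV _ f _ _ _ _); [| |der]
  | |- is_derive _ _ (fun y => expR (@?f y)) _ =>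
      simple notypeclasses refine (@dexp _ _ f _ _ _ _); [|der]
  | |- is_derive _ _ (fun y => cos (@?f y)) _ =>
      simple notypeclasses refine (@dcos _ _ f _ _ _ _); [|der]
  | |- is_derive _ _ (fun y => sin (@?f y)) _ =>
      simple notypeclasses refine (@dsin _ _ f _ _ _ _); [|der]
  | |- is_derive _ _ (fun y => ln (@?f y)) _ =>
      simple notypeclasses refine (@dln _ f _ _ _ _); [| |der]
  | |- is_derive _ _ (fun y => atan (@?f y)) _ =>
      simple notypeclasses refine (@datan _ f _ _ _); [|der]
  end.

(** The claimed derivative is compared with the computed one, which leaves an
    algebraic identity. *)
Ltac derive_by := simple notypeclasses refine (@is_derive_eq _ _ _ _ _ _ _ _ _ _);
  [|der|]; rewrite /=.

Section ftc.
Context (R : realType).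
Notation leb := (@lebesgue_measure R).

Lemma FTC_segment (a b : R) (f F : R -> R) : a < b ->
  (forall x, a <= x <= b -> is_derive x (1 : R) F (f x)) ->
  (forall x, a <= x <= b -> {for x, continuous f}) ->
  leb.-integrable `[a, b] (EFin \o f) /\ Rintegral leb `[a, b] f = F b - F a.
Proof.
move=> ab dF cf.
have cfw : {within `[a, b], continuous f}.
  apply: continuous_in_subspaceT => x /set_mem /=; rewrite in_itv /=; exact: cf.
split; first exact: continuous_compact_integrable (@segment_compact _ _ _) cfw.
rewrite /Rintegral (@continuous_FTC2 _ f F a b ab cfw) //.
- split.
  + move=> x; rewrite in_itv /= => /andP[ax xb].
    by have [] := dF x; rewrite ?ltW.
  + by apply: cvg_at_right_filter; apply: derive_cont (dF a _); rewrite lexx ltW.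
  + by apply: cvg_at_left_filter; apply: derive_cont (dF b _); rewrite lexx ltW.
- move=> x; rewrite in_itv /= => /andP[ax xb]; rewrite derive1E.
  by apply: derive_val; apply: dF; rewrite !ltW.
Qed.

Lemma FTC_ge0_infty (g F : R -> R) (l : R) :
  (forall x : R, is_derive x (1 : R) F (g x)) -> continuous g ->
  (forall x : R, 0 <= x -> 0 <= g x) -> F x @[x --> +oo] --> l ->
  leb.-integrable `[0, +oo[ (EFin \o g) /\ Rintegral leb `[0, +oo[ g = l - F 0.
Proof.
move=> dF cg g0 Fl.
have H : (\int[leb]_(x in `[0%R, +oo[) (g x)%:E = l%:E - (F 0)%:E)%E.
  apply: ge0_continuous_FTC2y => //.
  - exact: continuous_subspaceT.
  - by apply: cvg_at_right_filter; exact: derive_cont (dF 0).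
  - by move=> x _; rewrite derive1E; apply: derive_val; exact: dF.
split; last by rewrite /Rintegral H.
apply/integrableP; split.
  by apply/measurable_EFinP; apply: measurable_funTS; exact: continuous_measurable_fun.
under eq_integral => x /set_mem /=.
  rewrite in_itv /= andbT => x0; rewrite ger0_norm ?g0 //; over.
by rewrite H -EFinB ltry.
Qed.

(** For f of any sign: subtract the nonnegative case for g from that for
    f + g. *)
Lemma FTC_dom_infty (f F g K : R -> R) (l k : R) :
  (forall x : R, is_derive x (1 : R) F (f x)) -> continuous f -> F x @[x --> +oo] --> l ->
  (forall x : R, is_derive x (1 : R) K (g x)) -> continuous g -> K x @[x --> +oo] --> k ->
  (forall x : R, 0 <= x -> `|f x| <= g x) ->
  leb.-integrable `[0, +oo[ (EFin \o f) /\ Rintegral leb `[0, +oo[ f = l - F 0.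
Proof.
move=> dF cf Fl dK cg Kk fg.
have g0 x : 0 <= x -> 0 <= g x by move=> x0; exact: le_trans (fg x x0).
have [ig Ig] := FTC_ge0_infty dK cg g0 Kk.
have [ifg Ifg] : leb.-integrable `[0, +oo[ (EFin \o (fun x => f x + g x)) /\
    Rintegral leb `[0, +oo[ (fun x => f x + g x) = (l + k) - (F 0 + K 0).
  apply: (@FTC_ge0_infty _ (fun x => F x + K x)).
  - by move=> x; apply: cvgD; [exact: cf|exact: cg].
  - move=> x x0; have := fg x x0; rewrite ler_norml => /andP[+ _]; lra.
  - exact: cvgD.
have if_ : leb.-integrable `[0, +oo[ (EFin \o f).
  apply: le_integrable ig => //.
    by apply/measurable_EFinP; apply: measurable_funTS; exact: continuous_measurable_fun.
  move=> x /=; rewrite in_itv /= andbT => x0.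
  by rewrite lee_fin (le_trans (fg x x0)) // ler_norm.
split => //.
have : Rintegral leb `[0, +oo[ (fun x => f x + g x) =
    Rintegral leb `[0, +oo[ f + Rintegral leb `[0, +oo[ g by rewrite RintegralD.
rewrite Ifg Ig; lra.
Qed.
End ftc.

Section logbounds.
Context (R : realType).
Implicit Type r : R.

(** Used to bound ln r by comparing a decreasing function with its value 0 at 1. *)
Lemma decr_to_1 (F f : R -> R) r : 0 < r < 1 -> F 1 = 0 ->
  (forall x : R, 0 < x -> is_derive x (1 : R) F (f x)) ->
  (forall x : R, 0 < x -> f x <= 0) -> 0 <= F r.
Proof.
move=> /andP[r0 r1] F1 dF f0.
have cF : {within `[r, 1], continuous F}.
  apply: continuous_in_subspaceT => x /set_mem /=; rewrite in_itv /= => /andP[rx _].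
  apply: derive_cont (dF x _); exact: lt_le_trans rx.
have dF' x : x \in `]r, 1[ -> is_derive x 1 F (f x).
  by rewrite in_itv /= => /andP[rx _]; apply: dF; exact: lt_trans rx.
have [c] := MVT r1 dF' cF.
rewrite in_itv /= F1 sub0r => /andP[rc c1] E.
rewrite -oppr_le0 E mulr_le0_ge0 //; last by rewrite subr_ge0 ltW.
by apply: f0; exact: lt_trans rc.
Qed.

(** This is b <= a in the notation of the kernel. *)
Lemma lnr_lb r : 0 < r < 1 -> 2 * (1 - r) / (1 + r) <= - ln r.
Proof.
move=> r01; rewrite -subr_ge0.
apply: (@decr_to_1 (fun r => - ln r - 2 * (1 - r) / (1 + r))
  (fun r => - (1 - r) ^+ 2 / (r * (1 + r) ^+ 2))) => //.
- by rewrite ln1; field.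
- move=> x x0; derive_by => //.
    by rewrite gt_eqF // addr_gt0.
  by field; rewrite ?gt_eqF // addr_gt0.
- move=> x x0; rewrite mulNr oppr_le0 divr_ge0 ?sqr_ge0 //.
  by rewrite mulr_ge0 ?sqr_ge0 // ltW.
Qed.

(** With r = s^2 it becomes the comparison of - 2 ln s with 1/s - s. *)
Lemma lnr_ub r : 0 < r < 1 -> r * (ln r) ^+ 2 <= (1 - r) ^+ 2.
Proof.
move=> /andP[r0 r1].
have [s [s0 s1 ->]] : exists s, [/\ 0 < s, s < 1 & r = s ^+ 2].
  exists (Num.sqrt r); split; rewrite ?sqrtr_gt0 ?sqr_sqrtr ?ltW //.
  by rewrite -sqrtr1 ltr_sqrt.
have H : 0 <= s^-1 - s + 2 * ln s.
  apply: (@decr_to_1 (fun s => s^-1 - s + 2 * ln s) (fun s => - (1 - s) ^+ 2 / s ^+ 2)).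
  - by rewrite s0.
  - by rewrite ln1 invr1 subrr mulr0 addr0.
  - move=> x x0; derive_by => //; first by rewrite gt_eqF.
    by field; rewrite gt_eqF.
  - by move=> x x0; rewrite mulNr oppr_le0 divr_ge0 ?sqr_ge0.
have L : ln (s ^+ 2) = 2 * ln s by rewrite lnXn // mulr_natl.
have Ls : ln s < 0 by rewrite ln_lt0 // s0.
have A : 0 <= - (s * (2 * ln s)).
  by rewrite -mulrN -mulrN !mulr_ge0 ?oppr_ge0 // ltW.
have B : - (s * (2 * ln s)) <= 1 - s ^+ 2.
  have : 0 <= s * (s^-1 - s + 2 * ln s) by rewrite mulr_ge0 // ltW.
  rewrite mulrDr mulrBr divff ?gt_eqF // expr2; lra.
rewrite L -exprMn -[leLHS]sqrrN ler_sqr ?nnegrE //.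
exact: le_trans B.
Qed.

Lemma lnr_ub_inv r : 0 < r < 1 -> - ln r <= (1 - r) / r.
Proof.
move=> /andP[r0 r1]; rewrite -lnV ?posrE //.
have := @le_ln1Dx R (r^-1 - 1); rewrite subrKC mulrBl divff ?gt_eqF // mul1r; apply.
by rewrite ltrBrDl subrr invr_gt0.
Qed.

(** From e^x >= x at x = 4 y / 9, where y^9 e^(-4 y) is maximal for y = 9/4. *)
Lemma exp_pow9 (y : R) : 0 <= y -> y ^+ 9 * expR (- y) ^+ 4 <= (9 / 4) ^+ 9.
Proof.
move=> y0.
have H : (4 / 9 * y) ^+ 9 <= expR y ^+ 4.
  rewrite -expRM_natl -[4%:R * y](_ : 9%:R * (4 / 9 * y) = _); last by field.
  rewrite expRM_natl lerXn2r ?nnegrE ?expR_ge0 ?mulr_ge0 //.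
  by apply: le_trans (expR_ge1Dx _); rewrite lerDr.
rewrite expRN exprVn ler_pdivrMr ?exprn_gt0 ?expR_gt0 //.
have -> : y ^+ 9 = (9 / 4) ^+ 9 * (4 / 9 * y) ^+ 9.
  by rewrite -exprMn; congr (_ ^+ _); field.
by rewrite ler_pM2l // exprn_gt0.
Qed.
End logbounds.

Section kappa.
Context (R : realType).
Notation leb := (@lebesgue_measure R).
Notation intble f := (leb.-integrable setT (EFin \o f)).

(** The exponent - 3/4 is integrable at 0, and the fourth power of kappa is an
    integral power of |x|: bounds by kappa are proved for fourth powers, where
    they are polynomial. *)
Definition kappa (x : R) : R := `|x| `^ (- (3 / 4)).

Lemma kappa_ge0 x : 0 <= kappa x. Proof. exact: powR_ge0. Qed.

Lemma kappa4 x : x != 0 -> kappa x ^+ 4 = `|x| ^- 3.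
Proof.
move=> x0; rewrite /kappa -powR_mulrn ?powR_ge0 // -powRrM.
rewrite (_ : - (3 / 4) * 4%:R = - 3%:R :> R); last by field.
by rewrite powRN powR_mulrn.
Qed.

Lemma measurable_kappa : measurable_fun setT kappa.
Proof.
apply: (@measurableT_comp _ _ _ _ _ _ (fun x : R => x `^ (- (3 / 4))) setT (fun x : R => `|x|)) => //.
Qed.

Lemma kappaN x : kappa (- x) = kappa x. Proof. by rewrite /kappa normrN. Qed.

Lemma integrable_kappa_oc (M : R) : 0 < M ->
  leb.-integrable `]0, M] (EFin \o kappa).
Proof.
move=> M0; apply/integrableP; split.
  by apply/measurable_EFinP; apply: measurable_funTS; exact: measurable_kappa.
pose F (n : nat) : set R := `[M / n.+2%:R, M]%classic.
have F0 n : 0 < M / n.+2%:R by rewrite divr_gt0.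
have FM n : M / n.+2%:R < M by rewrite ltr_pdivrMr // ltr_pMr // ltr1n.
have UF : `]0, M]%classic = \bigcup_n F n.
  apply/seteqP; split => x /=.
    rewrite in_itv /= => /andP[x0 xM].
    exists (Num.trunc (M / x)) => //; rewrite /F /= in_itv /= xM andbT.
    rewrite ler_pdivrMr // mulrC -ler_pdivrMr //; apply: ltW.
    by apply: (lt_le_trans (truncnS_gt _)); rewrite ler_nat.
  by move=> [n _]; rewrite /F /= !in_itv /= => /andP[nx ->]; rewrite (lt_le_trans _ nx).
have kE x : 0 < x -> kappa x = x `^ (- (3 / 4)) by move=> x0; rewrite /kappa gtr0_norm.
have int_n n : (\int[leb]_(x in F n) `|kappa x|%:E <= (4 * M `^ (1 / 4))%:E)%E.
  have dF (x : R) : M / n.+2%:R <= x <= M ->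
      is_derive x (1 : R) (fun x => 4 * x `^ (1 / 4)) (x `^ (- (3 / 4))).
    move=> /andP[nx _]; have x0 : 0 < x by exact: lt_le_trans nx.
    have H := is_derive1_powR (1 / 4) x0.
    simple notypeclasses refine (is_derive_eq (dM (dcst 4 x 1) H) _); rewrite /=.
    rewrite mulr0 addr0 mulrA (_ : 1 / 4 - 1 = - (3 / 4)); last by field.
    by rewrite (_ : 4 * (1 / 4) = 1) ?mul1r //; field.
  have cf (x : R) : M / n.+2%:R <= x <= M -> {for x, continuous (fun x : R => x `^ (- (3 / 4)))}.
    move=> /andP[nx _]; have x0 : 0 < x by exact: lt_le_trans nx.
    exact: derive_cont (is_derive1_powR (- (3 / 4)) x0).
  have [ii Ei] := FTC_segment (FM n) dF cf.
  have -> : (\int[leb]_(x in F n) `|kappa x|%:E = \int[leb]_(x in F n) (x `^ (- (3 / 4)))%:E)%E.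
    apply: eq_integral => x /set_mem; rewrite /F /= in_itv /= => /andP[nx _].
    have x0 : 0 < x by exact: lt_le_trans nx.
    by rewrite kE // ger0_norm // powR_ge0.
  rewrite -(fineK (integrable_fin_num _ ii)) // lee_fin.
  rewrite [leLHS](_ : _ = Rintegral leb (F n) (fun x => x `^ (- (3 / 4)))) // Ei.
  by rewrite gerBl mulr_ge0 // powR_ge0.
have cv : (\int[leb]_(x in F i) `|kappa x|%:E)%E @[i --> \oo] -->
    (\int[leb]_(x in \bigcup_i F i) `|kappa x|%:E)%E.
  apply: ge0_nondecreasing_set_cvg_integral => //.
  - move=> n m nm; apply/subsetPset => x; rewrite /F /= !in_itv /= => /andP[nx ->].
    rewrite andbT (le_trans _ nx) // ler_pM2l // lef_pV2 ?posrE //.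
    by rewrite ler_nat !ltnS.
  - by move=> n; exact: measurable_itv.
  - move=> n; apply/measurable_EFinP; apply: measurable_funTS.
    by apply: measurableT_comp => //; exact: measurable_kappa.
rewrite UF.
apply: (@le_lt_trans _ _ (4 * M `^ (1 / 4))%:E); last by rewrite ltry.
apply: (cvge_to_le cv); exact: nearW.
Qed.

Lemma integrable_kappa (M : R) : 0 < M -> intble (fun x => kappa x * ind M x).
Proof.
move=> M0.
have kp : intble (kappa \_ `]0, M]).
  have := integrable_kappa_oc M0.
  rewrite (@integrable_mkcond _ _ _ leb) // restrict_EFin; exact.
have kn := mpres_integrable (mpres_opp R) kp.
rewrite (_ : (fun x => _) = (fun x => (kappa \_ `]0, M]) x + (kappa \_ `]0, M]) (- x))).
  exact: (integrableD measurableT kp kn).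
have k0 : kappa 0 = 0.
  by rewrite /kappa normr0 powR0 // oppr_eq0 mulf_neq0 // invr_neq0.
apply/funext => x; rewrite /ind indicE !patchE !mem_setE !in_itv /= kappaN.
rewrite (_ : point = 0 :> R) //.
have [x0|x0|->] := ltgtP x 0.
- have xM : (x <= M) = true by rewrite ltW // (lt_trans x0).
  rewrite oppr_gt0 x0 lerNl xM /= andbT add0r.
  by case: ifP; rewrite ?mulr1 ?mulr0.
- have xM : (- M <= x) = true by rewrite ltW // (lt_trans _ x0) // oppr_lt0.
  rewrite oppr_gt0 (lt_gtF x0) xM /= addr0.
  by case: ifP; rewrite ?mulr1 ?mulr0.
- by rewrite oppr0 ltxx /= k0 mul0r addr0.
Qed.

(** The majorant in the variable r, singular at both ends. *)
Definition kappa2 (r : R) : R := if 0 < r < 1 then kappa r * kappa (1 - r) else 0.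

Lemma kappa2_ge0 r : 0 <= kappa2 r.
Proof. by rewrite /kappa2; case: ifP => // _; rewrite mulr_ge0 // kappa_ge0. Qed.

Lemma measurable_kappa2 : measurable_fun setT kappa2.
Proof.
apply: measurable_fun_ifT.
- by apply: measurable_and; exact: measurable_fun_ltr.
- apply: measurable_funM; first exact: measurable_kappa.
  by apply: (measurableT_comp measurable_kappa); exact: measurable_funB.
- exact: measurable_cst.
Qed.

Lemma kappa_half (x : R) : 1 / 2 <= x -> kappa x <= 2.
Proof.
move=> x2; have x0 : 0 < x by apply: lt_le_trans x2; rewrite divr_gt0.
rewrite -(@ler_pXn2r _ 4) ?nnegrE ?kappa_ge0 // kappa4 ?gt_eqF // gtr0_norm //.
rewrite -exprVn; have : x^-1 <= 2.
  by rewrite -[leRHS]invrK lef_pV2 ?posrE // ?invr_gt0 // -[2^-1]mul1r.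
move=> x2'; apply: (@le_trans _ _ (2 ^+ 3)).
  by rewrite lerXn2r ?nnegrE // invr_ge0 ltW.
by rewrite -!natrX ler_nat.
Qed.

Lemma integrable_kappa2 : intble kappa2.
Proof.
have ik := integrable_kappa (@ltr01 R).
have ik' := mpres_integrable (mpres_comp (mpres_shift 1) (mpres_opp R)) ik.
have H : intble (fun x => 2 * (kappa x * ind 1 x + kappa (- x + 1) * ind 1 (- x + 1))).
  by apply: integrable_scale; exact: (integrableD measurableT ik ik').
apply: (@integrable_dom R _ _ leb _ _ measurable_kappa2 _ H) => r.
rewrite ger0_norm ?kappa2_ge0 // /kappa2.
have i0 x : 0 <= kappa x * ind 1 x by rewrite mulr_ge0 ?kappa_ge0 ?ind_ge0.
case: ifPn => [/andP[r0 r1]|_]; last by rewrite mulr_ge0 // addr_ge0.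
have e1 : ind 1 r = 1.
  by rewrite /ind indicE mem_set //= in_itv /= (ltW r1) (le_trans _ (ltW r0)) // oppr_le0.
have e2 : ind 1 (- r + 1) = 1.
  by rewrite /ind indicE mem_set //= in_itv /=; apply/andP; split; lra.
rewrite e1 e2 !mulr1 [- r + 1]addrC.
have [r2|r2] := leP (1 / 2) r.
  apply: (@le_trans _ _ (2 * kappa (1 - r))).
    by rewrite ler_wpM2r ?kappa_ge0 // kappa_half.
  by rewrite ler_pM2l // lerDr kappa_ge0.
apply: (@le_trans _ _ (kappa r * 2)).
  by rewrite ler_wpM2l ?kappa_ge0 // kappa_half //; lra.
by rewrite mulrC ler_pM2l // lerDl kappa_ge0.
Qed.
End kappa.

Section gauss.
Context (R : realType).
Notation leb := (@lebesgue_measure R).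

(** A multiple of the normal density with variance 1 / (2 c). *)
Lemma gauss_scaled (c : R) : 0 < c ->
  leb.-integrable setT (EFin \o (fun x : R => expR (- (c * x ^+ 2)))) /\
  Rintegral leb setT (fun x : R => expR (- (c * x ^+ 2))) = Num.sqrt (pi / c).
Proof.
move=> c0; pose s : R := Num.sqrt (2 * c)^-1.
have c2 : 0 < (2 * c)^-1 by rewrite invr_gt0 mulr_gt0.
have s0 : s != 0 by rewrite gt_eqF // sqrtr_gt0.
have s2 : s ^+ 2 = (2 * c)^-1 by rewrite sqr_sqrtr // ltW.
have pE : s ^+ 2 * pi *+ 2 = pi / c.
  by rewrite s2 -mulr_natr; field; rewrite gt_eqF.
have q0 : Num.sqrt (pi / c) != 0 by rewrite gt_eqF // sqrtr_gt0 divr_gt0 // pi_gt0.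
have E : (fun x : R => expR (- (c * x ^+ 2))) =
    (fun x => Num.sqrt (pi / c) * normal_pdf 0 s x).
  apply/funext => x; rewrite normal_pdfE // /normal_peak /normal_fun.
  rewrite pE [RHS]mulrA divff // mul1r subr0 s2; congr expR.
  by rewrite -mulr_natr; field; rewrite gt_eqF.
have ip : leb.-integrable setT (EFin \o normal_pdf 0 s) by exact: integrable_normal_pdf.
rewrite E; split; first exact: integrable_scale.
by rewrite RintegralZl // /Rintegral integral_normal_pdf mulr1.
Qed.
End gauss.

Section laplace.
Context (R : realType).
Notation leb := (@lebesgue_measure R).

Lemma cvg0_pinfty (F : R -> R) (C : R) :
  (forall x : R, 0 <= x -> `|F x| <= C / (1 + x)) -> F x @[x --> +oo] --> 0.
Proof.
move=> H; apply/cvgrPdist_le => e e0; near=> x.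
have x0 : 0 <= x by near: x; exact: nbhs_pinfty_ge.
rewrite sub0r normrN (le_trans (H x x0)) // ler_pdivrMr; last by rewrite ltr_wpDr.
have : C / e <= x by near: x; apply: nbhs_pinfty_ge; exact: num_real.
by rewrite ler_pdivrMr // mulrC => h; rewrite mulrDr mulr1 (le_trans h) // lerDr ltW.
Unshelve. all: by end_near.
Qed.

(** From e^y >= 1 + y at y = x A / 3, cubed. *)
Lemma poly_exp_bound (A : R) : 0 < A -> exists2 C, 0 <= C &
  forall x : R, 0 <= x -> (1 + x) ^+ 2 * expR (- (x * A)) <= C / (1 + x).
Proof.
(* m (1 + x) <= 1 + x A / 3 *)
move=> A0; pose m := Num.min 1 (A / 3).
have m0 : 0 < m by rewrite lt_min ltr01 divr_gt0.
exists (m ^- 3); first by rewrite invr_ge0 exprn_ge0 // ltW.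
move=> x x0; have x1 : 0 < 1 + x by rewrite ltr_wpDr.
rewrite expRN ler_pdivrMr ?expR_gt0 // mulrAC ler_pdivlMr // -exprSr.
rewrite ler_pdivlMl ?exprn_gt0 // -exprMn.
rewrite (_ : x * A = 3%:R * (x * (A / 3))); last by field.
rewrite expRM_natl lerXn2r ?nnegrE ?expR_ge0 ?mulr_ge0 ?(ltW m0) ?(ltW x1) //.
apply: le_trans (expR_ge1Dx _); rewrite mulrDr mulr1 mulrC lerD //.
  by rewrite /m ge_min lexx.
by rewrite ler_wpM2l // /m ge_min lexx orbT.
Qed.

Lemma laplace_dom (f F : R -> R) (A K : R) : 0 < A -> 0 <= K ->
  (forall x : R, is_derive x (1 : R) F (f x)) -> continuous f ->
  (forall x : R, 0 <= x -> `|F x| <= K * ((1 + x) ^+ 2 * expR (- (x * A)))) ->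
  F x @[x --> +oo] --> 0.
Proof.
move=> A0 K0 dF cf H; have [C C0 HC] := poly_exp_bound A0.
apply: (@cvg0_pinfty _ (K * C)) => x x0.
by rewrite (le_trans (H x x0)) // -mulrA ler_wpM2l // HC.
Qed.

Lemma sqr_bound (a b c x : R) : 0 <= x ->
  `|a * x ^+ 2 + b * x + c| <= (`|a| + `|b| + `|c|) * (1 + x) ^+ 2.
Proof.
move=> x0; apply: (le_trans (ler_normD _ _)).
have h1 : x ^+ 2 <= (1 + x) ^+ 2 by rewrite lerXn2r ?nnegrE ?addr_ge0 // lerDr.
have h3 : 1 <= (1 + x) ^+ 2 by rewrite exprn_ege1 // lerDl.
have h2 : x <= (1 + x) ^+ 2 by rewrite sqrrD expr1n mul1r; have := sqr_ge0 x; lra.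
rewrite !mulrDl; apply: lerD; last by rewrite ler_peMr.
apply: (le_trans (ler_normD _ _)); rewrite normrM (ger0_norm (sqr_ge0 x)) normrM (ger0_norm x0).
by apply: lerD; rewrite ler_wpM2l.
Qed.

(** The antiderivative of x^2 e^(-x (A + i t)) is elementary: with
    u - i v = 1 / (A + i t), the polynomials qr and qi below are the real part
    and minus the imaginary part of (u - i v) x^2 + 2 (u - i v)^2 x + 2 (u - i v)^3. *)
Lemma laplace2 (A t : R) : 0 < A ->
  leb.-integrable `[0, +oo[ (EFin \o (fun x => x ^+ 2 * expR (- (x * A)) * cos (x * t))) /\
  Rintegral leb `[0, +oo[ (fun x => x ^+ 2 * expR (- (x * A)) * cos (x * t)) =
    2 * ((A ^+ 3 - 3 * A * t ^+ 2) / (A ^+ 2 + t ^+ 2) ^+ 3).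
Proof.
move=> A0.
have D0 : 0 < A ^+ 2 + t ^+ 2 by rewrite ltr_wpDr ?sqr_ge0 // exprn_gt0.
pose u := A / (A ^+ 2 + t ^+ 2); pose v := t / (A ^+ 2 + t ^+ 2).
pose qr x := u * x ^+ 2 + (2 * (u ^+ 2 - v ^+ 2)) * x + 2 * (u ^+ 3 - 3 * u * v ^+ 2).
pose qi x := v * x ^+ 2 + (4 * u * v) * x + 2 * (3 * u ^+ 2 * v - v ^+ 3).
pose F x := - (expR (- (x * A)) * (cos (x * t) * qr x - sin (x * t) * qi x)).
pose K x := - (expR (- (x * A)) * (A^-1 * x ^+ 2 + (2 * A ^- 2) * x + 2 * A ^- 3)).
have cf : continuous (fun x : R => x ^+ 2 * expR (- (x * A)) * cos (x * t)).
  by move=> x; apply: derive_cont; der.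
have cg : continuous (fun x : R => x ^+ 2 * expR (- (x * A))).
  by move=> x; apply: derive_cont; der.
have dF (x : R) : is_derive x (1 : R) F (x ^+ 2 * expR (- (x * A)) * cos (x * t)).
  rewrite /F /qr /qi; derive_by.
  rewrite /u /v; field.
  by rewrite gt_eqF.
have dK (x : R) : is_derive x (1 : R) K (x ^+ 2 * expR (- (x * A))).
  rewrite /K; derive_by.
  by field; rewrite gt_eqF.
have cvF : F x @[x --> +oo] --> 0.
  apply: (@laplace_dom _ _ _ (`|u| + `|2 * (u ^+ 2 - v ^+ 2)| + `|2 * (u ^+ 3 - 3 * u * v ^+ 2)| + (`|v| + `|4 * u * v| + `|2 * (3 * u ^+ 2 * v - v ^+ 3)|)) A0 _ dF cf).
    by rewrite !addr_ge0.
  move=> x x0; rewrite /F normrN normrM (ger0_norm (expR_ge0 _)) mulrA mulrC.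
  rewrite ler_wpM2r ?expR_ge0 // mulrDl.
  apply: (le_trans (ler_normB _ _)); rewrite (normrM (cos _)) (normrM (sin _)); apply: lerD.
    apply: le_trans (sqr_bound _ _ _ x0).
    by rewrite ler_piMl // cos_max.
  apply: le_trans (sqr_bound _ _ _ x0).
  by rewrite ler_piMl // sin_max.
have cvK : K x @[x --> +oo] --> 0.
  apply: (@laplace_dom _ _ _ (`|A^-1| + `|2 * A ^- 2| + `|2 * A ^- 3|) A0 _ dK cg).
    by rewrite !addr_ge0.
  move=> x x0; rewrite /K normrN normrM (ger0_norm (expR_ge0 _)) mulrA mulrC.
  by rewrite ler_wpM2r ?expR_ge0 // sqr_bound.
have [|i1 E1] := FTC_dom_infty dF cf cvF dK cg cvK.
  move=> x x0; rewrite normrM (ger0_norm (mulr_ge0 (sqr_ge0 x) (expR_ge0 _))).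
  by rewrite ler_piMr ?cos_max // mulr_ge0 ?sqr_ge0 ?expR_ge0.
split => //; rewrite E1 sub0r /F opprK !mul0r oppr0 expR0 cos0 sin0 /qr /qi /u /v.
by field; rewrite gt_eqF.
Qed.

Lemma laplace0 (A t : R) : 0 < A ->
  leb.-integrable `[0, +oo[ (EFin \o (fun x => expR (- (x * A)) * cos (x * t))) /\
  Rintegral leb `[0, +oo[ (fun x => expR (- (x * A)) * cos (x * t)) =
    A / (A ^+ 2 + t ^+ 2).
Proof.
move=> A0.
have D0 : 0 < A ^+ 2 + t ^+ 2 by rewrite ltr_wpDr ?sqr_ge0 // exprn_gt0.
pose u := A / (A ^+ 2 + t ^+ 2); pose v := t / (A ^+ 2 + t ^+ 2).
pose F x := - (expR (- (x * A)) * (cos (x * t) * u - sin (x * t) * v)).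
pose K x := - (expR (- (x * A)) * A^-1).
have cf : continuous (fun x : R => expR (- (x * A)) * cos (x * t)).
  by move=> x; apply: derive_cont; der.
have cg : continuous (fun x : R => expR (- (x * A))).
  by move=> x; apply: derive_cont; der.
have dF (x : R) : is_derive x (1 : R) F (expR (- (x * A)) * cos (x * t)).
  rewrite /F; derive_by.
  rewrite /u /v; field.
  by rewrite gt_eqF.
have dK (x : R) : is_derive x (1 : R) K (expR (- (x * A))).
  rewrite /K; derive_by.
  by field; rewrite gt_eqF.
have one (x : R) : 0 <= x -> 1 <= (1 + x) ^+ 2 by move=> x0; rewrite exprn_ege1 // lerDl.
have cvF : F x @[x --> +oo] --> 0.
  apply: (@laplace_dom _ _ _ (`|u| + `|v|) A0 _ dF cf); first by rewrite !addr_ge0.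
  move=> x x0; rewrite /F normrN normrM (ger0_norm (expR_ge0 _)) mulrA mulrC.
  rewrite ler_wpM2r ?expR_ge0 // mulrDl.
  apply: (le_trans (ler_normB _ _)); rewrite (normrM (cos _)) (normrM (sin _)); apply: lerD.
    by rewrite mulrC ler_wpM2l // (le_trans (cos_max _)) // one.
  by rewrite mulrC ler_wpM2l // (le_trans (sin_max _)) // one.
have cvK : K x @[x --> +oo] --> 0.
  apply: (@laplace_dom _ _ _ `|A^-1| A0 _ dK cg) => // x x0.
  rewrite /K normrN normrM (ger0_norm (expR_ge0 _)) mulrA mulrC.
  by rewrite ler_wpM2r ?expR_ge0 // ler_peMr // one.
have [|i1 E1] := FTC_dom_infty dF cf cvF dK cg cvK.
  move=> x x0; rewrite !normrM (ger0_norm (expR_ge0 _)).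
  by rewrite ler_piMr ?cos_max // expR_ge0.
split => //; rewrite E1 sub0r /F opprK !mul0r oppr0 expR0 cos0 sin0 /u /v.
by field; rewrite gt_eqF.
Qed.

Lemma poisson_segment (e M : R) : 0 < e -> 0 < M ->
  Rintegral leb `[- M, M] (fun t => e / (e ^+ 2 + t ^+ 2)) = 2 * atan (M / e).
Proof.
move=> e0 M0.
have D0 (t : R) : e ^+ 2 + t ^+ 2 != 0 by rewrite gt_eqF // ltr_wpDr ?sqr_ge0 // exprn_gt0.
have MM : - M < M by rewrite gtrN.
have [|t _|_ ->] := @FTC_segment R _ _ (fun t => e / (e ^+ 2 + t ^+ 2)) (fun t => atan (t / e)) MM.
- move=> t _; derive_by.
  by field; rewrite D0 gt_eqF.
- by apply: derive_cont; der; exact: D0.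
by rewrite mulNr atanN opprK -mulr2n mulr_natl.
Qed.
End laplace.

Section measurability.
Context (R : realType).

Lemma measurable_inv : measurable_fun setT (fun x : R => x^-1).
Proof.
rewrite (_ : (fun x : R => x^-1) = (fun x => x * (x ^+ 2) `^ (-1))).
  apply: measurable_funM => //.
  apply: (@measurableT_comp _ _ _ _ _ _ (fun x : R => x `^ (-1)) setT (fun x : R => x ^+ 2)) => //.
apply/funext => x; rewrite powR_inv1 ?sqr_ge0 //.
have [->|x0] := eqVneq x 0; first by rewrite invr0 mul0r.
by rewrite expr2 invfM mulrA divff // mul1r.
Qed.

Lemma measurable_cos : measurable_fun setT (@cos R).
Proof. by apply: continuous_measurable_fun; exact: continuous_cos. Qed.

Context d (T : measurableType d).
Implicit Types f g : T -> R.
Notation meas f := (measurable_fun setT (f : T -> R)).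

Lemma measV f : meas f -> meas (fun x => (f x)^-1).
Proof. by move=> mf; exact: (measurableT_comp measurable_inv mf). Qed.
Lemma measE f : meas f -> meas (fun x => expR (f x)).
Proof. by move=> mf; exact: (measurableT_comp (@measurable_expR R) mf). Qed.
Lemma measC f : meas f -> meas (fun x => cos (f x)).
Proof. by move=> mf; exact: (measurableT_comp measurable_cos mf). Qed.
Lemma measL f : meas f -> meas (fun x => ln (f x)).
Proof. by move=> mf; exact: (measurableT_comp (@measurable_ln R) mf). Qed.
Lemma measX f n : meas f -> meas (fun x => f x ^+ n).
Proof. exact: measurable_funX. Qed.
Lemma measN f : meas f -> meas (fun x => - f x).
Proof. by move=> mf; apply: measurableT_comp. Qed.
Lemma measD f g : meas f -> meas g -> meas (fun x => f x + g x).
Proof. exact: measurable_funD. Qed.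
Lemma measM f g : meas f -> meas g -> meas (fun x => f x * g x).
Proof. exact: measurable_funM. Qed.
Lemma meas_cst (c : R) : meas (fun=> c).
Proof. exact: measurable_cst. Qed.
End measurability.

Ltac meas := lazymatch goal with
  | |- measurable_fun _ (fun _ => ?c) => exact: meas_cst
  | |- measurable_fun _ (fun y => GRing.add (@?f y) (@?g y)) => apply: measD; meas
  | |- measurable_fun _ (fun y => GRing.opp (@?f y)) => apply: measN; meas
  | |- measurable_fun _ (fun y => GRing.mul (@?f y) (@?g y)) => apply: measM; meas
  | |- measurable_fun _ (fun y => GRing.exp (@?f y) ?n) => apply: measX; meas
  | |- measurable_fun _ (fun y => GRing.inv (@?f y)) => apply: measV; meas
  | |- measurable_fun _ (fun y => expR (@?f y)) => apply: measE; meas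
  | |- measurable_fun _ (fun y => cos (@?f y)) => apply: measC; meas
  | |- measurable_fun _ (fun y => ln (@?f y)) => apply: measL; meas
  | |- _ => idtac
  end.

Section almost_everywhere.
Context d1 d2 (T1 : measurableType d1) (T2 : measurableType d2) (R : realType).
Variables (m1 : {sigma_finite_measure set T1 -> \bar R})
          (m2 : {sigma_finite_measure set T2 -> \bar R}).

Lemma ae_prod1 (P : T1 -> Prop) : {ae m1, forall x, P x} ->
  {ae prodm m1 m2, forall z, P z.1}.
Proof.
move=> [N [mN N0 NP]]; exists (N `*` setT); split.
- exact: measurableX.
- apply: (etrans (product_measure1E m1 m2 mN measurableT)).
  by apply: (etrans (f_equal (fun u => u * _)%E N0)); exact: mul0e.
- by move=> [x y] /= Pz; split => //; exact: NP.
Qed.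

Lemma ae_prod2 (P : T2 -> Prop) : {ae m2, forall x, P x} ->
  {ae prodm m1 m2, forall z, P z.2}.
Proof.
move=> [N [mN N0 NP]]; exists (setT `*` N); split.
- exact: measurableX.
- apply: (etrans (product_measure1E m1 m2 measurableT mN)).
  by apply: (etrans (f_equal (fun u => _ * u)%E N0)); exact: mule0.
- by move=> [x y] /= Pz; split => //; exact: NP.
Qed.
End almost_everywhere.

Section ae_logic.
Context d (T : measurableType d) (R : realType) (mu : {measure set T -> \bar R}).
Lemma ae_and (P Q : T -> Prop) : {ae mu, forall x, P x} -> {ae mu, forall x, Q x} ->
  {ae mu, forall x, P x /\ Q x}.
Proof. by move=> HP HQ; apply: filterS2 HP HQ => x. Qed.
Lemma ae_mono (P Q : T -> Prop) : (forall x, P x -> Q x) ->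
  {ae mu, forall x, P x} -> {ae mu, forall x, Q x}.
Proof. by move=> PQ; apply: filterS. Qed.
End ae_logic.

Section ae_coordinates.
Context (R : realType).

Definition nonzero_coords (g : G R) : Prop :=
  [/\ [/\ g.1.1.1.1.1.1 != 0, g.1.1.1.1.1.2 != 0 & g.1.1.1.1.2 != 0],
      [/\ g.1.1.1.2 != 0, g.1.1.2 != 0 & g.1.2 != 0] & g.2 != 0].

Lemma ae_nonzero : {ae m1 R, forall x : R, x != 0}.
Proof.
exists [set 0]; split => //; first exact: lebesgue_measure_set1.
by move=> x /= /negP; rewrite negbK => /eqP.
Qed.

(** On the coordinate hyperplanes, a null set, the majorants degenerate and
    the integral that defines N may diverge. *)
Lemma ae_nonzero_coords : {ae @hm R, forall g, nonzero_coords g}.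
Proof.
have a1 := ae_nonzero.
have k6 : {ae @hm R, forall g : G R, g.2 != 0}.
  exact: (@ae_prod2 _ _ _ _ R (@m6 R) (m1 R) _ a1).
have k5 : {ae @hm R, forall g : G R, g.1.2 != 0}.
  exact: (@ae_prod1 _ _ _ _ R (@m6 R) (m1 R) _ (@ae_prod2 _ _ _ _ R (@m5 R) (m1 R) _ a1)).
have k4' : {ae @m6 R, forall g, g.1.2 != 0}.
  exact: (@ae_prod1 _ _ _ _ R (@m5 R) (m1 R) _ (@ae_prod2 _ _ _ _ R (@m4 R) (m1 R) _ a1)).
have k4 : {ae @hm R, forall g : G R, g.1.1.2 != 0}.
  exact: (@ae_prod1 _ _ _ _ R (@m6 R) (m1 R) _ k4').
have k3'' : {ae @m5 R, forall g, g.1.2 != 0}.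
  exact: (@ae_prod1 _ _ _ _ R (@m4 R) (m1 R) _ (@ae_prod2 _ _ _ _ R (@m3 R) (m1 R) _ a1)).
have k3' : {ae @m6 R, forall g, g.1.1.2 != 0}.
  exact: (@ae_prod1 _ _ _ _ R (@m5 R) (m1 R) _ k3'').
have k3 : {ae @hm R, forall g : G R, g.1.1.1.2 != 0}.
  exact: (@ae_prod1 _ _ _ _ R (@m6 R) (m1 R) _ k3').
have up4 (P : R * R * R * R -> Prop) : {ae @m4 R, forall g, P g} ->
    {ae @hm R, forall g : G R, P g.1.1.1}.
  move=> h4.
  have h5 : {ae @m5 R, forall g, P g.1} by exact: (@ae_prod1 _ _ _ _ R (@m4 R) (m1 R) _ h4).
  have h6 : {ae @m6 R, forall g, P g.1.1} by exact: (@ae_prod1 _ _ _ _ R (@m5 R) (m1 R) _ h5).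
  exact: (@ae_prod1 _ _ _ _ R (@m6 R) (m1 R) _ h6).
have up2 (P : R * R -> Prop) : {ae @m2 R, forall g, P g} ->
    {ae @hm R, forall g : G R, P g.1.1.1.1.1}.
  move=> h2.
  have h3 : {ae @m3 R, forall g, P g.1} by exact: (@ae_prod1 _ _ _ _ R (@m2 R) (m1 R) _ h2).
  have h4 : {ae @m4 R, forall g, P g.1.1} by exact: (@ae_prod1 _ _ _ _ R (@m3 R) (m1 R) _ h3).
  exact: (up4 (fun g => P g.1.1)).
have k2 : {ae @hm R, forall g : G R, g.1.1.1.1.2 != 0}.
  apply: (up4 (fun g => g.1.2 != 0)).
  exact: (@ae_prod1 _ _ _ _ R (@m3 R) (m1 R) _ (@ae_prod2 _ _ _ _ R (@m2 R) (m1 R) _ a1)).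
have k1 : {ae @hm R, forall g : G R, g.1.1.1.1.1.2 != 0}.
  exact: (up2 (fun g => g.2 != 0) (@ae_prod2 _ _ _ _ R (m1 R) (m1 R) _ a1)).
have k0 : {ae @hm R, forall g : G R, g.1.1.1.1.1.1 != 0}.
  exact: (up2 (fun g => g.1 != 0) (@ae_prod1 _ _ _ _ R (m1 R) (m1 R) _ a1)).
have K := ae_and (ae_and (ae_and k0 k1) (ae_and k2 k3))
  (ae_and (ae_and k4 k5) k6).
by apply: ae_mono K => g [[[? ?] [? ?]] [[? ?] ?]].
Qed.
End ae_coordinates.

Section ae_integrability.
Context d (T : measurableType d) (R : realType) (mu : {measure set T -> \bar R}).

Lemma ae_integrable_dom (f h : T -> R) : measurable_fun setT f ->
  {ae mu, forall x, `|f x| <= h x} -> mu.-integrable setT (EFin \o h) ->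
  mu.-integrable setT (EFin \o f).
Proof.
move=> mf fh hi; have := hi => /integrableP[/measurable_EFinP mh hoo].
apply/integrableP; split; first exact/measurable_EFinP.
apply: le_lt_trans hoo; apply: ae_ge0_le_integral => //.
- by apply/measurable_EFinP; exact: measurableT_comp.
- by apply/measurable_EFinP; exact: measurableT_comp.
- by apply: filterS fh => x fhx _; rewrite /= lee_fin (le_trans fhx) // ler_norm.
Qed.

Lemma dominated_cvg_Rintegral (f_ : nat -> T -> R) (f h : T -> R) :
  (forall n, measurable_fun setT (f_ n)) -> measurable_fun setT f ->
  {ae mu, forall x, (f_ n x @[n --> \oo] --> f x) /\ forall n, `|f_ n x| <= h x} ->
  mu.-integrable setT (EFin \o h) ->
  Rintegral mu setT (f_ n) @[n --> \oo] --> Rintegral mu setT f.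
Proof.
move=> mf_ mf H hi.
have if_ n : mu.-integrable setT (EFin \o f_ n).
  by apply: ae_integrable_dom hi => //; apply: filterS H => x [_ ].
have [|||||fi _ cv] := @dominated_convergence _ _ R mu setT measurableT
  (fun n => EFin \o f_ n) (EFin \o f) (EFin \o h).
- by move=> n; exact/measurable_EFinP.
- exact/measurable_EFinP.
- by apply: filterS H => x [cx _] _; apply: cvg_EFin => //; exact: nearW.
- exact: hi.
- by apply: filterS H => x [_ bx] n _; rewrite /= lee_fin.
apply: (fine_cvg (f := fun n => (\int[mu]_x (f_ n x)%:E)%E)).
rewrite fineK; last exact: integrable_fin_num.
exact: cv.
Qed.
End ae_integrability.

(** * Right-invariant fields and the operator L *)

Section smooth_comp.
Context (R : realType) (V : normedModType R).
Implicit Types (f : V -> R).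

Lemma Ck_ext n f h : f =1 h -> Ck n f -> Ck n h.
Proof. by move=> /funext ->. Qed.

Lemma Coo_is_derive f v x : Coo f -> is_derive x v f ('D_v f x).
Proof. by move=> cf; apply/derivableP/Coo_derivable. Qed.

Lemma Coo_exp f : Coo f -> Coo (fun x => expR (f x)).
Proof.
move=> cf; elim=> [|n IH].
  split=> // x; apply: continuous_comp; [exact: Coo_cont cf x|exact: continuous_expR].
split.
  by move=> x; apply: continuous_comp; [exact: Coo_cont cf x|exact: continuous_expR].
move=> v; have H y := dexp (Coo_is_derive v y cf); split.
  by move=> y; apply: (is_derive_ex (H y)).
apply: Ck_ext (CkM IH (Coo_D v cf n)) => y /=; by rewrite (is_deriveE (H y)).
Qed.

Lemma Coo_opp f : Coo f -> Coo (fun x => - f x).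
Proof.
move=> cf n; apply: Ck_ext (CkM (Ck_cst _ n (-1)) (cf n)) => x /=; by rewrite mulN1r.
Qed.

Lemma Coo_cos_sin f : Coo f -> Coo (fun x => cos (f x)) /\ Coo (fun x => sin (f x)).
Proof.
move=> cf.
have ccos : continuous (fun x => cos (f x)).
  by move=> x; apply: continuous_comp; [exact: Coo_cont cf x|exact: continuous_cos].
have cs : continuous (fun x => sin (f x)).
  by move=> x; apply: continuous_comp; [exact: Coo_cont cf x|exact: continuous_sin].
have H n : Ck n (fun x => cos (f x)) /\ Ck n (fun x => sin (f x)).
  elim: n => [|n [IHc IHs]]; first by split; split.
  have Hc v y := dcos (Coo_is_derive v y cf).
  have Hs v y := dsin (Coo_is_derive v y cf).
  split; split=> // v; split.
  - by move=> y; apply: (is_derive_ex (Hc v y)).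
  - apply: Ck_ext (CkM (CkM (Ck_cst _ n (-1)) IHs) (Coo_D v cf n)) => y /=.
    by rewrite (is_deriveE (Hc v y)) mulN1r.
  - by move=> y; apply: (is_derive_ex (Hs v y)).
  - apply: Ck_ext (CkM IHc (Coo_D v cf n)) => y /=.
    by rewrite (is_deriveE (Hs v y)).
by split=> n; case: (H n).
Qed.
End smooth_comp.

Section fields.
Context (R : realType).
Implicit Types (f h : G R -> R) (g v u w : G R).
Notation L1 f := ((@hm R).-integrable setT (EFin \o f)).
Notation I7 f := (Rintegral (@hm R) setT f).

Definition et : G R := (0, 0, 0, 0, 0, 0, 1).
Definition e1 : G R := (1, 0, 0, 0, 0, 0, 0).
Definition e2 : G R := (0, 1, 0, 0, 0, 0, 0).
Definition e3 : G R := (0, 0, 1, 0, 0, 0, 0).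
Definition e4 : G R := (0, 0, 0, 1, 0, 0, 0).
Definition e5 : G R := (0, 0, 0, 0, 1, 0, 0).
Definition e6 : G R := (0, 0, 0, 0, 0, 1, 0).

Lemma Coo_coords :
  [/\ [/\ Coo (fun g : G R => g.1.1.1.1.1.1),
          Coo (fun g : G R => g.1.1.1.1.1.2) &
          Coo (fun g : G R => g.1.1.1.1.2)],
      [/\ Coo (fun g : G R => g.1.1.1.2),
          Coo (fun g : G R => g.1.1.2) &
          Coo (fun g : G R => g.1.2)] &
      Coo (fun g : G R => g.2)].
Proof.
have [[c1 c2 c3] [c4 c5 c6] c7] := continuous_coords R.
by split; [split|split|]; apply: Coo_linear.
Qed.

Lemma is_derive_lin (l : G R -> R) g v : (forall (h : R) u, l (h *: v + u) = h * l v + l u) ->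
  is_derive g v l (l v).
Proof. by move=> H; apply: is_derive_linear. Qed.

(** Twice the symplectic form of C^2 in real coordinates: the term that the
    group law adds to t, up to sign, and the coefficient of d/dt in the
    invariant field in the direction v. *)
Definition sympl w v : R := 2 * (w.1.1.1.1.1.1 * v.1.1.1.1.1.2 - w.1.1.1.1.1.2 * v.1.1.1.1.1.1
  + (w.1.1.1.1.2 * v.1.1.1.2 - w.1.1.1.2 * v.1.1.1.1.2)).

Lemma symplD w v u : sympl w (v + u) = sympl w v + sympl w u.
Proof. by rewrite /sympl /=; ring. Qed.
Lemma symplZ w v (h : R) : sympl w (h *: v) = h * sympl w v.
Proof. by rewrite /sympl /= /GRing.scale /=; ring. Qed.
Lemma symplC w v : sympl w v = - sympl v w.
Proof. by rewrite /sympl /=; ring. Qed.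
Lemma sympl_etr w : sympl w et = 0. Proof. by rewrite /sympl /=; ring. Qed.
Lemma sympl_etl v : sympl et v = 0. Proof. by rewrite /sympl /=; ring. Qed.
Lemma symplvv v : sympl v v = 0. Proof. by rewrite /sympl; ring. Qed.

Lemma Coo_sympl v : Coo (sympl^~ v).
Proof.
have [[k1 k2 k3] [k4 k5 k6] k7] := Coo_coords.
have C (c : R) : Coo (fun _ : G R => c) by exact: Coo_cst.
by apply: CooM => //; apply: CooD; (apply: CooD; [|apply: Coo_opp]); exact: CooM.
Qed.

Lemma sympl_derive v u g : is_derive g u (sympl^~ v) (sympl u v).
Proof. by apply: is_derive_lin => h w; rewrite /sympl /= /GRing.scale /=; ring. Qed.

(** The field D_v + sympl (., v) D_t commutes with right translations. With X_j
    and Y_j the fields in the directions x_j and y_j, Z_j = (X_j - i Y_j) / 2. *)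
Definition fld v f g : R := 'D_v f g + sympl g v * 'D_et f g.

Lemma Coo_fld v f : Coo f -> Coo (fld v f).
Proof.
by move=> cf; apply: CooD; [apply: Coo_D|apply: CooM; [exact: Coo_sympl|apply: Coo_D]].
Qed.

Lemma bsupp_fld v f : bsupp f -> bsupp (fld v f).
Proof.
move=> bf; apply: bsuppD; first exact: bsupp_derive.
by apply: bsuppMr; apply: bsupp_derive.
Qed.

Lemma fldM v f h g : Coo f -> Coo h ->
  fld v (f \* h) g = f g * fld v h g + fld v f g * h g.
Proof.
move=> cf ch; rewrite /fld.
rewrite (is_deriveE (dM (Coo_is_derive v g cf) (Coo_is_derive v g ch))).
rewrite (is_deriveE (dM (Coo_is_derive et g cf) (Coo_is_derive et g ch))).
by move: ('D_v f g) ('D_v h g) ('D_et f g) ('D_et h g) => *; ring.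
Qed.

Lemma RintegralD_ f h : L1 f -> L1 h -> I7 (fun g => f g + h g) = I7 f + I7 h.
Proof. by move=> i1 i2; rewrite -RintegralD. Qed.

Lemma RintegralZ_ c f : L1 f -> I7 (fun g => c * f g) = c * I7 f.
Proof. by move=> i1; rewrite -RintegralZl. Qed.

(** The field has divergence 0, as its coefficient does not depend on t. *)
Lemma integral_fld0 v f : Coo f -> bsupp f -> I7 (fld v f) = 0.
Proof.
move=> cf bf; have cv := Coo_sympl v.
have E : (fun g => sympl g v * 'D_et f g) = 'D_et ((sympl^~ v) \* f).
  apply/funext => g; rewrite (is_deriveE (dM (sympl_derive v et g) (Coo_is_derive et g cf))).
  by rewrite sympl_etl mulr0 addr0.
rewrite /fld RintegralD_.
- rewrite integral_derive0 // E integral_derive0 ?addr0 //; first exact: CooM.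
  exact: bsuppMr.
- by apply: integrable_bsupp; [apply/Coo_cont/Coo_D|apply: bsupp_derive].
- apply: integrable_bsupp; first by rewrite E; apply/Coo_cont/Coo_D/CooM.
  by apply: bsuppMr; apply: bsupp_derive.
Qed.

Lemma fld_ibp v f h : Coo f -> Coo h -> bsupp h ->
  I7 (fun g => f g * fld v h g) = - I7 (fun g => fld v f g * h g).
Proof.
move=> cf ch bh; apply/eqP; rewrite -addr_eq0 -RintegralD_.
- apply/eqP; rewrite -(integral_fld0 v (CooM cf ch) (bsuppMr _ bh)).
  by congr (Rintegral _ _ _); apply/funext => g /=; rewrite fldM.
- apply: integrable_bsupp; last by apply: bsuppMr; apply: bsupp_fld.
  by apply: Coo_cont; apply: CooM => //; apply: Coo_fld.
- apply: integrable_bsupp; last by apply: bsuppMr.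
  by apply: Coo_cont; apply: CooM => //; apply: Coo_fld.
Qed.

Definition fld2 v f := fld v (fld v f).

Lemma Coo_fld2 v f : Coo f -> Coo (fld2 v f).
Proof. by move=> cf; do 2!apply: Coo_fld. Qed.

Lemma bsupp_fld2 v f : bsupp f -> bsupp (fld2 v f).
Proof. by move=> bf; do 2!apply: bsupp_fld. Qed.

Lemma fld2_ibp v f h : Coo f -> Coo h -> bsupp h ->
  I7 (fun g => f g * fld2 v h g) = I7 (fun g => fld2 v f g * h g).
Proof.
move=> cf ch bh; rewrite fld_ibp //; first last.
- exact: bsupp_fld.
- exact: Coo_fld.
by rewrite fld_ibp ?opprK //; apply: Coo_fld.
Qed.

(** The operator to which Box_k reduces for k < 2. *)
Definition L f g : R := - (4^-1 *
  (fld2 e1 f g + fld2 e2 f g + fld2 e3 f g + fld2 e4 f g + fld2 e5 f g + fld2 e6 f g)).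

Lemma Coo_L f : Coo f -> Coo (L f).
Proof.
move=> cf; apply: Coo_opp; apply: (CooM (Coo_cst _ _)).
by do 5!(apply: CooD; last by apply: Coo_fld2); apply: Coo_fld2.
Qed.

Lemma bsupp_L f : bsupp f -> bsupp (L f).
Proof.
move=> bf; have B v := bsupp_fld2 v bf.
rewrite /L; have [M HM] : bsupp (fld2 e1 f \+ fld2 e2 f \+ fld2 e3 f \+ fld2 e4 f
   \+ fld2 e5 f \+ fld2 e6 f) by do 5!(apply: bsuppD => //).
by exists M => g Mg; have /= -> := HM _ Mg; rewrite mulr0 oppr0.
Qed.

Lemma Rintegral_sum6 k (f1 f2 f3 f4 f5 f6 : G R -> R) :
  L1 f1 -> L1 f2 -> L1 f3 -> L1 f4 -> L1 f5 -> L1 f6 ->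
  I7 (fun g => k * (f1 g + f2 g + f3 g + f4 g + f5 g + f6 g)) =
  k * (I7 f1 + I7 f2 + I7 f3 + I7 f4 + I7 f5 + I7 f6).
Proof.
move=> i1 i2 i3 i4 i5 i6.
have AD (p q : G R -> R) : L1 p -> L1 q -> L1 (fun g => p g + q g).
  by move=> ip iq; exact: (integrableD measurableT ip iq).
have j2 := AD _ _ i1 i2; have j3 := AD _ _ j2 i3; have j4 := AD _ _ j3 i4.
have j5 := AD _ _ j4 i5; have j6 := AD _ _ j5 i6.
by rewrite (RintegralZ_ k j6) (RintegralD_ j5 i6) (RintegralD_ j4 i5) (RintegralD_ j3 i4)
  (RintegralD_ j2 i3) (RintegralD_ i1 i2).
Qed.

Lemma L_ibp f h : Coo f -> Coo h -> bsupp h ->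
  I7 (fun g => f g * L h g) = I7 (fun g => L f g * h g).
Proof.
move=> cf ch bh.
have A v : L1 (fun g => f g * fld2 v h g).
  apply: integrable_bsupp; last by apply: bsuppMr; exact: bsupp_fld2.
  by apply: Coo_cont; apply: CooM => //; apply: Coo_fld2.
have B v : L1 (fun g => fld2 v f g * h g).
  apply: integrable_bsupp; last by apply: bsuppMr.
  by apply: Coo_cont; apply: CooM => //; apply: Coo_fld2.
have E v := fld2_ibp v cf ch bh.
rewrite (_ : (fun g => f g * L h g) = (fun g => (- 4^-1) *
  (f g * fld2 e1 h g + f g * fld2 e2 h g + f g * fld2 e3 h g + f g * fld2 e4 h g
   + f g * fld2 e5 h g + f g * fld2 e6 h g))); last first.
  apply/funext => g; rewrite /L.
  by move: (fld2 _ _ _) (fld2 _ _ _) (fld2 _ _ _) (fld2 _ _ _) (fld2 _ _ _)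
    (fld2 _ _ _) (f g) (h g) => *; ring.
rewrite (_ : (fun g => L f g * h g) = (fun g => (- 4^-1) *
  (fld2 e1 f g * h g + fld2 e2 f g * h g + fld2 e3 f g * h g + fld2 e4 f g * h g
   + fld2 e5 f g * h g + fld2 e6 f g * h g))); last first.
  apply/funext => g; rewrite /L.
  by move: (fld2 _ _ _) (fld2 _ _ _) (fld2 _ _ _) (fld2 _ _ _) (fld2 _ _ _)
    (fld2 _ _ _) (f g) (h g) => *; ring.
rewrite !Rintegral_sum6; do ?[exact: A|exact: B].
have K k (x1 x2 x3 x4 x5 x6 y1 y2 y3 y4 y5 y6 : R) : x1 = y1 -> x2 = y2 -> x3 = y3 ->
    x4 = y4 -> x5 = y5 -> x6 = y6 ->
    k * (x1 + x2 + x3 + x4 + x5 + x6) = k * (y1 + y2 + y3 + y4 + y5 + y6).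
  by move=> -> -> -> -> -> ->.
exact (K _ _ _ _ _ _ _ _ _ _ _ _ _ (E _) (E _) (E _) (E _) (E _) (E _)).
Qed.

End fields.

(** * L on Gaussian waves *)

Lemma is_derive_conv (R : realType) (V : normedModType R) (f : V -> R) (x v : V) (l m : R) :
  is_derive x v f l -> l = m -> is_derive x v f m.
Proof. by move=> H <-. Qed.

Section gaussian_fields.
Context (R : realType).
Implicit Types (g v : G R) (a b tau : R).

Definition sq12 g : R := g.1.1.1.1.1.1 ^+ 2 + g.1.1.1.1.1.2 ^+ 2 + g.1.1.1.1.2 ^+ 2 + g.1.1.1.2 ^+ 2.
Definition sq3 g : R := g.1.1.2 ^+ 2 + g.1.2 ^+ 2.
Definition quad a b g : R := a * sq12 g + b * sq3 g.
(** Ecos and Esin are the real and imaginary parts of the waves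
    e^(-tau (P - i t)), where P = a |z'|^2 + b |z_3|^2. *)
Definition Ecos a b tau g : R := expR (- (tau * quad a b g)) * cos (tau * g.2).
Definition Esin a b tau g : R := expR (- (tau * quad a b g)) * sin (tau * g.2).

(** A field maps e^(-tau (P - i t)) to its multiple by - tau (p - i c), where
    p = D_v P is linear and c is the coefficient of the field; the square of the
    field multiplies by tau^2 (p - i c)^2 - tau p'. *)
Lemma fld2_Ecos a b tau v (p : G R -> R) (p' : R) :
  (forall g, is_derive g v (quad a b) (p g)) ->
  (forall g, is_derive g (et R) (quad a b) 0) ->
  (forall g, is_derive g v p p') -> (forall g, is_derive g (et R) p 0) -> v.2 = 0 ->
  forall g, fld2 v (Ecos a b tau) g =
    (tau ^+ 2 * (p g ^+ 2 - sympl g v ^+ 2) - tau * p') * Ecos a b tau g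
    + 2 * tau ^+ 2 * (p g * sympl g v) * Esin a b tau g.
Proof.
move=> qv qt pv pt v0.
have tv g : is_derive g v (fun g : G R => tau * g.2) 0.
  have D : is_derive g v (fun g : G R => g.2) v.2 by apply: is_derive_lin.
  by apply: (is_derive_conv (dM (dcst tau g v) D)); rewrite v0 !mulr0 addr0.
have tt g : is_derive g (et R) (fun g : G R => tau * g.2) tau.
  have D : is_derive g (et R) (fun g : G R => g.2) (et R).2 by apply: is_derive_lin.
  by apply: (is_derive_conv (dM (dcst tau g (et R)) D)); rewrite /= mulr1 mulr0 addr0.
have ev w (l : G R -> R) (m : R) g : is_derive g w (quad a b) (l g) ->
   is_derive g w (fun g : G R => tau * g.2) m ->
   is_derive g w (Ecos a b tau) (- (tau * l g) * Ecos a b tau g - m * Esin a b tau g) /\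
   is_derive g w (Esin a b tau) (- (tau * l g) * Esin a b tau g + m * Ecos a b tau g).
  move=> D1 D2; have D3 := dexp (dN (dM (dcst tau g w) D1)).
  rewrite /Ecos /Esin; split; [apply: (is_derive_conv (dM D3 (dcos D2)))|apply: (is_derive_conv (dM D3 (dsin D2)))];
    move: (sin _) (cos _) (expR _) => *; ring.
have Ev g := (ev v p 0 g (qv g) (tv g)).1.
have Sv g := (ev v p 0 g (qv g) (tv g)).2.
have Et g := (ev (et R) (fun=> 0) tau g (qt g) (tt g)).1.
have St g := (ev (et R) (fun=> 0) tau g (qt g) (tt g)).2.
have FE : fld v (Ecos a b tau) = fun g => - tau * (p g * Ecos a b tau g + sympl g v * Esin a b tau g).
  apply/funext => g; rewrite /fld (is_deriveE (Ev g)) (is_deriveE (Et g)).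
  by move: (p g) (sympl g v) (Ecos _ _ _ _) (Esin _ _ _ _) => *; ring.
move=> g; rewrite /fld2 FE /fld.
rewrite (is_deriveE (dM (dcst (- tau) g v) (dD (dM (pv g) (Ev g)) (dM (sympl_derive v v g) (Sv g))))).
rewrite (is_deriveE (dM (dcst (- tau) g (et R)) (dD (dM (pt g) (Et g)) (dM (sympl_derive v (et R) g) (St g))))).
rewrite symplvv sympl_etl.
by move: (p g) (sympl g v) (Ecos _ _ _ _) (Esin _ _ _ _) => *; ring.
Qed.

(** In the sum over the four directions of z' the cross terms p c cancel: P is
    radial there, and the coefficients c generate a rotation. *)
Lemma L_Ecos a b tau g : L (Ecos a b tau) g =
  (tau * (2 * a + b) - tau ^+ 2 * ((a ^+ 2 - 1) * sq12 g + b ^+ 2 * sq3 g)) * Ecos a b tau g.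
Proof.
have coord (l : G R -> R) v g' : (forall (h : R) u, l (h *: v + u) = h * l v + l u) ->
  is_derive g' v l (l v) by apply: is_derive_lin.
have qv v g' (l : R) : l = a * (2 * g'.1.1.1.1.1.1 * v.1.1.1.1.1.1 + 2 * g'.1.1.1.1.1.2 * v.1.1.1.1.1.2
    + 2 * g'.1.1.1.1.2 * v.1.1.1.1.2 + 2 * g'.1.1.1.2 * v.1.1.1.2)
    + b * (2 * g'.1.1.2 * v.1.1.2 + 2 * g'.1.2 * v.1.2) ->
    is_derive g' v (quad a b) l.
  move=> ->; have D1 : is_derive g' v (fun g : G R => g.1.1.1.1.1.1) v.1.1.1.1.1.1 by apply: coord.
  have D2 : is_derive g' v (fun g : G R => g.1.1.1.1.1.2) v.1.1.1.1.1.2 by apply: coord.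
  have D3 : is_derive g' v (fun g : G R => g.1.1.1.1.2) v.1.1.1.1.2 by apply: coord.
  have D4 : is_derive g' v (fun g : G R => g.1.1.1.2) v.1.1.1.2 by apply: coord.
  have D5 : is_derive g' v (fun g : G R => g.1.1.2) v.1.1.2 by apply: coord.
  have D6 : is_derive g' v (fun g : G R => g.1.2) v.1.2 by apply: coord.
  rewrite /quad /sq12 /sq3; apply: (is_derive_conv
    (dD (dM (dcst a g' v) (dD (dD (dD (dX 2 D1) (dX 2 D2)) (dX 2 D3)) (dX 2 D4)))
              (dM (dcst b g' v) (dD (dX 2 D5) (dX 2 D6))))).
  by rewrite /=; ring.
have kl v g' (k : R) (l : G R -> R) (m : R) : (forall (h : R) u, l (h *: v + u) = h * l v + l u) ->
    m = k * l v -> is_derive g' v (fun g => k * l g) m.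
  move=> H ->; apply: (is_derive_conv (dM (dcst k g' v) (coord l v g' H))).
  by rewrite mulr0 addr0.
have K v (k : R) (p : G R -> R) :
    (forall (h : R) u w, p (h *: u + w) = h * p u + p w) -> p (et R) = 0 -> v.2 = 0 -> p v = 1 ->
    (forall g', is_derive g' v (quad a b) (k * p g')) ->
    fld2 v (Ecos a b tau) g = (tau ^+ 2 * ((k * p g) ^+ 2 - sympl g v ^+ 2) - tau * k) * Ecos a b tau g
    + 2 * tau ^+ 2 * (k * p g * sympl g v) * Esin a b tau g.
  move=> lp pt v0 pv d3.
  apply: (@fld2_Ecos a b tau v (fun g => k * p g) k d3) => //.
  - by move=> g'; apply: qv; rewrite /=; ring.
  - by move=> g'; apply: kl => //; rewrite pv mulr1.
  - by move=> g'; apply: kl => //; rewrite pt mulr0.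
have K1 := @K (e1 R) (2 * a) (fun g => g.1.1.1.1.1.1) (fun _ _ _ => erefl) erefl erefl erefl.
have K2 := @K (e2 R) (2 * a) (fun g => g.1.1.1.1.1.2) (fun _ _ _ => erefl) erefl erefl erefl.
have K3 := @K (e3 R) (2 * a) (fun g => g.1.1.1.1.2) (fun _ _ _ => erefl) erefl erefl erefl.
have K4 := @K (e4 R) (2 * a) (fun g => g.1.1.1.2) (fun _ _ _ => erefl) erefl erefl erefl.
have K5 := @K (e5 R) (2 * b) (fun g => g.1.1.2) (fun _ _ _ => erefl) erefl erefl erefl.
have K6x := @K (e6 R) (2 * b) (fun g => g.1.2) (fun _ _ _ => erefl) erefl erefl erefl.
have q1 g' : is_derive g' (e1 R) (quad a b) ((2 * a) * g'.1.1.1.1.1.1) by apply: qv => /=; ring.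
have q2 g' : is_derive g' (e2 R) (quad a b) ((2 * a) * g'.1.1.1.1.1.2) by apply: qv => /=; ring.
have q3 g' : is_derive g' (e3 R) (quad a b) ((2 * a) * g'.1.1.1.1.2) by apply: qv => /=; ring.
have q4 g' : is_derive g' (e4 R) (quad a b) ((2 * a) * g'.1.1.1.2) by apply: qv => /=; ring.
have q5 g' : is_derive g' (e5 R) (quad a b) ((2 * b) * g'.1.1.2) by apply: qv => /=; ring.
have q6 g' : is_derive g' (e6 R) (quad a b) ((2 * b) * g'.1.2) by apply: qv => /=; ring.
rewrite /L (K1 q1) (K2 q2) (K3 q3) (K4 q4) (K5 q5) (K6x q6).
rewrite /sympl /sq12 /sq3 /=.
move: (Ecos _ _ _ _) (Esin _ _ _ _) (g.1.1.1.1.1.1) (g.1.1.1.1.1.2) (g.1.1.1.1.2) (g.1.1.1.2) (g.1.1.2) (g.1.2) => *.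
by field.
Qed.

Lemma Coo_Ecos a b tau : Coo (Ecos a b tau).
Proof.
have [[k1 k2 k3] [k4 k5 k6] k7] := Coo_coords R.
have sc (c : R) (f : G R -> R) : Coo f -> Coo (fun g => c * f g).
  by move=> cf; exact: (CooM (Coo_cst _ c) cf).
have X2 (f : G R -> R) : Coo f -> Coo (fun g => f g ^+ 2) by move=> cf; exact: (CooM cf cf).
apply: CooM; last by apply: (Coo_cos_sin (sc _ _ k7)).1.
apply: Coo_exp; apply: Coo_opp; apply/sc/CooD; apply/sc.
  by do 3!(apply: CooD; last exact/X2); exact/X2.
by apply: CooD; exact/X2.
Qed.
End gaussian_fields.

(** * The weights of the kernel and their domination *)

Section restriction.
Context d (T : measurableType d) (R : realType) (mu : {measure set T -> \bar R}).

Lemma Rintegral_ind (D : set T) (f : T -> R) :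
  Rintegral mu D f = Rintegral mu setT (fun x => \1_D x * f x).
Proof.
rewrite Rintegral_mkcond; congr (Rintegral _ _ _); apply/funext => x.
by rewrite patchE indicE; case: ifP => _; rewrite ?mul1r ?mul0r.
Qed.

Lemma integrable_ind_iff (D : set T) (f : T -> R) : measurable D ->
  mu.-integrable D (EFin \o f) <-> mu.-integrable setT (EFin \o (fun x => \1_D x * f x)).
Proof.
move=> mD; rewrite (integrable_mkcond _ mD) (_ : _ \_ D = EFin \o (fun x => \1_D x * f x)) //.
apply/funext => x; rewrite patchE /= indicE; by case: ifP => _; rewrite ?mul1r ?mul0r.
Qed.
End restriction.

Section weights.
Context (R : realType).
Implicit Types (r : R).

(** The weights of the kernel as functions of r = e^(-mln r): its quadratic
    form is [quad (alpha r) (beta r)] and its density is [weight r]. *)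
Definition mln r : R := - ln r.
Definition alpha r : R := (1 + r) / (1 - r).
Definition beta r : R := 2 / mln r.
Definition weight r : R := (mln r * (1 - r) ^+ 2)^-1.
(** With this factor the r-derivative of the waves is a multiple of their image
    under L: w L Ecos = tau d/dr (bweight Ecos), by is_derive_Q and L_Ecos. *)
Definition bweight r : R := 2 * r * weight r.

Lemma mln_gt0 r : 0 < r < 1 -> 0 < mln r.
Proof. by move=> r01; rewrite /mln oppr_gt0 ln_lt0. Qed.

Lemma weights_pos r : 0 < r < 1 ->
  [/\ 0 < mln r, 1 <= alpha r, 0 < beta r, 0 < weight r & 0 < bweight r].
Proof.
move=> r01; have l0 := mln_gt0 r01; have /andP[r0 r1] := r01.
have s0 : 0 < 1 - r by rewrite subr_gt0.
have w0 : 0 < weight r by rewrite /weight invr_gt0 mulr_gt0 // exprn_gt0.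
split=> //; rewrite /beta /bweight.
- by rewrite /alpha ler_pdivlMr // mul1r; lra.
- by rewrite divr_gt0.
- by rewrite !mulr_gt0.
Qed.

Lemma beta_le_alpha r : 0 < r < 1 -> beta r <= alpha r.
Proof.
move=> r01; have l0 := mln_gt0 r01; have /andP[r0 r1] := r01.
have := lnr_lb r01; rewrite -/(mln r) /beta /alpha => H.
by rewrite ler_pdivrMr // mulrAC ler_pdivlMr ?subr_gt0 // [leRHS]mulrC -ler_pdivrMr ?addr_gt0.
Qed.

(** The fourth power of w b^(-9/4) <= r^(-3/4) (1 - r)^(-3/4). In terms of
    l = - ln r it follows from r^3 l^5 <= (1 - r)^5. *)
Lemma weight_beta r : 0 < r < 1 -> weight r ^+ 4 <= kappa2 r ^+ 4 * beta r ^+ 9.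
Proof.
move=> r01; have l0 := mln_gt0 r01; have /andP[r0 r1] := r01.
have s0 : 0 < 1 - r by rewrite subr_gt0.
have h1 := lnr_ub r01; have h2 := lnr_ub_inv r01.
rewrite /kappa2 r01 exprMn !kappa4 ?gt_eqF // !gtr0_norm // /beta /weight -/(mln r) in h1 h2 *.
have h3 : r ^+ 3 * mln r ^+ 5 <= (1 - r) ^+ 5.
  have e1 : r * mln r ^+ 2 <= (1 - r) ^+ 2 by rewrite /mln sqrrN.
  have e2 : r * mln r <= 1 - r by rewrite mulrC -ler_pdivlMr.
  have -> : r ^+ 3 * mln r ^+ 5 = (r * mln r ^+ 2) * (r * mln r ^+ 2) * (r * mln r) by ring.
  have -> : (1 - r) ^+ 5 = (1 - r) ^+ 2 * (1 - r) ^+ 2 * (1 - r) by ring.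
  have p1 : 0 <= r * mln r ^+ 2 by rewrite mulr_ge0 ?exprn_ge0 // ltW.
  have p2 : 0 <= r * mln r by rewrite mulr_ge0 // ltW.
  by apply: ler_pM => //; [exact: mulr_ge0|exact: ler_pM].
move: (mln r) l0 h3 => l l0 h3; clear h1 h2.
have rn : r != 0 by rewrite gt_eqF.
have sn : 1 - r != 0 by rewrite gt_eqF.
have ln : l != 0 by rewrite gt_eqF.
have -> : (l * (1 - r) ^+ 2)^-1 ^+ 4 = (l ^+ 9 * r ^+ 3 * (1 - r) ^+ 8)^-1 * (r ^+ 3 * l ^+ 5).
  by field; rewrite rn ln sn.
have -> : r ^- 3 * (1 - r) ^- 3 * (2 / l) ^+ 9 =
  (l ^+ 9 * r ^+ 3 * (1 - r) ^+ 8)^-1 * (512 * (1 - r) ^+ 5).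
  by field; rewrite rn ln sn.
apply: ler_wpM2l.
  by rewrite ltW // invr_gt0 (mulr_gt0 (mulr_gt0 (exprn_gt0 9 l0) (exprn_gt0 3 r0)) (exprn_gt0 8 s0)).
by apply: (le_trans h3); rewrite ler_peMl ?exprn_ge0 ?(ltW s0) // ler1n.
Qed.

(** The first ratio governs the mass of the Gaussian with weights (a, a, b) in
    C^3, the second one that of the wider Gaussian with weights (b, b, b). *)
Lemma bweight_bounds r : 0 < r < 1 ->
  bweight r / (alpha r ^+ 2 * beta r) = r / (1 + r) ^+ 2 /\ bweight r / beta r ^+ 3 <= 4^-1.
Proof.
move=> r01; have l0 := mln_gt0 r01; have /andP[r0 r1] := r01.
have s0 : 0 < 1 - r by rewrite subr_gt0.
have h1 := lnr_ub r01.
have e1 : r * mln r ^+ 2 <= (1 - r) ^+ 2 by rewrite /mln sqrrN.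
rewrite /bweight /weight /alpha /beta; move: (mln r) l0 e1 => l l0 e1.
have sn : 1 - r != 0 by rewrite gt_eqF.
have an : 1 + r != 0 by rewrite gt_eqF // addr_gt0.
have ln : l != 0 by rewrite gt_eqF.
split; first by field; rewrite ln sn an.
have -> : 2 * r / (l * (1 - r) ^+ 2) / (2 / l) ^+ 3 = 4^-1 * ((r * l ^+ 2) / (1 - r) ^+ 2).
  by field; rewrite ln sn.
by rewrite ler_piMr ?invr_ge0 // ler_pdivrMr ?exprn_gt0 // mul1r.
Qed.

(** The r-derivative of the weighted exponential. Times tau cos (tau t) it is
    also the image of the wave under L, times the weight w. *)
Definition dQ (tau : R) (g : G R) r : R :=
  weight r * ((2 * alpha r + beta r) - tau * ((alpha r ^+ 2 - 1) * sq12 g + beta r ^+ 2 * sq3 g)) *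
  expR (- (tau * quad (alpha r) (beta r) g)).

(** The identity from which the formula for N comes: by L_Ecos, the weighted
    waves evolve in r under L. *)
Lemma is_derive_Q tau g r : 0 < r < 1 ->
  is_derive r (1 : R) (fun r => bweight r * expR (- (tau * quad (alpha r) (beta r) g))) (dQ tau g r).
Proof.
move=> r01; have l0 := mln_gt0 r01; have /andP[r0 r1] := r01.
have s0 : 0 < 1 - r by rewrite subr_gt0.
have sn : 1 - r != 0 by rewrite gt_eqF.
have ln0 : mln r != 0 by rewrite gt_eqF.
have rn : r != 0 by rewrite gt_eqF.
rewrite /quad /bweight /weight /beta /alpha /mln in ln0 *; derive_by => //.
  by rewrite mulf_neq0 // expf_neq0.
rewrite /dQ /weight /quad /alpha /beta /mln.
move: ln0 {l0 r01}; move: (sq12 g) (sq3 g) (ln r) => u v l l0.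
have ln1 : l != 0 by rewrite -oppr_eq0.
move: (expR _) => e.
by field; rewrite ?rn ?ln1 ?sn.
Qed.

End weights.

Section domination.
Context (R : realType).
Implicit Types (r : R) (g : G R).

(** The majorant in the six real coordinates of z. *)
Definition kappa6 g : R := kappa g.1.1.1.1.1.1 * kappa g.1.1.1.1.1.2 * kappa g.1.1.1.1.2
  * kappa g.1.1.1.2 * kappa g.1.1.2 * kappa g.1.2.

Lemma kappa6_ge0 g : 0 <= kappa6 g.
Proof. by do 5!(apply: mulr_ge0; last exact: kappa_ge0); exact: kappa_ge0. Qed.

(** Each factor is at most |z|^3, and |z|^18 is the right-hand side. *)
Lemma prod6_le (x1 x2 x3 x4 x5 x6 : R) :
  `|x1| ^+ 3 * `|x2| ^+ 3 * `|x3| ^+ 3 * `|x4| ^+ 3 * `|x5| ^+ 3 * `|x6| ^+ 3 <=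
  (x1 ^+ 2 + x2 ^+ 2 + x3 ^+ 2 + x4 ^+ 2 + (x5 ^+ 2 + x6 ^+ 2)) ^+ 9.
Proof.
set s := _ + (_ + _).
have s0 : 0 <= s by rewrite /s !addr_ge0 ?sqr_ge0.
have B (x : R) : x ^+ 2 <= s -> `|x| ^+ 3 <= Num.sqrt s ^+ 3.
  by move=> xs; apply: lerXn2r; rewrite ?nnegrE ?sqrtr_ge0 // -sqrtr_sqr ler_wsqrtr.
have -> : s ^+ 9 = Num.sqrt s ^+ 3 * Num.sqrt s ^+ 3 * Num.sqrt s ^+ 3 * Num.sqrt s ^+ 3
    * Num.sqrt s ^+ 3 * Num.sqrt s ^+ 3.
  by rewrite -[in LHS](sqr_sqrtr s0); ring.
have p (x : R) : 0 <= `|x| ^+ 3 by rewrite exprn_ge0.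
have H (u v x : R) : 0 <= u -> u <= v -> x ^+ 2 <= s ->
    0 <= u * `|x| ^+ 3 /\ u * `|x| ^+ 3 <= v * Num.sqrt s ^+ 3.
  by move=> u0 uv xs; rewrite mulr_ge0 //; split=> //; apply: ler_pM => //; exact: B.
have q1 := sqr_ge0 x1; have q2 := sqr_ge0 x2; have q3 := sqr_ge0 x3.
have q4 := sqr_ge0 x4; have q5 := sqr_ge0 x5; have q6 := sqr_ge0 x6.
have h1 : `|x1| ^+ 3 <= Num.sqrt s ^+ 3 by apply: B; rewrite /s; lra.
have [p2 h2] := H _ _ x2 (p x1) h1 ltac:(rewrite /s; lra).
have [p3 h3] := H _ _ x3 p2 h2 ltac:(rewrite /s; lra).
have [p4 h4] := H _ _ x4 p3 h3 ltac:(rewrite /s; lra).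
have [p5 h5] := H _ _ x5 p4 h4 ltac:(rewrite /s; lra).
by have [_ h6] := H _ _ x6 p5 h5 ltac:(rewrite /s; lra).
Qed.

Lemma quad_lb r g : 0 < r < 1 -> beta r * (sq12 g + sq3 g) <= quad (alpha r) (beta r) g.
Proof.
move=> r01; have := beta_le_alpha r01; rewrite /quad mulrDr => H.
apply: lerD => //; apply: ler_wpM2r => //; by rewrite /sq12 !addr_ge0 // sqr_ge0.
Qed.

(** The common source of all majorants: P^9 is at least b^9 |z|^18, which
    cancels the b^9 of weight_beta and leaves the singularities of kappa6. *)
Lemma core_domination r g : 0 < r < 1 -> nonzero_coords g ->
  0 < quad (alpha r) (beta r) g /\
  weight r ^+ 4 <= (kappa2 r * kappa6 g) ^+ 4 * quad (alpha r) (beta r) g ^+ 9.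
Proof.
move=> r01 [[n1 n2 n3] [n4 n5 n6] _].
have [l0 a1 b0 w0 _] := weights_pos r01.
have s0 : 0 < sq12 g + sq3 g.
  rewrite /sq12 /sq3; do 4!(apply: ltr_wpDr; first by rewrite ?addr_ge0 ?sqr_ge0).
  by rewrite exprn_even_gt0.
have P0 : 0 < quad (alpha r) (beta r) g.
  by apply: lt_le_trans (quad_lb g r01); apply: mulr_gt0.
split=> //; apply: (le_trans (weight_beta r01)); rewrite [(kappa2 r * kappa6 g) ^+ 4]exprMn -[leRHS]mulrA; apply: ler_wpM2l.
  by rewrite exprn_ge0 // kappa2_ge0.
have -> : kappa6 g ^+ 4 = (`|g.1.1.1.1.1.1| ^+ 3 * `|g.1.1.1.1.1.2| ^+ 3 * `|g.1.1.1.1.2| ^+ 3 *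
   `|g.1.1.1.2| ^+ 3 * `|g.1.1.2| ^+ 3 * `|g.1.2| ^+ 3)^-1.
  by rewrite /kappa6 !exprMn !kappa4 // !invfM.
have p (x : R) : x != 0 -> 0 < `|x| ^+ 3 by move=> x0; rewrite exprn_gt0 // normr_gt0.
rewrite mulrC ler_pdivlMr; last exact: (mulr_gt0 (mulr_gt0 (mulr_gt0 (mulr_gt0 (mulr_gt0 (p _ n1) (p _ n2)) (p _ n3)) (p _ n4)) (p _ n5)) (p _ n6)).
apply: le_trans (_ : (beta r * (sq12 g + sq3 g)) ^+ 9 <= _).
  rewrite [leRHS]exprMn; apply: ler_wpM2l; first by rewrite exprn_ge0 // ltW.
  exact: prod6_le.
by apply: lerXn2r; rewrite ?nnegrE ?quad_lb // ltW // mulr_gt0.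
Qed.

Lemma root4 (x y : R) : 0 <= y -> x ^+ 4 <= y ^+ 4 -> x <= y.
Proof.
move=> y0 h; rewrite leNgt; apply/negP => yx.
by move: h; apply/negP; rewrite -ltNge ltrXn2r // ?nnegrE // (le_trans y0) ?ltW.
Qed.

Lemma le_pow4 (y : R) : 0 <= y -> y <= (1 + y) ^+ 4.
Proof.
move=> y0; apply: (@le_trans _ _ (1 + y)); first by rewrite lerDr.
by rewrite -{1}[1 + y]expr1 ler_weXn2l // lerDl.
Qed.

(** The factor e^(-4 tau P) absorbs the power P^9 of core_domination. *)
Lemma dom_exp tau : 0 < tau -> exists2 C, 0 <= C & forall r g, 0 < r < 1 -> nonzero_coords g ->
  weight r * expR (- (tau * quad (alpha r) (beta r) g)) <= C * (kappa2 r * kappa6 g).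
Proof.
(* the constant comes from exp_pow9 for y = tau P; 1 + c is at least its fourth root *)
move=> t0; set c := (9 / 4) ^+ 9 / tau ^+ 9.
have c0 : 0 <= c by rewrite /c divr_ge0 ?exprn_ge0 ?divr_ge0 // ltW.
exists (1 + c) => [|r g r01 nz]; first by rewrite addr_ge0.
have [P0 H] := core_domination r01 nz.
have D0 : 0 <= kappa2 r * kappa6 g by rewrite mulr_ge0 ?kappa2_ge0 ?kappa6_ge0.
apply: root4; first by rewrite mulr_ge0 ?addr_ge0.
move: (kappa2 r * kappa6 g) D0 H => D D0 H; rewrite !exprMn; move: P0 H.
move: (quad _ _ _) => P P0 H.
have tP : 0 <= tau * P by rewrite mulr_ge0 // ltW.
apply: (@le_trans _ _ (D ^+ 4 * c)); last first.
  by rewrite mulrC; apply: ler_wpM2r; [rewrite exprn_ge0|exact: le_pow4].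
apply: le_trans (ler_wpM2r _ H) _; first by rewrite exprn_ge0 // expR_ge0.
rewrite -mulrA; apply: ler_wpM2l; first by rewrite exprn_ge0.
rewrite /c ler_pdivlMr ?exprn_gt0 //.
by apply: le_trans (exp_pow9 tP); rewrite exprMn [tau ^+ 9 * _]mulrC mulrAC.
Qed.

(** Here P^9 is absorbed by (P + e)^9, a part of the denominator, and the rest
    (P + e)^3 is at least e^3. *)
Lemma dom_eps (e : R) : 0 < e -> exists2 C, 0 <= C & forall r g, 0 < r < 1 -> nonzero_coords g ->
  weight r / (quad (alpha r) (beta r) g + e) ^+ 3 <= C * (kappa2 r * kappa6 g).
Proof.
move=> e0; set c := (e ^+ 3)^-1.
have c0 : 0 <= c by rewrite /c invr_ge0 exprn_ge0 // ltW.
exists (1 + c) => [|r g r01 nz]; first by rewrite addr_ge0.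
have [P0 H] := core_domination r01 nz.
have D0 : 0 <= kappa2 r * kappa6 g by rewrite mulr_ge0 ?kappa2_ge0 ?kappa6_ge0.
apply: root4; first by rewrite mulr_ge0 ?addr_ge0.
move: (kappa2 r * kappa6 g) D0 H => D D0 H; rewrite !exprMn; move: P0 H.
move: (quad _ _ _) => P P0 H.
have Pe : 0 < P + e by rewrite addr_gt0.
apply: (@le_trans _ _ (D ^+ 4 * c)); last first.
  by rewrite mulrC; apply: ler_wpM2r; [rewrite exprn_ge0|exact: le_pow4].
apply: le_trans (ler_wpM2r _ H) _; first by rewrite exprn_ge0 // invr_ge0 exprn_ge0 // ltW.
rewrite -mulrA; apply: ler_wpM2l; first by rewrite exprn_ge0.
rewrite /c exprVn ler_pdivrMr ?exprn_gt0 // mulrC ler_pdivlMr ?exprn_gt0 //.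
have -> : ((P + e) ^+ 3) ^+ 4 = (P + e) ^+ 9 * (P + e) ^+ 3 by ring.
by apply: ler_pM; rewrite ?exprn_ge0 ?(ltW P0) ?(ltW e0) //; apply: lerXn2r; rewrite ?nnegrE ?(ltW P0) ?(ltW e0) ?(ltW Pe) ?lerDl ?lerDr ?(ltW P0) ?(ltW e0).
Qed.

(** The real part of (A + i t)^-3. *)
Definition re3 (A t : R) : R := (A ^+ 3 - 3 * A * t ^+ 2) / (A ^+ 2 + t ^+ 2) ^+ 3.

(** The numerator is at most |A + i t|^3, hence |re3 A t| <= |A + i t|^-3;
    split its fourth power |A + i t|^-12 as 9 + 3 between A and t. *)
Lemma re3_le (A B t : R) : 0 < B -> B <= A -> t != 0 ->
  re3 A t ^+ 4 <= (B ^+ 9 * `|t| ^+ 3)^-1.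
Proof.
move=> B0 BA tn; have A0 := lt_le_trans B0 BA.
set S := A ^+ 2 + t ^+ 2.
have S0 : 0 < S by rewrite /S ltr_wpDr ?sqr_ge0 // exprn_gt0.
have n1 : (A ^+ 3 - 3 * A * t ^+ 2) ^+ 2 <= S ^+ 3.
  have -> : S ^+ 3 = (A ^+ 3 - 3 * A * t ^+ 2) ^+ 2 + (3 * A ^+ 2 * t - t ^+ 3) ^+ 2 by rewrite /S; ring.
  by rewrite lerDl sqr_ge0.
have n2 : (A ^+ 3 - 3 * A * t ^+ 2) ^+ 4 <= S ^+ 6.
  have -> : S ^+ 6 = (S ^+ 3) ^+ 2 by ring.
  have -> : (A ^+ 3 - 3 * A * t ^+ 2) ^+ 4 = ((A ^+ 3 - 3 * A * t ^+ 2) ^+ 2) ^+ 2 by ring.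
  by apply: lerXn2r => //; rewrite nnegrE ?sqr_ge0 // exprn_ge0 // ltW.
have t3 : 0 < `|t| ^+ 3 by rewrite exprn_gt0 // normr_gt0.
have n3 : B ^+ 9 * `|t| ^+ 3 <= S ^+ 6.
  set s := Num.sqrt S.
  have -> : S ^+ 6 = s ^+ 9 * s ^+ 3 by rewrite -(sqr_sqrtr (ltW S0)) -/s; ring.
  have As : B <= s.
    apply: (le_trans BA); rewrite -[A]ger0_norm ?(ltW A0) // -sqrtr_sqr ler_wsqrtr // /S lerDl sqr_ge0 //.
  have ts : `|t| <= s by rewrite -sqrtr_sqr ler_wsqrtr // /S lerDr sqr_ge0.
  have s0 : 0 <= s by exact: sqrtr_ge0.
  by apply: ler_pM; rewrite ?exprn_ge0 ?(ltW B0) //; apply: lerXn2r; rewrite ?nnegrE ?(ltW B0).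
rewrite /re3 -/S expr_div_n ler_pdivrMr ?exprn_gt0 // ?exprn_gt0 //.
apply: (le_trans n2); rewrite mulrC ler_pdivlMr ?mulr_gt0 ?exprn_gt0 ?normr_gt0 //.
have -> : (S ^+ 3) ^+ 4 = S ^+ 6 * S ^+ 6 by ring.
by apply: ler_wpM2l => //; rewrite exprn_ge0 // ltW.
Qed.

(** Uniform in e: the passage e -> 0 needs one majorant for all e. *)
Lemma dom_re3 r g (e : R) : 0 <= e -> 0 < r < 1 -> nonzero_coords g ->
  `|weight r * re3 (quad (alpha r) (beta r) g + e) g.2| <= kappa2 r * (kappa6 g * kappa g.2).
Proof.
move=> e0 r01 nz; have [P0 H] := core_domination r01 nz.
have t0 : g.2 != 0 by case: nz.
apply: root4; first by rewrite !mulr_ge0 ?kappa2_ge0 ?kappa6_ge0 ?kappa_ge0.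
rewrite -normrX ger0_norm; last by rewrite (exprM _ 2 2) sqr_ge0.
rewrite mulrA [leRHS]exprMn kappa4 // exprMn.
have H2 := @re3_le (quad (alpha r) (beta r) g + e) (quad (alpha r) (beta r) g) g.2 P0 ltac:(by rewrite lerDl) t0.
apply: (le_trans (ler_wpM2l _ H2)); first by rewrite (exprM _ 2 2) sqr_ge0.
rewrite invfM mulrA; apply: ler_wpM2r; first by rewrite invr_ge0 exprn_ge0.
by rewrite ler_pdivrMr ?exprn_gt0.
Qed.

End domination.

(** * Integration over a slab *)

Section dominators.
Context (R : realType).
Implicit Types (g : G R) (M : R).
Notation L1 f := ((@hm R).-integrable setT (EFin \o f)).

(** Haar measure in g times Lebesgue measure in r. *)
Definition hm1 := [the {sigma_finite_measure set _ -> \bar R} of prodm (@hm R) (m1 R)].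
Notation LX f := (hm1.-integrable setT (EFin \o f)).

Definition kappa_ind M x : R := kappa x * ind M x.
Definition dom6 M := tens7 (kappa_ind M) (kappa_ind M) (kappa_ind M) (kappa_ind M) (kappa_ind M) (kappa_ind M) (ind M).
Definition dom7 M := tens7 (kappa_ind M) (kappa_ind M) (kappa_ind M) (kappa_ind M) (kappa_ind M) (kappa_ind M) (kappa_ind M).

Lemma dom6E M g : dom6 M g = kappa6 g * cube_ind M g.
Proof. by rewrite /dom6 /kappa6 /cube_ind /tens7 /kappa_ind; ring. Qed.

Lemma dom7E M g : dom7 M g = kappa6 g * kappa g.2 * cube_ind M g.
Proof. by rewrite /dom7 /kappa6 /cube_ind /tens7 /kappa_ind; ring. Qed.

Lemma integrable_dom6 M : 0 < M -> L1 (dom6 M).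
Proof.
by move=> M0; apply: integrable_tens7; first [exact: integrable_ind|exact: integrable_kappa].
Qed.

Lemma integrable_dom7 M : 0 < M -> L1 (dom7 M).
Proof. by move=> M0; apply: integrable_tens7; exact: integrable_kappa. Qed.

Lemma integrable_dom_kappa2 (C : R) (d : G R -> R) : L1 d -> LX (fun x => C * (d x.1 * kappa2 x.2)).
Proof.
move=> id; apply: integrable_scale.
exact: (@integrable_prod _ _ _ _ R (@hm R) (m1 R) _ _ id (integrable_kappa2 R)).
Qed.

Lemma measX1 (f : G R -> R) : measurable_fun setT f -> measurable_fun setT (fun x : G R * R => f x.1).
Proof. by move=> mf; apply: measurableT_comp. Qed.

Lemma measX2 (f : R -> R) : measurable_fun setT f -> measurable_fun setT (fun x : G R * R => f x.2).
Proof. by move=> mf; apply: measurableT_comp. Qed.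

Lemma measurable_sq : measurable_fun setT (@sq12 R) /\ measurable_fun setT (@sq3 R).
Proof.
have [[k1 k2 k3] [k4 k5 k6] k7] := Coo_coords R.
have X2 (f : G R -> R) : Coo f -> Coo (fun g => f g ^+ 2) by move=> cf; exact: (CooM cf cf).
split; apply: measurable_continuous; apply: Coo_cont; rewrite /sq12 /sq3.
  by do 3!(apply: CooD; last exact/X2); exact/X2.
by apply: CooD; exact/X2.
Qed.

Lemma measurable_weights : [/\ measurable_fun setT (@alpha R), measurable_fun setT (@beta R),
  measurable_fun setT (@weight R) & measurable_fun setT (@mln R)].
Proof.
have mi : measurable_fun setT (fun r : R => r) by exact: measurable_id.
have mN : measurable_fun setT (fun r : R => - r) by exact: measN.
have ml : measurable_fun setT (@mln R) by apply: measN; exact: measurable_ln.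
split=> //; rewrite /alpha /beta /weight; repeat first [exact: mi|exact: mN|exact: ml|exact: meas_cst
  |apply: measM|apply: measV|apply: measX|apply: measD].
Qed.

Lemma measurable_tc : measurable_fun setT (fun g : G R => g.2).
Proof. by have [_ _ k7] := continuous_coords R; exact: measurable_continuous. Qed.

Lemma measurable_quad_hm1 : measurable_fun setT (fun x : G R * R => quad (alpha x.2) (beta x.2) x.1).
Proof.
have [z1 z3] := measurable_sq; have [a b w l] := measurable_weights.
rewrite /quad; apply: measD; apply: measM; first [exact: measX1|exact: measX2].
Qed.

Lemma measurable_weight_hm1 : measurable_fun setT (fun x : G R * R => weight x.2).
Proof. by have [a b w l] := measurable_weights; exact: measX2. Qed.

Lemma measurable_Ecos_hm1 tau : measurable_fun setT (fun x : G R * R => Ecos (alpha x.2) (beta x.2) tau x.1).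
Proof.
rewrite /Ecos; meas; first exact: measurable_quad_hm1.
by apply: measX1; exact: measurable_tc.
Qed.

Lemma ae_hm1 : {ae hm1, forall x : G R * R, nonzero_coords x.1}.
Proof. exact: (@ae_prod1 _ _ _ _ R (@hm R) (m1 R) _ (ae_nonzero_coords R)). Qed.

Definition cut (p q r : R) : R := \1_(`]p, q[%classic) r.

Lemma cutE p q r : cut p q r = if p < r < q then 1 else 0.
Proof. by rewrite /cut indicE mem_setE in_itv; case: ifP. Qed.

Lemma measurable_cut p q : measurable_fun setT (cut p q).
Proof. exact: measurable_indic. Qed.

(** The support of f cuts the majorant off to a cube, where kappa6 is
    integrable. *)
Lemma dominated_by_kappa6 (F : G R * R -> R) (f : G R -> R) (C : R) : measurable_fun setT F ->
  continuous f -> bsupp f -> 0 <= C ->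
  (forall g r, 0 < r < 1 -> nonzero_coords g -> `|F (g, r)| <= C * (kappa2 r * kappa6 g) * `|f g|) ->
  (forall g r, ~~ (0 < r < 1) -> F (g, r) = 0) ->
  exists2 h, LX h & {ae hm1, forall x, `|F x| <= h x}.
Proof.
move=> mF cf bf C0 HF F0; have [C' [M [C'0 M0 HM]]] := bsupp_dominated cf bf.
exists (fun x => (C * C') * (dom6 M x.1 * kappa2 x.2)).
  by apply: integrable_dom_kappa2; exact: integrable_dom6.
apply: ae_mono ae_hm1 => -[g r] nz /=.
have [r01|r01] := boolP (0 < r < 1); last first.
  rewrite F0 // normr0; apply: mulr_ge0; first exact: mulr_ge0.
  by rewrite dom6E; apply: mulr_ge0; [apply: mulr_ge0; [exact: kappa6_ge0|exact: cube_ind_ge0]|exact: kappa2_ge0].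
apply: (le_trans (HF g r r01 nz)).
have D0 : 0 <= C * (kappa2 r * kappa6 g) by exact: (mulr_ge0 C0 (mulr_ge0 (kappa2_ge0 r) (kappa6_ge0 g))).
apply: (le_trans (ler_wpM2l D0 (HM g))).
by rewrite dom6E le_eqVlt; apply/orP; left; apply/eqP; move: (kappa2 r) (kappa6 g) (cube_ind M g) => *; ring.
Qed.

(** The wave times a test function on the slab p < r < q. Both ends are free,
    to let them tend to 0 and 1. *)
Definition heat_slab tau (f : G R -> R) p q (x : G R * R) : R :=
  cut p q x.2 * (weight x.2 * Ecos (alpha x.2) (beta x.2) tau x.1 * f x.1).

Lemma measurable_heat_slab tau f p q : continuous f -> measurable_fun setT (heat_slab tau f p q).
Proof.
move=> cf; rewrite /heat_slab; apply: measM; first by apply: measX2; exact: measurable_cut.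
apply: measM; last by apply: measX1; exact: measurable_continuous.
by apply: measM; [exact: measurable_weight_hm1|exact: measurable_Ecos_hm1].
Qed.

Lemma dom_heat_slab tau f : 0 < tau -> continuous f -> bsupp f ->
  exists2 h, LX h & forall p q, 0 <= p -> q <= 1 -> {ae hm1, forall x, `|heat_slab tau f p q x| <= h x}.
Proof.
move=> t0 cf bf; have [C C0 HC] := dom_exp t0.
have [h ih Hh] := @dominated_by_kappa6 (fun x => cut 0 1 x.2 * (weight x.2 * expR (- (tau * quad (alpha x.2) (beta x.2) x.1)) * f x.1)) f C ltac:(
   by apply: measM; [apply: measX2; exact: measurable_cut|apply: measM; [apply: measM; [exact: measurable_weight_hm1|meas; exact: measurable_quad_hm1]|apply: measX1; exact: measurable_continuous]]) cf bf C0
  ltac:(by move=> g r r01 nz /=; rewrite cutE r01 mul1r normrM; apply: ler_wpM2r => //; have [_ _ _ w0 _] := weights_pos r01; rewrite ger0_norm ?HC // mulr_ge0 ?expR_ge0 // ltW)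
  ltac:(by move=> g r r01 /=; rewrite cutE (negbTE r01) mul0r).
exists h => // p q p0 q1; apply: ae_mono Hh => -[g r] /= ; apply: le_trans.
rewrite /heat_slab /= !cutE; case: ifP => [/andP[pr rq]|_]; last by rewrite mul0r normr0.
rewrite (le_lt_trans p0 pr) (lt_le_trans rq q1) !mul1r !normrM; apply: ler_wpM2r => //.
rewrite mulrA ler_piMr ?mulr_ge0 //.
exact: cos_max.
Qed.

Lemma integrable_heat_slab tau f p q : 0 < tau -> continuous f -> bsupp f -> 0 <= p -> q <= 1 ->
  LX (heat_slab tau f p q).
Proof.
move=> t0 cf bf p0 q1; have [h ih H] := dom_heat_slab t0 cf bf.
exact: (@ae_integrable_dom _ _ R hm1 _ _ (measurable_heat_slab tau p q cf) (H p q p0 q1) ih).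
Qed.

End dominators.

Section segment_identity.
Context (R : realType).
Implicit Types (g : G R) (M : R).
Notation L1 f := ((@hm R).-integrable setT (EFin \o f)).
Notation I7 f := (Rintegral (@hm R) setT f).
Notation LX f := ((@hm1 R).-integrable setT (EFin \o f)).

Lemma cut_FTC (p q : R) (f F : R -> R) : p < q ->
  (forall x, p <= x <= q -> is_derive x (1 : R) F (f x)) ->
  (forall x, p <= x <= q -> {for x, continuous f}) ->
  Rintegral (m1 R) setT (fun r => cut p q r * f r) = F q - F p.
Proof.
move=> pq dF cf; have [i1 <-] := FTC_segment pq dF cf.
rewrite /cut -(Rintegral_ind (m1 R)) /= Rintegral_itv_obnd_cbnd; last first.
  by apply: integrableS i1 => // x /=; rewrite !in_itv /= => /andP[? ?]; rewrite !ltW.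
rewrite Rintegral_itv_bndo_bndc //.
by apply: integrableS i1 => // x /=; rewrite !in_itv /= => /andP[-> ?]; rewrite ltW.
Qed.

(** The boundary term at height r. *)
Definition heat_slice tau (f : G R -> R) r : R :=
  I7 (fun g => bweight r * (Ecos (alpha r) (beta r) tau g * f g)).

(** The r-derivative of tau times the integrand of [heat_slice]. *)
Definition dheat_slab tau (f : G R -> R) p q (x : G R * R) : R :=
  cut p q x.2 * (tau * (dQ tau x.1 x.2 * cos (tau * x.1.2)) * f x.1).

Lemma measurable_dheat_slab tau f p q : continuous f -> measurable_fun setT (dheat_slab tau f p q).
Proof.
move=> cf; have [z1 z3] := measurable_sq R; have [a b w l] := measurable_weights R.
rewrite /dheat_slab /dQ; apply: measM; first by apply: measX2; exact: measurable_cut.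
apply: measM; last by apply: measX1; exact: measurable_continuous.
apply: measM; first exact: meas_cst; apply: measM; last first.
  by apply: measC; apply: measM; [exact: meas_cst|apply: measX1; exact: measurable_tc].
apply: measM; last first.
  by apply: measE; apply: measN; apply: measM; [exact: meas_cst|exact: measurable_quad_hm1].
apply: measM; first exact: measX2.
apply: measD.
  apply: (measX2 (f := fun r => 2 * alpha r + beta r)); apply: measD => //.
  by apply: measM => //; exact: meas_cst.
apply: measN; apply: measM; first exact: meas_cst.
apply: measD; apply: measM; first [exact: measX1|idtac].
  apply: (measX2 (f := fun r => alpha r ^+ 2 - 1)); apply: measD; last exact: meas_cst.
  exact: measX.
by apply: (measX2 (f := fun r => beta r ^+ 2)); exact: measX.
Qed.

Lemma sq_cube M g : cube M g -> [/\ 0 <= sq12 g, 0 <= sq3 g, sq12 g <= 4 * M ^+ 2 & sq3 g <= 2 * M ^+ 2].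
Proof.
rewrite /cube /= !in_itv /= => -[[[[[[h1 h2] h3] h4] h5] h6] h7].
have B (x : R) : - M <= x <= M -> 0 <= x ^+ 2 <= M ^+ 2.
  move=> xM; rewrite sqr_ge0 -[x ^+ 2]real_normK ?num_real //=.
  have H : `|x| <= M by rewrite ler_norml.
  by apply: lerXn2r => //; rewrite nnegrE ?normr_ge0 // (le_trans _ H).
rewrite /sq12 /sq3; move: (B _ h1) (B _ h2) (B _ h3) (B _ h4) (B _ h5) (B _ h6).
move: (_ ^+ 2) (_ ^+ 2) (_ ^+ 2) (_ ^+ 2) (_ ^+ 2) (_ ^+ 2) (_ ^+ 2) => m x1 x2 x3 x4 x5 x6.
clear.
by move=> /andP[? ?] /andP[? ?] /andP[? ?] /andP[? ?] /andP[? ?] /andP[? ?]; split; lra.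
Qed.

Lemma weights_ub (p q r : R) : 0 < p -> q < 1 -> p < r < q ->
  [/\ alpha r <= 2 / (1 - q), beta r <= 2 / mln q & weight r <= (mln q * (1 - q) ^+ 2)^-1].
Proof.
move=> p0 q1 /andP[pr rq]; have r0 := lt_trans p0 pr; have q0 := lt_trans r0 rq.
have r1 := lt_trans rq q1.
have lq : 0 < mln q by apply: mln_gt0; rewrite q0.
have lr : mln q <= mln r by rewrite /mln lerN2 ler_ln // ltW.
have lr0 := lt_le_trans lq lr.
have sq : 0 < 1 - q by rewrite subr_gt0.
have sr : 1 - q <= 1 - r by lra.
have sr0 := lt_le_trans sq sr.
split; rewrite /alpha /beta /weight.
- by apply: ler_pM; [lra|rewrite invr_ge0 ltW|lra|rewrite lef_pV2 ?posrE].
- by rewrite ler_pM2l // lef_pV2.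
- rewrite lef_pV2 ?posrE ?mulr_gt0 ?exprn_gt0 //; apply: ler_pM => //; rewrite ?exprn_ge0 ?(ltW lq) ?(ltW sq) //.
  by apply: lerXn2r => //; rewrite nnegrE ltW.
Qed.

(** Away from r = 0 and r = 1 everything is bounded; the majorant is only
    used for Fubini. *)
Lemma dheat_slab_bound tau f p q : 0 < tau -> continuous f -> bsupp f -> 0 < p -> q < 1 ->
  exists K M, forall x : G R * R, `|dheat_slab tau f p q x| <= K * (cube_ind M x.1 * cut p q x.2).
Proof.
move=> t0 cf bf p0 q1; have [C [M [C0 M0 HM]]] := bsupp_dominated cf bf.
set a := 2 / (1 - q); set b := 2 / mln q; set w := (mln q * (1 - q) ^+ 2)^-1.
exists (tau * (w * (2 * a + b + tau * (a ^+ 2 * (4 * M ^+ 2) + b ^+ 2 * (2 * M ^+ 2)))) * C), M.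
move=> [g r]; rewrite /dheat_slab /= cutE; case: ifP => [prq|_]; last by rewrite !(mul0r, mulr0) normr0.
rewrite mul1r mulr1 normrM; have := weights_ub p0 q1 prq; rewrite -/a -/b -/w => -[a1 b1 w1].
have r01 : 0 < r < 1 by move: prq => /andP[pr rq]; rewrite (lt_trans p0 pr) (lt_trans rq q1).
have [l0 a0 b0 w0 _] := weights_pos r01.
have [gM|gM] := pselect (cube M g); last first.
  suff -> : f g = 0.
    rewrite normr0 mulr0 mulr_ge0 ?cube_ind_ge0 //.
    have A0 : 0 <= a by apply: le_trans a1; apply: le_trans a0.
    have B0 : 0 <= b by apply: le_trans b1; apply: ltW.
    have W0 : 0 <= w by apply: le_trans w1; apply: ltW.
    have M2 : 0 <= M ^+ 2 by exact: sqr_ge0.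
    have t0' := ltW t0.
    have h1 := mulr_ge0 (sqr_ge0 a) M2; have h2 := mulr_ge0 (sqr_ge0 b) M2.
    have h3 : 0 <= a ^+ 2 * (4 * M ^+ 2) + b ^+ 2 * (2 * M ^+ 2).
      by apply: addr_ge0; apply: mulr_ge0; rewrite ?sqr_ge0 // mulr_ge0.
    have h4 : 0 <= 2 * a + b + tau * (a ^+ 2 * (4 * M ^+ 2) + b ^+ 2 * (2 * M ^+ 2)).
      by rewrite addr_ge0 ?(mulr_ge0 t0' h3) // addr_ge0 // mulr_ge0.
    exact: (mulr_ge0 (mulr_ge0 t0' (mulr_ge0 W0 h4)) C0).
  have : cube_ind M g = 0.
    rewrite /cube_ind /tens7 /ind !indicE; apply/eqP; apply: contra_notT gM.
    rewrite !mulf_eq0 !pnatr_eq0 !eqb0 !negb_or !negbK => /andP[/andP[/andP[/andP[/andP[/andP[]]]]]].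
    by rewrite !in_setE /cube /=.
  by move=> H; have := HM g; rewrite H mulr0 normr_le0 => /eqP.
have [z0 y0 z1 y1] := sq_cube gM.
have := HM g; rewrite (cube_indE gM) !mulr1 => HC.
apply: ler_pM => //; rewrite normrM gtr0_norm // ler_pM2l //.
rewrite normrM; apply: (@le_trans _ _ (`|dQ tau g r| * 1)).
  by apply: ler_wpM2l => //; exact: cos_max.
rewrite mulr1 /dQ normrM [`|expR _|]ger0_norm ?expR_ge0 //.
apply: (@le_trans _ _ (`|weight r * (2 * alpha r + beta r - tau * ((alpha r ^+ 2 - 1) * sq12 g + beta r ^+ 2 * sq3 g))| * 1)).
  apply: ler_wpM2l => //; rewrite -expR0 ler_expR oppr_le0 mulr_ge0 ?(ltW t0) //.
  by rewrite /quad addr_ge0 // mulr_ge0 // ?(ltW b0) // (le_trans _ a0).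
rewrite mulr1 normrM (gtr0_norm w0); apply: ler_pM => //; first exact: ltW.
apply: le_trans (ler_normB _ _) _; apply: lerD.
  by rewrite ger0_norm; lra.
rewrite normrM gtr0_norm // ler_pM2l // ger0_norm; last first.
  rewrite addr_ge0 // mulr_ge0 // ?sqr_ge0 //.
  by rewrite subr_ge0 exprn_ege1.
have a2 : alpha r ^+ 2 <= a ^+ 2 by apply: lerXn2r => //; rewrite nnegrE ?(le_trans _ a0) // (le_trans _ a1) // (le_trans _ a0).
have b2 : beta r ^+ 2 <= b ^+ 2 by apply: lerXn2r => //; rewrite nnegrE ltW // (lt_le_trans b0).
apply: lerD; apply: ler_pM => //; rewrite ?sqr_ge0 // ?subr_ge0 ?exprn_ege1 //.
by apply: le_trans a2; rewrite gerBl.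
Qed.

Lemma integrable_cut p q : (m1 R).-integrable setT (EFin \o (cut p q : R -> R)).
Proof.
apply: (@integrable_dom R _ _ (m1 R) _ _ (measurable_cut p q) _ (integrable_ind (`|p| + `|q|))) => r.
rewrite cutE; case: ifP => [/andP[pr rq]|_]; last by rewrite normr0 ind_ge0.
rewrite normr1 /ind indicE mem_set //= in_itv /=.
have := ler_norm q; have := ler_norm (- p); have := normr_ge0 p; have := normr_ge0 q.
rewrite normrN; move: `|p| `|q| => u v *; apply/andP; split; lra.
Qed.

Lemma integrable_dheat_slab tau f p q : 0 < tau -> continuous f -> bsupp f -> 0 < p -> q < 1 ->
  LX (dheat_slab tau f p q).
Proof.
move=> t0 cf bf p0 q1; have [K [M H]] := dheat_slab_bound t0 cf bf p0 q1.
apply: (@integrable_dom R _ _ (@hm1 R) _ _ (measurable_dheat_slab tau p q cf) H).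
apply: integrable_scale.
exact: (@integrable_prod _ _ _ _ R (@hm R) (m1 R) _ _ (integrable_cube_ind M) (integrable_cut p q)).
Qed.

(** Fubini in both orders: integrating in g first, L moves onto the wave and
    becomes an r-derivative; integrating in r first, the fundamental theorem of
    calculus leaves the two ends. *)
Lemma segment_identity tau f p q : 0 < tau -> Coo f -> bsupp f -> 0 < p -> p < q -> q < 1 ->
  Rintegral (@hm1 R) setT (heat_slab tau (L f) p q) = tau * (heat_slice tau f q - heat_slice tau f p).
Proof.
move=> t0 cf bf p0 pq q1.
have cLf := Coo_cont (Coo_L cf); have bLf := bsupp_L bf; have cf0 := Coo_cont cf.
rewrite (@Rintegral_prod21 _ _ _ _ R (@hm R) (m1 R)); last first.
  by apply: integrable_heat_slab => //; exact: ltW.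
transitivity (Rintegral (m1 R) setT (fun r => I7 (fun g => dheat_slab tau f p q (g, r)))).
  congr (Rintegral _ _ _); apply/funext => r; rewrite /heat_slab /dheat_slab /= cutE.
  case: ifP => _; last by congr (Rintegral _ _ _); apply/funext => g; rewrite !mul0r.
  transitivity (weight r * I7 (fun g => Ecos (alpha r) (beta r) tau g * L f g)).
    rewrite -RintegralZ_; last first.
      apply: integrable_bsupp; last exact: bsuppMr.
      by apply: Coo_cont; apply: CooM; [exact: Coo_Ecos|exact: Coo_L].
    by congr (Rintegral _ _ _); apply/funext => g; rewrite mul1r mulrA.
  rewrite L_ibp //; last exact: Coo_Ecos.
  rewrite -RintegralZ_; last first.
    apply: integrable_bsupp; last exact: bsuppMr.
    by apply: Coo_cont; apply: CooM => //; apply: Coo_L; exact: Coo_Ecos.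
  congr (Rintegral _ _ _); apply/funext => g; rewrite L_Ecos /dQ /Ecos.
  by move: (weight r) (alpha r) (beta r) (sq12 g) (sq3 g) (expR _) (cos _) (f g) => *; ring.
rewrite -(@Rintegral_prod21 _ _ _ _ R (@hm R) (m1 R)); last exact: integrable_dheat_slab.
rewrite (@Rintegral_prod12 _ _ _ _ R (@hm R) (m1 R)); last exact: integrable_dheat_slab.
have iI r : L1 (fun g => bweight r * (Ecos (alpha r) (beta r) tau g * f g)).
  apply: integrable_bsupp; last by apply: bsuppMr; apply: bsuppMr.
  by apply: Coo_cont; apply: CooM; [exact: Coo_cst|apply: CooM => //; exact: Coo_Ecos].
transitivity (I7 (fun g => tau * (bweight q * (Ecos (alpha q) (beta q) tau g * f g)) +
    (- tau) * (bweight p * (Ecos (alpha p) (beta p) tau g * f g)))); last first.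
  rewrite (RintegralD_ (integrable_scale tau (iI q)) (integrable_scale (- tau) (iI p))).
  by rewrite (RintegralZ_ tau (iI q)) (RintegralZ_ (- tau) (iI p)) /heat_slice mulNr mulrBr.
congr (Rintegral _ _ _); apply/funext => g.
(* for fixed g only the exponential and the weight depend on r *)
pose k := tau * cos (tau * g.2) * f g.
have r01 r : p <= r <= q -> 0 < r < 1 by move=> /andP[pr rq]; rewrite (lt_le_trans p0 pr) (le_lt_trans rq q1).
transitivity (Rintegral (m1 R) setT (fun r => cut p q r * (k * dQ tau g r))).
  congr (Rintegral _ _ _); apply/funext => r; rewrite /dheat_slab /= /k.
  by move: (cut p q r) (dQ tau g r) (cos _) (f g) => *; ring.
transitivity (k * (bweight q * expR (- (tau * quad (alpha q) (beta q) g))) -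
    k * (bweight p * expR (- (tau * quad (alpha p) (beta p) g)))); last first.
  by rewrite /k /Ecos; move: (bweight _) (bweight _) (expR _) (expR _) (cos _) (f g) => *; ring.
have D1 r : p <= r <= q -> is_derive r (1 : R)
    (fun r => k * (bweight r * expR (- (tau * quad (alpha r) (beta r) g)))) (k * dQ tau g r).
  move=> /r01 hr; apply: (is_derive_conv (dM (dcst k r 1) (is_derive_Q tau g hr))).
  by rewrite mulr0 addr0.
have D2 r : p <= r <= q -> {for r, continuous (fun r => k * dQ tau g r)}.
  move=> /r01 hr; have l0 := mln_gt0 hr; have /andP[r0 r1] := hr.
  have sn : 1 - r != 0 by rewrite gt_eqF // subr_gt0.
  have ln0 : - ln r != 0 by rewrite gt_eqF.
  rewrite /dQ /quad /weight /beta /alpha /mln; clear D1; move: k => k; apply: derive_cont; der => //.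
  by rewrite mulf_neq0 // expf_neq0.
exact (cut_FTC pq D1 D2).
Qed.

End segment_identity.

(** * Gaussian concentration at the ends of the slab *)

Section gauss7.
Context (R : realType).
Implicit Types (g : G R) (M : R).
Notation L1 f := ((@hm R).-integrable setT (EFin \o f)).
Notation I7 f := (Rintegral (@hm R) setT f).

(** The Gaussian in z factors, and what is left is the integral over t. *)
Lemma gauss7 (a b tau : R) (f : R -> R) : 0 < a -> 0 < b -> 0 < tau ->
  (m1 R).-integrable setT (EFin \o f) ->
  L1 (fun g => expR (- (tau * quad a b g)) * f g.2) /\
  I7 (fun g => expR (- (tau * quad a b g)) * f g.2) =
    (pi / (tau * a)) ^+ 2 * (pi / (tau * b)) * Rintegral (m1 R) setT f.
Proof.
move=> a0 b0 t0 if_.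
have ta : 0 < tau * a by exact: mulr_gt0.
have tb : 0 < tau * b by exact: mulr_gt0.
have [ia ea] := gauss_scaled ta; have [ib eb] := gauss_scaled tb.
pose ga (x : R) := expR (- (tau * a * x ^+ 2)).
pose gb (x : R) := expR (- (tau * b * x ^+ 2)).
rewrite (_ : (fun g => expR (- (tau * quad a b g)) * f g.2) = tens7 ga ga ga ga gb gb f).
  split; first exact: (@integrable_tens7 R ga ga ga ga gb gb f).
  rewrite (@Rintegral_tens7 R ga ga ga ga gb gb f) // /ga /gb.
  have pa : 0 <= pi / (tau * a) by rewrite divr_ge0 ?pi_ge0 // ltW.
  have pb : 0 <= pi / (tau * b) by rewrite divr_ge0 ?pi_ge0 // ltW.
  have -> : Rintegral (m1 R) setT (fun x : R => expR (- (tau * a * x ^+ 2))) = Num.sqrt (pi / (tau * a)) by exact: ea.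
  have -> : Rintegral (m1 R) setT (fun x : R => expR (- (tau * b * x ^+ 2))) = Num.sqrt (pi / (tau * b)) by exact: eb.
  rewrite -[in RHS](sqr_sqrtr pa) -[in RHS](sqr_sqrtr pb).
  by move: (Num.sqrt _) (Num.sqrt _) (Rintegral _ _ _) => u v w; ring.
apply/funext => g; rewrite /tens7 /ga /gb -!expRD; congr (expR _ * _).
rewrite /quad /sq12 /sq3; move: (g.1.1.1.1.1.1) (g.1.1.1.1.1.2) (g.1.1.1.1.2) (g.1.1.1.2) (g.1.1.2) (g.1.2) => *.
by ring.
Qed.

Lemma normG_coords g : [/\ `|g.1.1.1.1.1.1| <= `|g|, `|g.1.1.1.1.1.2| <= `|g|, `|g.1.1.1.1.2| <= `|g| & 
  [/\ `|g.1.1.1.2| <= `|g|, `|g.1.1.2| <= `|g|, `|g.1.2| <= `|g| & `|g.2| <= `|g|]].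
Proof.
have /(normG_le g `|g|) : `|g| <= `|g| by [].
by rewrite /cube /= !in_itv /= -!ler_norml => -[[[[[[? ?] ?] ?] ?] ?] ?].
Qed.

Lemma vec_basis (v : G R) : v = v.1.1.1.1.1.1 *: e1 R + v.1.1.1.1.1.2 *: e2 R + v.1.1.1.1.2 *: e3 R
  + v.1.1.1.2 *: e4 R + v.1.1.2 *: e5 R + v.1.2 *: e6 R + v.2 *: et R.
Proof.
move: v => [[[[[[x1 x2] x3] x4] x5] x6] x7].
rewrite /e1 /e2 /e3 /e4 /e5 /e6 /et.
do 6!(congr (_, _); [|by rewrite /= /GRing.scale /=; ring]); by rewrite /= /GRing.scale /=; ring.
Qed.

(** Expand v in the basis; the seven basic derivatives are bounded. *)
Lemma derive_bounded (f : G R -> R) : Coo f -> bsupp f ->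
  exists2 K, 0 <= K & forall v g, `|'D_v f g| <= K * `|v|.
Proof.
move=> cf bf; have c1f := Coo_C1 cf.
have B v : exists2 C, 0 <= C & forall g, `|'D_v f g| <= C.
  by apply: bsupp_bounded; [apply/Coo_cont/Coo_D|apply: bsupp_derive].
have [C1 p1 H1] := B (e1 R); have [C2 p2 H2] := B (e2 R); have [C3 p3 H3] := B (e3 R).
have [C4 p4 H4] := B (e4 R); have [C5 p5 H5] := B (e5 R); have [C6 p6 H6] := B (e6 R).
have [C7 p7 H7] := B (et R).
exists (C1 + C2 + C3 + C4 + C5 + C6 + C7) => [|v g]; first by rewrite !addr_ge0.
have [n1 n2 n3 [n4 n5 n6 n7]] := normG_coords v.
have E := congr1 (fun w => 'D_w f g) (vec_basis v); rewrite /= in E.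
rewrite E !derive_add // !derive_scale // {E}.
have T (x d n C : R) : `|x| <= n -> `|d| <= C -> `|x * d| <= C * n.
  by move=> xn dC; rewrite normrM mulrC; apply: ler_pM.
have A (x y s t : R) : `|x| <= s -> `|y| <= t -> `|x + y| <= s + t.
  by move=> h1 h2; apply: le_trans (ler_normD _ _) _; apply: lerD.
have S (n : R) : (C1 + C2 + C3 + C4 + C5 + C6 + C7) * n =
  C1 * n + C2 * n + C3 * n + C4 * n + C5 * n + C6 * n + C7 * n by rewrite !mulrDl.
rewrite S.
exact: (A _ _ _ _ (A _ _ _ _ (A _ _ _ _ (A _ _ _ _ (A _ _ _ _ (A _ _ _ _ (T _ _ _ _ n1 (H1 g)) (T _ _ _ _ n2 (H2 g)))
  (T _ _ _ _ n3 (H3 g))) (T _ _ _ _ n4 (H4 g))) (T _ _ _ _ n5 (H5 g))) (T _ _ _ _ n6 (H6 g))) (T _ _ _ _ n7 (H7 g))).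
Qed.

Lemma lipschitz (f : G R -> R) : Coo f -> bsupp f ->
  exists2 K, 0 <= K & forall g h, `|f g - f h| <= K * `|g - h|.
Proof.
move=> cf bf; have [K K0 HK] := derive_bounded cf bf.
exists K => // g h; have [c _] := @mvt_line R _ f h (g - h) 1 (fun y => Coo_derivable cf).
by rewrite scale1r [h + _]addrC subrK mul1r => ->.
Qed.
End gauss7.

Section endpoint_limits.
Context (R : realType).
Implicit Types (g : G R) (M : R).

(** From e^u >= 1 + u and y <= (1 + y^2) / 2. *)
Lemma sq_expR (y u : R) : y ^+ 2 <= 2 * u -> y <= expR u.
Proof.
move=> H; apply: le_trans (expR_ge1Dx u).
by have := sqr_ge0 (y - 1); rewrite sqrrB mulr1 expr1n; lra.
Qed.

Lemma coord_sqr_le g : let s := sq12 g + sq3 g in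
  [/\ [/\ g.1.1.1.1.1.1 ^+ 2 <= s, g.1.1.1.1.1.2 ^+ 2 <= s & g.1.1.1.1.2 ^+ 2 <= s],
      [/\ g.1.1.1.2 ^+ 2 <= s, g.1.1.2 ^+ 2 <= s & g.1.2 ^+ 2 <= s] & 0 ^+ 2 <= s].
Proof.
rewrite /sq12 /sq3 expr0n /=.
have := sqr_ge0 g.1.1.1.1.1.1; have := sqr_ge0 g.1.1.1.1.1.2; have := sqr_ge0 g.1.1.1.1.2.
have := sqr_ge0 g.1.1.1.2; have := sqr_ge0 g.1.1.2; have := sqr_ge0 g.1.2.
move: (_ ^+ 2) (_ ^+ 2) (_ ^+ 2) (_ ^+ 2) (_ ^+ 2) (_ ^+ 2) => x1 x2 x3 x4 x5 x6 *.
by split; [split|split|]; lra.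
Qed.

Notation L1 f := ((@hm R).-integrable setT (EFin \o f)).
Notation I7 f := (Rintegral (@hm R) setT f).

Definition axis (t : R) : G R := (0, 0, 0, 0, 0, 0, t).
(** The cosine transform of f along the axis z = 0. *)
Definition fhat (f : G R -> R) (tau : R) : R :=
  Rintegral (m1 R) setT (fun t => cos (tau * t) * f (axis t)).

Lemma axis_continuous : continuous axis.
Proof.
move=> t; rewrite /axis.
apply: (@continuous_comp _ _ _ (fun t : R => t) (fun t : R => ((0, 0, 0, 0, 0, 0), t) : G R)).
  by apply: cvg_id.
exact: pair_continuous.
Qed.

Lemma measurable_axis (f : G R -> R) : continuous f -> measurable_fun setT (fun t : R => f (axis t)).
Proof.
move=> cf; apply: continuous_measurable_fun => t.
by apply: continuous_comp; [exact: axis_continuous|exact: cf].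
Qed.

Lemma ind_bound (f : G R -> R) : continuous f -> bsupp f ->
  exists C M, [/\ 0 <= C, 0 < M, forall g, `|f g| <= C * ind M g.2 & forall g, M < `|g.2| -> f g = 0].
Proof.
move=> cf bf; have [C [M [C0 M0 H]]] := bsupp_dominated cf bf.
have H1 g : `|f g| <= C * ind M g.2.
  apply: (le_trans (H g)); apply: ler_wpM2l => //; rewrite /cube_ind /tens7 !indE.
  by do ![case: ifP => _; rewrite ?mulr0 ?mul0r ?mulr1].
exists C, M; split => // g Mg; have := H1 g; rewrite indE -ler_norml (lt_geF Mg) mulr0.
by rewrite normr_le0 => /eqP.
Qed.

Lemma integrable_axis (f : G R -> R) (tau : R) : continuous f -> bsupp f ->
  (m1 R).-integrable setT (EFin \o (fun t : R => cos (tau * t) * f (axis t))).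
Proof.
move=> cf bf; have [C [M [C0 M0 H _]]] := ind_bound cf bf.
have mf := measurable_axis cf.
apply: (@integrable_dom R _ _ (m1 R) _ (fun t => C * ind M t)).
- apply: measM; last exact: mf.
  by apply: measC; apply: measM; [exact: meas_cst|exact: measurable_id].
- move=> t; rewrite normrM -[leRHS]mul1r; apply: ler_pM; rewrite ?normr_ge0 //.
    exact: cos_max.
- by apply: integrable_scale; exact: integrable_ind.
Qed.

Lemma le_I7 (u v : G R -> R) : L1 u -> L1 v -> (forall g, `|u g| <= v g) -> `|I7 u| <= I7 v.
Proof.
move=> iu iv uv; apply: (le_trans (le_normr_Rintegral measurableT iu)).
have ia : L1 (fun g => `|u g|).
  apply: (integrable_dom _ _ iv) => [|g]; last by rewrite normr_id uv.
  by apply: measurableT_comp => //; exact: measurable_L1.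
exact: (le_Rintegral measurableT ia iv (fun g _ => uv g)).
Qed.

(** The Gaussian mass is a multiple of r / (1 + r)^2, which is at most r. *)
Lemma heat_slice_near0 tau (f : G R -> R) : 0 < tau -> Coo f -> bsupp f ->
  exists2 K, 0 <= K & forall r, 0 < r < 1 -> `|heat_slice tau f r| <= K * r.
Proof.
move=> t0 cf bf; have [C [M [C0 M0 H _]]] := ind_bound (Coo_cont cf) bf.
have I0 : 0 <= Rintegral (m1 R) setT (ind M) by apply: Rintegral_ge0 => x _; exact: ind_ge0.
have p3 : 0 <= (pi / tau) ^+ 3 by rewrite exprn_ge0 // divr_ge0 ?pi_ge0 // ltW.
exists (C * ((pi / tau) ^+ 3 * Rintegral (m1 R) setT (ind M))) => [|r r01].
  exact: (mulr_ge0 C0 (mulr_ge0 p3 I0)).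
have [l0 a1 b0 w0 B0] := weights_pos r01; have a0 := lt_le_trans ltr01 a1.
have [iv ev] := gauss7 a0 b0 t0 (integrable_ind M).
have iv' := integrable_scale (C * bweight r) iv.
apply: (le_trans (le_I7 _ iv' _)).
- apply: integrable_bsupp; last by do 2!apply: bsuppMr.
  by apply: Coo_cont; apply: (CooM (Coo_cst _ _)); apply: CooM => //; exact: Coo_Ecos.
- move=> g; rewrite /Ecos normrM (gtr0_norm B0) !normrM [`|expR _|]ger0_norm ?expR_ge0 //.
  have h1 : `|cos (tau * g.2)| <= 1 by exact: cos_max.
  have e0 := expR_ge0 (- (tau * quad (alpha r) (beta r) g)).
  rewrite [leRHS](_ : _ = bweight r * (expR (- (tau * quad (alpha r) (beta r) g)) * 1 * (C * ind M g.2))); last first.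
    by move: (expR _) (ind _ _) => *; ring.
  apply: ler_wpM2l; first exact: ltW.
  by apply: ler_pM => //; exact: ler_wpM2l.
- rewrite RintegralZ_ // ev; have [e _] := bweight_bounds r01.
  move: p3 I0; set J := Rintegral (m1 R) setT (ind M) => p3 I0.
  have -> : C * bweight r * ((pi / (tau * alpha r)) ^+ 2 * (pi / (tau * beta r)) * J) =
      C * ((pi / tau) ^+ 3 * J) * (bweight r / (alpha r ^+ 2 * beta r)).
    move: (bweight r) (alpha r) (beta r) a0 b0 => B a b a0' b0'; field.
    by rewrite !gt_eqF.
  rewrite e; apply: ler_wpM2l; first exact: (mulr_ge0 C0 (mulr_ge0 p3 I0)).
  have /andP[r0 _] := r01.
  by rewrite ler_piMr ?(ltW r0) // invf_le1 ?exprn_gt0 ?addr_gt0 // exprn_ege1 // lerDl ltW.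
Qed.

(** Replace f (z, t) by f (0, t), for which the integral is explicit. By the
    Lipschitz bound the error carries a factor |z|, which half of the Gaussian
    turns into (tau b)^(-1/2), while the other half keeps a bounded mass. *)
Lemma heat_slice_near1 tau (f : G R -> R) : 0 < tau -> Coo f -> bsupp f ->
  exists2 K, 0 <= K & forall r, 0 < r < 1 ->
    `|heat_slice tau f r - (pi / tau) ^+ 3 * fhat f tau * (r / (1 + r) ^+ 2)| <=
    K * (Num.sqrt (tau * beta r))^-1.
Proof.
move=> t0 cf bf; have cf0 := Coo_cont cf.
have [C [M [C0 M0 H HM]]] := ind_bound cf0 bf; have [K K0 HK] := lipschitz cf bf.
have I0 : 0 <= Rintegral (m1 R) setT (ind M) by apply: Rintegral_ge0 => x _; exact: ind_ge0.
have p3 : 0 <= (pi / tau) ^+ 3 by rewrite exprn_ge0 // divr_ge0 ?pi_ge0 // ltW.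
exists (K * (2 * (pi / tau) ^+ 3 * Rintegral (m1 R) setT (ind M))) => [|r r01].
  exact: (mulr_ge0 K0 (mulr_ge0 (mulr_ge0 (ler0n _ 2) p3) I0)).
have [l0 a1 b0 w0 B0] := weights_pos r01; have a0 := lt_le_trans ltr01 a1.
have [iu eu] := gauss7 a0 b0 t0 (integrable_axis tau cf0 bf).
have b20 : 0 < beta r / 2 by rewrite divr_gt0.
have [iv ev] := gauss7 b20 b20 t0 (integrable_ind M).
have iu' := integrable_scale (- bweight r) iu.
set s := Num.sqrt (tau * beta r).
have s0 : 0 < s by rewrite sqrtr_gt0 mulr_gt0.
have si : 0 < s^-1 by rewrite invr_gt0.
have iv' := integrable_scale (K * s^-1 * bweight r) iv.
have iII : L1 (fun g => bweight r * (Ecos (alpha r) (beta r) tau g * f g)).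
  apply: integrable_bsupp; last by do 2!apply: bsuppMr.
  by apply: Coo_cont; apply: (CooM (Coo_cst _ _)); apply: CooM => //; exact: Coo_Ecos.
have eq1 : heat_slice tau f r - (pi / tau) ^+ 3 * fhat f tau * (r / (1 + r) ^+ 2) =
   I7 (fun g => bweight r * (Ecos (alpha r) (beta r) tau g * f g) +
     (- bweight r) * (expR (- (tau * quad (alpha r) (beta r) g)) * (cos (tau * g.2) * f (axis g.2)))).
  rewrite RintegralD_ // (RintegralZ_ (- bweight r) iu) eu; congr (_ + _).
  have [e _] := bweight_bounds r01; rewrite -e -/(fhat f tau).
  move: (fhat f tau) (bweight r) (alpha r) (beta r) a0 b0 => I B a b a0' b0'; field.
  by rewrite !gt_eqF.
rewrite eq1; apply: (le_trans (le_I7 _ iv' _)).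
- exact: (integrableD measurableT iII iu').
- move=> g; rewrite /Ecos.
  have -> : bweight r * (expR (- (tau * quad (alpha r) (beta r) g)) * cos (tau * g.2) * f g) +
      - bweight r * (expR (- (tau * quad (alpha r) (beta r) g)) * (cos (tau * g.2) * f (axis g.2))) =
      bweight r * (expR (- (tau * quad (alpha r) (beta r) g)) * (cos (tau * g.2) * (f g - f (axis g.2)))).
    by move: (expR _) (cos _) (f _) (f _) => *; ring.
  have [gM|gM] := ltP M `|g.2|.
    rewrite HM // HM // subr0 !mulr0 normr0.
    exact: (mulr_ge0 (mulr_ge0 (mulr_ge0 K0 (ltW si)) (ltW B0)) (mulr_ge0 (expR_ge0 _) (ind_ge0 _ _))).
  have -> : ind M g.2 = 1.
    by rewrite /ind indicE mem_set //= in_itv /= -ler_norml.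
  rewrite mulr1 normrM (gtr0_norm B0) !normrM [`|expR _|]ger0_norm ?expR_ge0 //.
  rewrite -[leRHS]mulrA [leRHS]mulrCA; apply: ler_wpM2l; first exact: ltW.
  have e0 := expR_ge0 (- (tau * quad (alpha r) (beta r) g)).
  set u := tau * quad (beta r / 2) (beta r / 2) g.
  have uE : 2 * u = tau * (beta r * (sq12 g + sq3 g)) by rewrite /u /quad; field.
  have h2 : expR (- (tau * quad (alpha r) (beta r) g)) <= expR (- u) * expR (- u).
    rewrite -expRD ler_expR -opprD lerN2 -mulr2n -mulr_natl uE ler_pM2l //.
    exact: quad_lb.
  (* |x| <= s^-1 e^u for each coordinate x, because (s x)^2 <= 2 u *)
  have hn : `|g - axis g.2| <= s^-1 * expR u.
    have X (x : R) : x ^+ 2 <= sq12 g + sq3 g -> - (s^-1 * expR u) <= x <= s^-1 * expR u.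
      move=> xs; rewrite -ler_norml mulrC ler_pdivlMr //.
      apply: sq_expR; have s2 : s ^+ 2 = tau * beta r by rewrite sqr_sqrtr // ltW // mulr_gt0.
      rewrite uE exprMn real_normK ?num_real // s2 mulrC -mulrA.
      by rewrite ler_pM2l // ler_pM2l.
    apply/normG_le; rewrite /cube /= !in_itv /=.
    have [[z1 z2 z3] [z4 z5 z6] z7] := coord_sqr_le g.
    by do 6?[split]; apply: X; rewrite ?subr0 ?subrr.
  apply: (@le_trans _ _ (expR (- u) * expR (- u) * (1 * (K * (s^-1 * expR u))))).
    apply: ler_pM => //.
    apply: ler_pM => //; first exact: cos_max.
    by apply: (le_trans (HK _ _)); apply: ler_wpM2l.
  have uu : expR (- u) * expR u = 1 by rewrite -expRD addNr expR0.
  rewrite mul1r [leLHS](_ : _ = K * s^-1 * expR (- u) * (expR (- u) * expR u)); last first.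
    by move: (expR _) (expR _) => *; ring.
  by rewrite uu mulr1.
- rewrite RintegralZ_ // ev; have [_ e] := bweight_bounds r01.
  set J := Rintegral _ _ _.
  have -> : K / s * bweight r * ((pi / (tau * (beta r / 2))) ^+ 2 * (pi / (tau * (beta r / 2))) * J) =
     (K / s) * (8 * (pi / tau) ^+ 3 * J) * (bweight r / beta r ^+ 3).
    move: (bweight r) (beta r) b0 => B b b0'; field.
    by rewrite !gt_eqF.
  have kern : 0 <= K / s * (8 * (pi / tau) ^+ 3 * J).
    exact: (mulr_ge0 (mulr_ge0 K0 (ltW si)) (mulr_ge0 (mulr_ge0 (ler0n _ 8) p3) I0)).
  apply: le_trans (ler_wpM2l kern e) _.
  rewrite le_eqVlt; apply/orP; left; apply/eqP; field.
  by rewrite !gt_eqF.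
Qed.

End endpoint_limits.

(** * The identity at a fixed frequency *)

Section fixed_tau.
Context (R : realType).
Implicit Types (g : G R).

Lemma bound_cvg (u v : nat -> R) (l : R) : (forall n, `|u n - l| <= v n) ->
  v n @[n --> \oo] --> 0 -> u n @[n --> \oo] --> l.
Proof.
move=> H v0; apply/cvgrPdist_le => e e0.
have /cvgrPdist_le /(_ e e0) := v0; apply: filterS => n.
by rewrite sub0r normrN distrC => h; apply: (le_trans (H n)); apply: le_trans h; exact: ler_norm.
Qed.

(** The slabs ]pn, qn[ exhaust ]0, 1[; the offset 3 makes pn < qn for every n. *)
Definition pn (n : nat) : R := n.+3%:R^-1.
Definition qn (n : nat) : R := 1 - pn n.

Lemma pn_qn n : [/\ 0 < pn n, pn n < qn n, qn n < 1 & pn n <= 1 / 3].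
Proof.
have p0 : 0 < pn n by rewrite /pn invr_gt0.
have p3 : pn n <= 1 / 3.
  by rewrite /pn mul1r lef_pV2 ?posrE // ler_nat.
by split => //; rewrite /qn; lra.
Qed.

Lemma cvg_pn : pn n @[n --> \oo] --> 0.
Proof.
rewrite (_ : pn = fun n => harmonic n.+2) //.
rewrite (cvg_shiftS (fun n => @harmonic R n.+1)) (cvg_shiftS (@harmonic R)).
exact: cvg_harmonic.
Qed.

Lemma cut_cvg r : cut (pn n) (qn n) r @[n --> \oo] --> cut 0 1 r.
Proof.
rewrite (cutE 0 1); have [/andP[r0 r1]|r01] := boolP (0 < r < 1); last first.
  rewrite (_ : (fun n => _) = fun=> 0); first exact: cvg_cst.
  apply/funext => n; rewrite cutE; case: ifP => // /andP[h1 h2].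
  have [p0 _ q1 _] := pn_qn n; move: r01.
  by rewrite (lt_trans p0 h1) (lt_trans h2 q1).
apply: (@cvg_trans _ ((fun=> (1:R)) n @[n --> \oo])); last exact: cvg_cst.
apply: near_eq_cvg.
have h1 : \forall n \near \oo, pn n < r by exact: (cvgr_lt _ cvg_pn).
have h2 : \forall n \near \oo, pn n < 1 - r by apply: (cvgr_lt _ cvg_pn); rewrite subr_gt0.
near=> n; rewrite cutE (_ : pn n < r < qn n = true) //; apply/andP; split.
  by near: n.
by rewrite /qn ltrBrDl -ltrBrDr; near: n.
Unshelve. all: by end_near.
Qed.

Lemma heat_slice_pn tau (f : G R -> R) : 0 < tau -> Coo f -> bsupp f ->
  heat_slice tau f (pn n) @[n --> \oo] --> 0.
Proof.
move=> t0 cf bf; have [K K0 HK] := heat_slice_near0 t0 cf bf.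
apply: (@bound_cvg _ (fun n => K * pn n)) => [n|].
  rewrite subr0; apply: HK; have [p0 pq q1 _] := pn_qn n.
  by rewrite p0 (lt_trans pq q1).
by rewrite -[X in _ --> X](mulr0 K); apply: cvgMr; exact: cvg_pn.
Qed.

(** For r >= 1/2 one has b >= 1 / (1 - r), hence the error of heat_slice_near1
    tends to 0, while r / (1 + r)^2 tends to 1/4. *)
Lemma heat_slice_qn tau (f : G R -> R) : 0 < tau -> Coo f -> bsupp f ->
  heat_slice tau f (qn n) @[n --> \oo] --> (pi / tau) ^+ 3 * fhat f tau / 4.
Proof.
move=> t0 cf bf; have [K K0 HK] := heat_slice_near1 t0 cf bf.
set A := (pi / tau) ^+ 3 * fhat f tau in HK *.
apply: (@bound_cvg _ (fun n => K * Num.sqrt (pn n / tau) + `|A| * pn n)) => [n|].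
  have [p0 pq q1 p3] := pn_qn n; have q01 : 0 < qn n < 1 by rewrite (lt_trans p0 pq) q1.
  have h1 := HK _ q01; have /andP[q0 _] := q01.
  have pE : 1 - qn n = pn n by rewrite /qn; ring.
  have q2 : 1 / 2 <= qn n by rewrite /qn; lra.
  have [l0 a1 b0 w0 B0] := weights_pos q01.
  have b1 : (pn n)^-1 <= beta (qn n).
    have := lnr_ub_inv q01; rewrite -/(mln (qn n)) pE => hl.
    rewrite /beta ler_pdivlMr // mulrC ler_pdivrMr //.
    apply: (le_trans hl); rewrite ler_pdivrMr //.
    by move: q2 p0; move: (qn n) (pn n) => q p q2 p0; nra.
  have h2 : (Num.sqrt (tau * beta (qn n)))^-1 <= Num.sqrt (pn n / tau).
    move: (beta (qn n)) b0 b1 => b b0 b1.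
    have tb : 0 < tau * b by exact: mulr_gt0.
    rewrite -(sqrtrV (ltW tb)); apply: ler_wsqrtr.
    rewrite -[leRHS]invrK lef_pV2 ?posrE // ?invr_gt0 ?divr_gt0 //.
    by rewrite invf_div ler_pM2l.
  have h3 : `|qn n / (1 + qn n) ^+ 2 - 4^-1| <= pn n.
    have s0 : 0 < 1 + qn n by rewrite addr_gt0.
    rewrite (_ : _ - _ = - ((1 - qn n) ^+ 2 / (4 * (1 + qn n) ^+ 2))); last first.
      by field; rewrite gt_eqF.
    rewrite pE normrN ger0_norm; last by rewrite divr_ge0 ?sqr_ge0 // mulr_ge0 // sqr_ge0.
    rewrite ler_pdivrMr ?mulr_gt0 ?exprn_gt0 //.
    by move: q0 p0 p3; move: (qn n) (pn n) => q p q0 p0 p3; nra.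
  have -> : heat_slice tau f (qn n) - A / 4 = (heat_slice tau f (qn n) - A * (qn n / (1 + qn n) ^+ 2)) +
     A * (qn n / (1 + qn n) ^+ 2 - 4^-1) by ring.
  apply: le_trans (ler_normD _ _) _; apply: lerD.
    by apply: (le_trans h1); exact: ler_wpM2l.
  by rewrite normrM; exact: ler_wpM2l.
have -> : (0 : R) = K * Num.sqrt (0 / tau) + `|A| * 0 by rewrite mul0r sqrtr0 !mulr0 addr0.
apply: cvgD; last by apply: cvgMr; exact: cvg_pn.
apply: cvgMr; apply: continuous_cvg; first exact: sqrt_continuous.
by apply: cvgMl; exact: cvg_pn.
Qed.

(** The slab identity in the limit, by dominated convergence on the left. *)
Lemma fixed_tau tau (f : G R -> R) : 0 < tau -> Coo f -> bsupp f ->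
  tau ^+ 2 * Rintegral (@hm1 R) setT (heat_slab tau (L f) 0 1) = pi ^+ 3 / 4 * fhat f tau.
Proof.
move=> t0 cf bf; have cLf := Coo_cont (Coo_L cf); have bLf := bsupp_L bf.
have [h ih H] := dom_heat_slab t0 cLf bLf.
have c1 : Rintegral (@hm1 R) setT (heat_slab tau (L f) (pn n) (qn n)) @[n --> \oo] -->
    Rintegral (@hm1 R) setT (heat_slab tau (L f) 0 1).
  have hE n : {ae @hm1 R, forall x, `|heat_slab tau (L f) (pn n) (qn n) x| <= h x}.
    by have [p0 _ q1 _] := pn_qn n; apply: H; exact: ltW.
  apply: (@dominated_cvg_Rintegral _ _ R (@hm1 R) _ _ h _ _ _ ih).
  - by move=> n; exact: measurable_heat_slab.
  - exact: measurable_heat_slab.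
  - have := ae_foralln hE; apply: filterS => x hx; split=> //.
    by rewrite /heat_slab; apply: cvgMl; exact: cut_cvg.
have c2 : Rintegral (@hm1 R) setT (heat_slab tau (L f) (pn n) (qn n)) @[n --> \oo] -->
    tau * ((pi / tau) ^+ 3 * fhat f tau / 4 - 0).
  rewrite (_ : (fun n => _) = fun n => tau * (heat_slice tau f (qn n) - heat_slice tau f (pn n))); last first.
    by apply/funext => n; have [p0 pq q1 _] := pn_qn n; exact: segment_identity.
  by apply: cvgMr; apply: cvgB; [exact: heat_slice_qn|exact: heat_slice_pn].
rewrite (cvg_unique _ c1 c2) //.
by field; rewrite gt_eqF.
Qed.
End fixed_tau.

(** * Summation over frequencies *)

Section tonelli.
Context d1 d2 (T1 : measurableType d1) (T2 : measurableType d2) (R : realType).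
Variables (mu1 : {sigma_finite_measure set T1 -> \bar R})
          (mu2 : {sigma_finite_measure set T2 -> \bar R}).

(** The majorant is needed only after one integration, and only almost
    everywhere. *)
Lemma integrable_tonelli (F : T1 * T2 -> R) (h : T1 -> R) : measurable_fun setT F ->
  (forall x, mu2.-integrable setT (EFin \o (fun y => F (x, y)))) ->
  {ae mu1, forall x, Rintegral mu2 setT (fun y => `|F (x, y)|) <= h x} ->
  mu1.-integrable setT (EFin \o h) ->
  (mu1 \x mu2)%E.-integrable setT (EFin \o F).
Proof.
move=> mF iF Fh ih.
have mFE : measurable_fun setT (EFin \o F) by exact/measurable_EFinP.
apply/integrable12ltyP => //.
have /integrableP[/measurable_EFinP mh] := ih; apply: le_lt_trans.
apply: ae_ge0_le_integral => //.
- by move=> x _; apply: integral_ge0.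
- apply: (@measurable_fun_fubini_tonelli_F _ _ _ _ R mu2 (fun z => `|(EFin \o F) z|)%E) => //.
  exact: measurableT_comp.
- by apply/measurable_EFinP; exact: measurableT_comp.
apply: filterS Fh => x Fhx _.
have i2 : mu2.-integrable setT (EFin \o (fun y => `|F (x, y)|)).
  exact: (integrable_norm (iF x)).
have <- : (Rintegral mu2 setT (fun y => `|F (x, y)|))%:E = (\int[mu2]_y `|(EFin \o F) (x, y)|)%E.
  by rewrite fineK //; exact: (integrable_fin_num measurableT i2).
by rewrite /= lee_fin (le_trans Fhx) // ler_norm.
Qed.
End tonelli.

Section eps.
Context (R : realType).
Implicit Types (g : G R).
Notation L1 f := ((@hm R).-integrable setT (EFin \o f)).
Notation LX f := ((@hm1 R).-integrable setT (EFin \o f)).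
Notation Lt f := ((m1 R).-integrable setT (EFin \o f)).

(** The half-line as a factor of the integrand, so that Fubini is applied to
    integrals over the whole line. *)
Definition pos (t : R) : R := \1_(`]0, +oo[%classic) t.

Lemma posE t : pos t = if 0 < t then 1 else 0.
Proof. by rewrite /pos indicE mem_setE in_itv /= andbT; case: ifP. Qed.

Lemma pos_integral (f : R -> R) : (@lebesgue_measure R).-integrable `[0, +oo[ (EFin \o f) ->
  Lt (fun t => pos t * f t) /\
  Rintegral (m1 R) setT (fun t => pos t * f t) = Rintegral (@lebesgue_measure R) `[0, +oo[ f.
Proof.
move=> i0; have i1 : (@lebesgue_measure R).-integrable `]0, +oo[ (EFin \o f).
  by apply: integrableS i0 => // x /=; rewrite !in_itv /= !andbT => /ltW.
split; first exact/(integrable_ind_iff (m1 R) _ (measurable_itv _)).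
by rewrite -(Rintegral_ind (m1 R)) -Rintegral_itv_obnd_cbnd.
Qed.

Lemma laplace2_pos (A t : R) : 0 < A ->
  Lt (fun x => pos x * (x ^+ 2 * expR (- (x * A)) * cos (x * t))) /\
  Rintegral (m1 R) setT (fun x => pos x * (x ^+ 2 * expR (- (x * A)) * cos (x * t))) = 2 * re3 A t.
Proof. by move=> A0; have [i e] := laplace2 t A0; have [i' ->] := pos_integral i. Qed.

Lemma laplace0_pos (A t : R) : 0 < A ->
  Lt (fun x => pos x * (expR (- (x * A)) * cos (x * t))) /\
  Rintegral (m1 R) setT (fun x => pos x * (expR (- (x * A)) * cos (x * t))) = A / (A ^+ 2 + t ^+ 2).
Proof. by move=> A0; have [i e] := laplace0 t A0; have [i' ->] := pos_integral i. Qed.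

Definition quad_hm1 (x : G R * R) : R := quad (alpha x.2) (beta x.2) x.1.

(** The triple integral over g, r and tau whose two iterated forms are compared
    in [eps_identity]. *)
Definition laplace_integrand (e : R) (f : G R -> R) (z : (G R * R) * R) : R :=
  (cut 0 1 z.1.2 * weight z.1.2 * f z.1.1) *
  (pos z.2 * (z.2 ^+ 2 * expR (- (z.2 * (quad_hm1 z.1 + e))) * cos (z.2 * z.1.1.2))).

Lemma measurable_laplace_integrand e f : continuous f -> measurable_fun setT (laplace_integrand e f).
Proof.
move=> cf.
have m1' (k : G R * R -> R) : measurable_fun setT k -> measurable_fun setT (fun z : (G R * R) * R => k z.1).
  by move=> cpair; apply: measurableT_comp.
have m2' (k : R -> R) : measurable_fun setT k -> measurable_fun setT (fun z : (G R * R) * R => k z.2).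
  by move=> cpair; apply: measurableT_comp.
have mi : measurable_fun setT (fun z : (G R * R) * R => z.2) by exact: measurable_snd.
apply: measM; [apply: measM; [apply: measM|]|].
- by apply: (m1' (fun x => cut 0 1 x.2)); apply: measX2; exact: measurable_cut.
- by apply: (m1' (fun x => weight x.2)); exact: measurable_weight_hm1.
- by apply: (m1' (fun x => f x.1)); apply: measX1; exact: measurable_continuous.
- apply: measM; first by apply: m2'; exact: measurable_indic.
  apply: measM; [apply: measM|].
  + exact: measX.
  + have mP : measurable_fun setT (fun z : (G R * R) * R => quad_hm1 z.1) by apply: m1'; exact: measurable_quad_hm1.
    by apply: measE; apply: measN; apply: (measM mi (measD mP _)); exact: meas_cst.
  + apply: measC; apply: measM => //.
    by apply: (m1' (fun x => x.1.2)); apply: measX1; exact: measurable_tc.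
Qed.

Lemma quad_hm1_ge0 x : 0 < x.2 < 1 -> 0 <= quad_hm1 x.
Proof.
move=> r01; have [_ a1 b0 _ _] := weights_pos r01; rewrite /quad_hm1 /quad /sq12 /sq3.
by rewrite addr_ge0 // mulr_ge0 ?(ltW b0) ?(le_trans _ a1) // !addr_ge0 // sqr_ge0.
Qed.

(** With |cos| at most 1, integrating in tau first gives the function bounded in
    dom_eps; this is where the factor e^(-e tau) is indispensable. *)
Lemma integrable_laplace_integrand e f : 0 < e -> continuous f -> bsupp f ->
  (@hm1 R \x m1 R)%E.-integrable setT (EFin \o laplace_integrand e f).
Proof.
move=> e0 cf bf.
have Q x : 0 < x.2 < 1 -> 0 < quad_hm1 x + e by move=> /quad_hm1_ge0 h; rewrite ltr_wpDl.
have i1 x : Lt (fun t => laplace_integrand e f (x, t)).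
  rewrite /laplace_integrand /= cutE; have [r01|r01] := boolP (0 < x.2 < 1).
    by have [i _] := laplace2_pos x.1.2 (Q _ r01); exact: integrable_scale.
  rewrite (_ : EFin \o _ = cst 0%E); first exact: integrable0.
  by apply/funext => t /=; rewrite !mul0r.
have [C C0 HC] := dom_eps e0.
have re30 (A : R) : 0 < A -> re3 A 0 = (A ^+ 3)^-1.
  by move=> A0; rewrite /re3 expr0n /=; field; rewrite gt_eqF.
pose K (x : G R * R) := 2 * (cut 0 1 x.2 * (weight x.2 / (quad_hm1 x + e) ^+ 3) * f x.1).
have mK : measurable_fun setT K.
  apply: measM; first exact: meas_cst.
  apply: measM; last by apply: measX1; exact: measurable_continuous.
  apply: measM; first by apply: measX2; exact: measurable_cut.
  apply: measM; first exact: measurable_weight_hm1.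
  by apply: measV; apply: measX; apply: measD; [exact: measurable_quad_hm1|exact: meas_cst].
have [h ih Hh] : exists2 h, LX h & {ae @hm1 R, forall x, `|K x| <= h x}.
  apply: (@dominated_by_kappa6 R K f (2 * C) mK cf bf); first by rewrite mulr_ge0.
    move=> g r r01 nz; rewrite /K /= cutE r01 mul1r.
    have [_ _ _ w0 _] := weights_pos r01.
    have a0 : 0 <= weight r / (quad_hm1 (g, r) + e) ^+ 3.
      by rewrite divr_ge0 ?(ltW w0) // exprn_ge0 // ltW //; apply: (Q (g, r)).
    have := HC r g r01 nz; rewrite -/(quad_hm1 (g, r)).
    move: (kappa2 r * kappa6 g) (weight r / _) a0 => D a a0 aD.
    rewrite normrM ger0_norm // normrM (ger0_norm a0) mulrA; apply: ler_wpM2r => //.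
    by rewrite -mulrA ler_pM2l.
  by move=> g r r01; rewrite /K /= cutE (negbTE r01) !mul0r mulr0.
apply: (@integrable_tonelli _ _ _ _ R (@hm1 R) (m1 R) _ h (measurable_laplace_integrand e cf) i1 _ ih).
apply: ae_mono Hh => x; apply: le_trans.
have [r01|r01] := boolP (0 < x.2 < 1); last first.
  rewrite /laplace_integrand /= cutE (negbTE r01) /Rintegral (eq_integral (cst 0%E)) ?integral0 //.
    exact: normr_ge0.
  by move=> t _; rewrite !mul0r normr0.
have A0 := Q _ r01; have [_ _ _ w0 _] := weights_pos r01.
have [ia ea] := laplace2_pos 0 A0.
have -> : `|K x| = Rintegral (m1 R) setT (fun t => (weight x.2 * `|f x.1|) *
    (pos t * (t ^+ 2 * expR (- (t * (quad_hm1 x + e))) * cos (t * 0)))).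
  have a0 : 0 <= weight x.2 / (quad_hm1 x + e) ^+ 3 by rewrite divr_ge0 ?(ltW w0) // exprn_ge0 // ltW.
  rewrite RintegralZl // ea re30 // /K cutE r01 mul1r normrM ger0_norm // normrM (ger0_norm a0).
  by move: (weight _) `|f _| (_ ^-1) => *; ring.
apply: le_Rintegral => //.
- exact: (integrable_norm (i1 x)).
- exact: integrable_scale.
move=> t _; rewrite /laplace_integrand /= cutE r01 mul1r !normrM (gtr0_norm w0).
apply: ler_wpM2l; first by rewrite mulr_ge0 // ltW.
rewrite posE; case: ifP => t0; last by rewrite normr0 !mul0r.
rewrite normr1 !mul1r mulr0 cos0 mulr1 (gtr0_norm t0) -expr2 ger0_norm ?expR_ge0 //.
rewrite ler_piMr ?mulr_ge0 ?expR_ge0 ?exprn_ge0 ?(ltW t0) //.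
exact: cos_max.
Qed.

(** The integrand of the kernel against f, with P replaced by P + e. *)
Definition reg_kernel (e : R) (f : G R -> R) (x : G R * R) : R :=
  cut 0 1 x.2 * weight x.2 * f x.1 * re3 (quad_hm1 x + e) x.1.2.

Lemma measurable_reg_kernel e f : continuous f -> measurable_fun setT (reg_kernel e f).
Proof.
move=> cf; have mP : measurable_fun setT (fun x => quad_hm1 x + e).
  by apply: measD; [exact: measurable_quad_hm1|exact: meas_cst].
have mt : measurable_fun setT (fun x : G R * R => x.1.2) by apply: measX1; exact: measurable_tc.
apply: measM; [apply: measM; [apply: measM|]|].
- by apply: measX2; exact: measurable_cut.
- exact: measurable_weight_hm1.
- by apply: measX1; exact: measurable_continuous.
- rewrite /re3; apply: measM.
    apply: measD; first exact: measX.
    by apply: measN; apply: measM; [apply: measM => //; exact: meas_cst|exact: measX].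
  by apply: measV; apply: measX; apply: measD; exact: measX.
Qed.

Lemma dom_reg_kernel f : continuous f -> bsupp f ->
  exists2 h, LX h & forall e, 0 <= e -> {ae @hm1 R, forall x, `|reg_kernel e f x| <= h x}.
Proof.
move=> cf bf; have [C [M [C0 M0 HM]]] := bsupp_dominated cf bf.
exists (fun x => C * (dom7 M x.1 * kappa2 x.2)).
  by apply: integrable_dom_kappa2; exact: integrable_dom7.
move=> e e0; apply: ae_mono (@ae_hm1 R) => -[g r] nz /=.
have D0 : 0 <= kappa6 g * kappa g.2 by rewrite mulr_ge0 ?kappa6_ge0 ?kappa_ge0.
rewrite /reg_kernel /= cutE; have [r01|r01] := boolP (0 < r < 1); last first.
  rewrite !mul0r normr0 mulr_ge0 // dom7E; apply: mulr_ge0; last exact: kappa2_ge0.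
  by apply: mulr_ge0 => //; exact: cube_ind_ge0.
have H := dom_re3 e0 r01 nz; have Hf := HM g.
rewrite mul1r mulrAC normrM dom7E.
have -> : C * (kappa6 g * kappa g.2 * cube_ind M g * kappa2 r) =
   kappa2 r * (kappa6 g * kappa g.2) * (C * cube_ind M g).
  by move: (kappa6 g) (kappa g.2) (cube_ind M g) (kappa2 r) => *; ring.
by apply: ler_pM.
Qed.

Lemma integrable_reg_kernel e f : 0 <= e -> continuous f -> bsupp f -> LX (reg_kernel e f).
Proof.
move=> e0 cf bf; have [h ih H] := dom_reg_kernel cf bf.
exact: (@ae_integrable_dom _ _ R (@hm1 R) _ _ (measurable_reg_kernel e cf) (H e e0) ih).
Qed.

Definition axis_integrand (e : R) (f : G R -> R) (z : R * R) : R :=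
  (pos z.2 * expR (- (z.2 * e))) * (cos (z.2 * z.1) * f (axis z.1)).

Lemma integrable_axis_integrand e f : 0 < e -> continuous f -> bsupp f ->
  (m1 R \x m1 R)%E.-integrable setT (EFin \o axis_integrand e f).
Proof.
move=> e0 cf bf; have [C [M [C0 M0 H _]]] := ind_bound cf bf.
have mf := measurable_axis cf.
have ms1 : measurable_fun setT (fun z : R * R => z.1) by exact: measurable_fst.
have ms2 : measurable_fun setT (fun z : R * R => z.2) by exact: measurable_snd.
have [i0 _] := laplace0_pos 0 e0.
have ipos : Lt (fun t => pos t * expR (- (t * e))).
  rewrite (_ : (fun t => _) = (fun x => pos x * (expR (- (x * e)) * cos (x * 0)))) //.
  by apply/funext => t; rewrite mulr0 cos0 mulr1.
have ip := @integrable_prod _ _ _ _ R (m1 R) (m1 R) _ _ (integrable_scale C (integrable_ind M)) ipos.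
apply: (@integrable_dom R _ _ (m1 R \x m1 R)%E _ _ _ _ ip) => [|[s t] /=].
  apply: measM.
    apply: measM; first by apply: (measurableT_comp (f := pos)) => //; exact: measurable_indic.
    by apply: measE; apply: measN; apply: (measM ms2); exact: meas_cst.
  apply: measM; first by apply: measC; exact: measM.
  exact: (measurableT_comp mf ms1).
rewrite /axis_integrand /= mulrC normrM.
have p0 : 0 <= pos t by rewrite posE; case: ifP.
apply: ler_pM => //; last by rewrite ger0_norm // mulr_ge0 ?expR_ge0.
rewrite normrM -[leRHS]mul1r; apply: ler_pM => //.
exact: cos_max.
Qed.

(** Integrating in tau first gives the regularised kernel; integrating in
    (g, r) first gives fixed_tau, and then the tau-integral of the right-hand
    side is a Poisson integral of f along the axis. *)
Lemma eps_identity e (f : G R -> R) : 0 < e -> Coo f -> bsupp f ->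
  Rintegral (@hm1 R) setT (reg_kernel e (L f)) =
  pi ^+ 3 / 8 * Rintegral (m1 R) setT (fun t => f (axis t) * (e / (e ^+ 2 + t ^+ 2))).
Proof.
move=> e0 cf bf; have cLf := Coo_cont (Coo_L cf); have bLf := bsupp_L bf.
have cf0 := Coo_cont cf.
have iF := integrable_laplace_integrand e0 cLf bLf.
have E1 := Rintegral_prod12 iF; have E2 := Rintegral_prod21 iF.
have E3 : 2 * Rintegral (@hm1 R) setT (reg_kernel e (L f)) =
   Rintegral (@hm1 R \x m1 R)%E setT (laplace_integrand e (L f)).
  rewrite E1 -RintegralZl //; last by apply: integrable_reg_kernel => //; exact: ltW.
  congr (Rintegral _ _ _); apply/funext => x; rewrite /laplace_integrand /reg_kernel /= cutE.
  have [r01|r01] := boolP (0 < x.2 < 1); last first.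
    by rewrite /Rintegral (eq_integral (cst 0%E)) ?integral0 ?mul0r ?mulr0 // => t _; rewrite !mul0r.
  have A0 : 0 < quad_hm1 x + e by rewrite ltr_wpDl // quad_hm1_ge0.
  have [ia ea] := laplace2_pos x.1.2 A0.
  by rewrite RintegralZl // ea mulrCA !mulrA.
have iG := integrable_axis_integrand e0 cf0 bf.
have G1 := Rintegral_prod12 iG.
have E4 : Rintegral (@hm1 R \x m1 R)%E setT (laplace_integrand e (L f)) =
   pi ^+ 3 / 4 * Rintegral (m1 R \x m1 R)%E setT (axis_integrand e f).
  rewrite E2 -RintegralZl // (Rintegral_prod21 (integrable_scale (pi ^+ 3 / 4) iG)).
  congr (Rintegral _ _ _); apply/funext => t.
  transitivity (pos t * expR (- (t * e)) * (t ^+ 2 * Rintegral (@hm1 R) setT (heat_slab t (L f) 0 1))).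
    rewrite posE; case: ifP => t0; last first.
      rewrite !mul0r /Rintegral (eq_integral (cst 0%E)) ?integral0 // => x _.
      by rewrite /laplace_integrand /= posE t0 mul0r mulr0.
    rewrite mulrA -RintegralZl //; last exact: integrable_heat_slab.
    congr (Rintegral _ _ _); apply/funext => x; rewrite /laplace_integrand /heat_slab /Ecos /= posE t0.
    rewrite mulrDr opprD expRD /quad_hm1.
    by move: (cut _ _ _) (weight _) (L f _) (expR _) (expR _) (cos _) => *; ring.
  rewrite posE; case: ifP => t0; last first.
    rewrite !mul0r /Rintegral (eq_integral (cst 0%E)) ?integral0 ?mulr0 // => x _.
    by rewrite /axis_integrand /= posE t0 !mul0r mulr0.
  rewrite fixed_tau // mul1r mulrCA /fhat mulrA -RintegralZl //; last first.
    exact: integrable_axis.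
  by congr (Rintegral _ _ _); apply/funext => s; rewrite /axis_integrand /= posE t0; move: (expR _) (cos _) (f _) => *; field.
have E5 : Rintegral (m1 R \x m1 R)%E setT (axis_integrand e f) =
   Rintegral (m1 R) setT (fun t => f (axis t) * (e / (e ^+ 2 + t ^+ 2))).
  rewrite G1; congr (Rintegral _ _ _); apply/funext => s.
  have [i0 <-] := laplace0_pos s e0; rewrite -RintegralZl //.
  by congr (Rintegral _ _ _); apply/funext => t; rewrite /axis_integrand /=; move: (pos t) (expR _) (cos _) (f _) => *; ring.
apply: (@mulfI _ (2 : R)); first by rewrite pnatr_eq0.
by rewrite E3 E4 E5 mulrA; congr (_ * _); field.
Qed.

End eps.

(** * The kernel paired with L *)

Section eps_limit.
Context (R : realType).
Implicit Types (g : G R).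
Notation L1 f := ((@hm R).-integrable setT (EFin \o f)).
Notation I7 f := (Rintegral (@hm R) setT f).
Notation Lt f := ((m1 R).-integrable setT (EFin \o f)).

Lemma re3_cvg (A t : R) : 0 < A -> re3 (A + harmonic n) t @[n --> \oo] --> re3 (A + 0) t.
Proof.
move=> A0; have cu : A + harmonic n @[n --> \oo] --> A + 0.
  by apply: cvgD; [exact: cvg_cst|exact: cvg_harmonic].
have cX k : (A + harmonic n) ^+ k @[n --> \oo] --> (A + 0) ^+ k.
  by apply: (@continuous_cvg _ _ _ _ _ _ (fun y : R => y ^+ k)); [exact: exprn_continuous|exact: cu].
rewrite /re3; apply: cvgM.
  apply: cvgB; first exact: cX.
  by apply: cvgMl; apply: cvgMr; exact: cu.
apply: cvgV.
  by rewrite expf_neq0 // gt_eqF // ltr_wpDr ?sqr_ge0 // exprn_gt0 // addr0.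
apply: (@continuous_cvg _ _ _ _ _ _ (fun y : R => y ^+ 3)); first exact: exprn_continuous.
by apply: cvgD; [exact: cX|exact: cvg_cst].
Qed.

Lemma reg_kernel_cvg (f : G R -> R) : continuous f -> bsupp f ->
  Rintegral (@hm1 R) setT (reg_kernel (harmonic n) f) @[n --> \oo] --> Rintegral (@hm1 R) setT (reg_kernel 0 f).
Proof.
move=> cf bf; have [h ih H] := dom_reg_kernel cf bf.
have hE n : {ae @hm1 R, forall x, `|reg_kernel (harmonic n) f x| <= h x}.
  by apply: H; rewrite /harmonic invr_ge0.
apply: (@dominated_cvg_Rintegral _ _ R (@hm1 R) (fun n => reg_kernel (harmonic n) f) (reg_kernel 0 f) h) => //.
- by move=> n; exact: measurable_reg_kernel.
- exact: measurable_reg_kernel.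
have := ae_and (ae_foralln hE) (@ae_hm1 R); apply: filterS => -[g r] [hx nz]; split=> //.
rewrite /reg_kernel /= cutE; have [r01|r01] := boolP (0 < r < 1); last first.
  by rewrite !mul0r (_ : (fun n => _) = fun=> 0); [exact: cvg_cst|apply/funext => n; rewrite !mul0r].
apply: cvgMr; apply: re3_cvg.
by have [P0 _] := core_domination r01 nz.
Qed.

Lemma poisson_kernel_le (e t : R) : 0 < e -> 0 <= e / (e ^+ 2 + t ^+ 2) <= e^-1.
Proof.
move=> e0; have d0 : 0 < e ^+ 2 + t ^+ 2 by rewrite ltr_wpDr ?sqr_ge0 // exprn_gt0.
rewrite divr_ge0 ?(ltW e0) ?(ltW d0) //= ler_pdivrMr // mulrDr expr2 mulKf ?gt_eqF //.
by rewrite lerDl mulr_ge0 ?sqr_ge0 // invr_ge0 ltW.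
Qed.

Lemma poisson_kernel_t (e t : R) : 0 < e -> `|t| * (e / (e ^+ 2 + t ^+ 2)) <= 1 / 2.
Proof.
move=> e0; have d0 : 0 < e ^+ 2 + t ^+ 2 by rewrite ltr_wpDr ?sqr_ge0 // exprn_gt0.
rewrite mulrA ler_pdivrMr //.
have := sqr_ge0 (e - `|t|); rewrite sqrrB real_normK ?num_real //; move: (`|t|) => s; lra.
Qed.

Lemma axis_norm (t : R) : `|axis t - axis 0| <= `|t|.
Proof.
by apply/normG_le; rewrite /cube /= !in_itv /= !subrr oppr_le0 !normr_ge0 subr0 -ler_norml lexx.
Qed.

(** Split f (0, t) as f (0) on the segment of the support plus an error. The
    first part is an arctangent; in the second one the Lipschitz bound cancels
    the singularity of the Poisson kernel, as |t| e / (e^2 + t^2) <= 1/2. *)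
Lemma poisson_limit (f : G R -> R) : Coo f -> bsupp f ->
  Rintegral (m1 R) setT (fun t => f (axis t) * (harmonic n / (harmonic n ^+ 2 + t ^+ 2)))
   @[n --> \oo] --> pi * f (axis 0).
Proof.
move=> cf bf; have cf0 := Coo_cont cf.
have [C [M [C0 M0 _ HM]]] := ind_bound cf0 bf; have [K K0 HK] := lipschitz cf bf.
have e0 n : 0 < harmonic n :> R by rewrite /harmonic invr_gt0.
pose pk n t : R := harmonic n / (harmonic n ^+ 2 + t ^+ 2).
have mpk n : measurable_fun setT (pk n).
  have mi : measurable_fun setT (fun t : R => t) by exact: measurable_id.
  apply: measM; first exact: meas_cst.
  by apply: measV; apply: measD; [exact: meas_cst|exact: measX].
have mind : measurable_fun setT (ind M) by exact: measurable_indic.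
have maxis := measurable_axis cf0.
have i1 n : Lt (fun t => ind M t * pk n t).
  apply: (@integrable_dom R _ _ (m1 R) _ (fun t => (harmonic n)^-1 * ind M t)).
  - by apply: measM; [exact: mind|exact: mpk].
  - move=> t; have /andP[p0 p1] := poisson_kernel_le t (e0 n).
    rewrite normrM !ger0_norm ?ind_ge0 // mulrC; apply: ler_wpM2r => //; exact: ind_ge0.
  - by apply: integrable_scale; exact: integrable_ind.
pose er n t := ind M t * ((f (axis t) - f (axis 0)) * pk n t).
have mer n : measurable_fun setT (er n).
  by apply: measM => //; apply: measM => //; apply: measD => //; exact: meas_cst.
have ber n t : `|er n t| <= K / 2 * ind M t.
  rewrite normrM ger0_norm ?ind_ge0 // mulrC; apply: ler_wpM2r; first exact: ind_ge0.
  have /andP[p0 p1] := poisson_kernel_le t (e0 n).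
  rewrite normrM [`|pk _ _|]ger0_norm //.
  apply: (@le_trans _ _ (K * `|t| * pk n t)).
    apply: ler_wpM2r => //; apply: (le_trans (HK _ _)); apply: ler_wpM2l => //; exact: axis_norm.
  by rewrite -!mulrA ler_wpM2l // -[leRHS]mul1r; exact: poisson_kernel_t.
have iK := integrable_scale (K / 2) (integrable_ind M).
have ier n : Lt (er n) by exact: (@integrable_dom R _ _ (m1 R) _ _ (mer n) (ber n) iK).
have E n : Rintegral (m1 R) setT (fun t => f (axis t) * pk n t) =
    f (axis 0) * (2 * atan (M / harmonic n)) + Rintegral (m1 R) setT (er n).
  have PS : Rintegral (@lebesgue_measure R) `[- M, M] (fun t => harmonic n / (harmonic n ^+ 2 + t ^+ 2)) =
      Rintegral (m1 R) setT (fun t => ind M t * pk n t) by exact: (Rintegral_ind (m1 R)).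
  rewrite -(poisson_segment (e0 n) M0) PS.
  rewrite -(RintegralZl (mu := m1 R) _ measurableT (i1 n)).
  rewrite -(RintegralD (mu := m1 R) measurableT (integrable_scale (f (axis 0)) (i1 n)) (ier n)).
  congr (Rintegral _ _ _); apply/funext => t; rewrite /er /pk.
  have [tM|tM] := ltP M `|t|; first by rewrite HM // /ind indicE memNset ?mul0r ?mulr0 ?addr0 //= in_itv /= -ler_norml; apply/negP; rewrite -ltNge.
  have -> : ind M t = 1 by rewrite /ind indicE mem_set //= in_itv /= -ler_norml.
  by rewrite !mul1r; move: (f _) (f _) (_ / _) => *; ring.
rewrite (_ : (fun n => _) = fun n => f (axis 0) * (2 * atan (M / harmonic n)) + Rintegral (m1 R) setT (er n)); last exact/funext.
have -> : pi * f (axis 0) = f (axis 0) * (2 * (pi / 2)) + Rintegral (m1 R) setT (fun=> 0).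
  by rewrite Rintegral_cst // mul0r addr0; field.
apply: cvgD.
  apply: cvgMr; apply: cvgMr; apply: (cvg_comp _ _ _ (@cvgy_atan R)).
  rewrite (_ : (fun n => _) = fun n => M * n.+1%:R); last by apply/funext => n; rewrite /harmonic invrK.
  apply/cvgryPge => A; near=> n; rewrite -ler_pdivrMl //.
  apply: (@le_trans _ _ (n%:R : R)); last by rewrite ler_nat.
  by near: n; exact: nbhs_infty_ger.
apply: (@dominated_cvg_Rintegral _ _ R (m1 R) er (fun=> 0) (fun t => K / 2 * ind M t) mer) => //.
apply: ae_mono (ae_nonzero R) => t t0; split=> //.
rewrite /er [X in _ --> X](_ : _ = ind M t * ((f (axis t) - f (axis 0)) * (0 / (0 ^+ 2 + t ^+ 2)))); last by rewrite mul0r !mulr0.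
apply: cvgMr; apply: cvgMr.
apply: (@continuous_cvg _ _ _ _ _ _ (fun e : R => e / (e ^+ 2 + t ^+ 2))); last exact: cvg_harmonic.
apply: derive_cont; der.
by rewrite /= expr0n /= add0r sqrf_eq0.
Unshelve. all: by end_near.
Qed.

(** The limit e -> 0 of eps_identity. *)
Lemma kernel_pairing (f : G R -> R) : Coo f -> bsupp f ->
  Rintegral (@hm1 R) setT (reg_kernel 0 (L f)) = pi ^+ 4 / 8 * f (axis 0).
Proof.
move=> cf bf.
have c1 := reg_kernel_cvg (Coo_cont (Coo_L cf)) (bsupp_L bf).
have c2 : pi ^+ 3 / 8 * Rintegral (m1 R) setT
   (fun t => f (axis t) * (harmonic n / (harmonic n ^+ 2 + t ^+ 2))) @[n --> \oo] -->
   pi ^+ 3 / 8 * (pi * f (axis 0)) by apply: cvgMr; exact: poisson_limit.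
rewrite (_ : (fun n => Rintegral _ _ _) = (fun n => pi ^+ 3 / 8 * Rintegral (m1 R) setT
   (fun t => f (axis t) * (harmonic n / (harmonic n ^+ 2 + t ^+ 2))))) in c1; last first.
  by apply/funext => n; apply: eps_identity => //; rewrite /harmonic invr_gt0.
rewrite (cvg_unique _ c1 c2) //; by field.
Qed.
End eps_limit.

Section measurable_Rintegral.
Context d1 d2 (T1 : measurableType d1) (T2 : measurableType d2) (R : realType).
Variable (mu : {sigma_finite_measure set T2 -> \bar R}).

Lemma measurable_Rintegral (F : T1 * T2 -> R) : measurable_fun setT F ->
  measurable_fun setT (fun x => Rintegral mu setT (fun y => F (x, y))).
Proof.
move=> mF; have mE : measurable_fun setT (EFin \o F) by exact/measurable_EFinP.
apply: (measurableT_comp (f := fine)); first exact: fine_measurable.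
rewrite (_ : (fun x => _) = (fun x => (\int[mu]_y ((EFin \o F)^\+ (x, y)) - \int[mu]_y ((EFin \o F)^\- (x, y)))%E)).
  apply: emeasurable_funB.
    by apply: measurable_fun_fubini_tonelli_F => //; exact: measurable_funepos.
  by apply: measurable_fun_fubini_tonelli_F => //; exact: measurable_funeneg.
apply/funext => x; rewrite [LHS]integralE; congr (_ - _)%E; apply: eq_integral => y _.
  by rewrite !funeposE.
by rewrite !funenegE.
Qed.
End measurable_Rintegral.

(** Only the values on D matter, and mu may be a bare set function such as
    [haar]. *)
Lemma integrable_eq_on d (T : measurableType d) (R : realType) (mu : set T -> \bar R)
    (D : set T) (f h : T -> R) : measurable_fun setT f -> (forall x, D x -> f x = h x) ->
  mu.-integrable D (EFin \o h) -> mu.-integrable D (EFin \o f).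
Proof.
move=> mf fh /integrableP[_ lt]; apply/integrableP; split.
  by apply/measurable_EFinP; exact: measurable_funTS.
apply: le_lt_trans lt; rewrite le_eqVlt; apply/orP; left; apply/eqP.
have E : (fun x => `|(EFin \o f) x|%E) \_ D = (fun x => `|(EFin \o h) x|%E) \_ D.
  by apply/funext => x; rewrite !patchE; case: ifP => // /set_mem Dx /=; rewrite fh.
by rewrite /integral E.
Qed.

Section kernel.
Context (R : realType).
Implicit Types (g : G R).
Notation L1 f := ((@hm R).-integrable setT (EFin \o f)).
Notation I7 f := (Rintegral (@hm R) setT f).
Notation Lt f := ((m1 R).-integrable setT (EFin \o f)).

Lemma Re_inv_cube (A t : R) : complex.Re ((A +i* t)%C ^- 3) = re3 A t.
Proof.
have -> : (A +i* t)%C ^+ 3 = ((A ^+ 3 - 3 * A * t ^+ 2) +i* (3 * A ^+ 2 * t - t ^+ 3))%C.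
  by rewrite !exprS expr0 mulr1; simpc; congr (_ +i* _)%C; ring.
rewrite /= /re3; congr (_ / _).
by ring.
Qed.

Lemma normc_sqr (x y : R) : Normc.normc (x +i* y)%C ^+ 2 = x ^+ 2 + y ^+ 2.
Proof. by rewrite /Normc.normc sqr_sqrtr // addr_ge0 // sqr_ge0. Qed.

Definition kern g r : R := weight r * re3 (quad (alpha r) (beta r) g) g.2.

Lemma kernel_integrandE g r : 0 < r < 1 -> kernel_integrand g r = kern g r.
Proof.
move=> r01; have l0 := mln_gt0 r01; have /andP[r0 r1] := r01.
rewrite /kernel_integrand; case: g => [[[[[[x1 y1] x2] y2] x3] y3] t].
rewrite zc0 zc1 zc2 !normc_sqr Re_inv_cube /tc /=.
have -> : `|ln r| = mln r by rewrite /mln -normrN gtr0_norm.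
rewrite /kern /weight /quad /sq12 /sq3 /alpha /beta /=; congr (_ * re3 _ _).
by move: (_ / _) (_ / _) => a b; ring.
Qed.

Definition kern_int g : R := Rintegral (m1 R) setT (fun r => cut 0 1 r * kern g r).

Lemma N_kern_int g : N g = 8 / pi ^+ 4 * kern_int g.
Proof.
rewrite /N /kern_int; congr (_ * _).
rewrite [LHS](Rintegral_ind (m1 R)); congr (Rintegral _ _ _); apply/funext => r.
rewrite -/(cut 0 1 r) cutE; case: ifP => r01; last by rewrite !mul0r.
by rewrite kernel_integrandE.
Qed.

Definition kern_hm1 (x : G R * R) : R := cut 0 1 x.2 * kern x.1 x.2.

Lemma measurable_kern_hm1 : measurable_fun setT kern_hm1.
Proof.
have mP := @measurable_quad_hm1 R.
have mt : measurable_fun setT (fun x : G R * R => x.1.2) by apply: measX1; exact: measurable_tc.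
apply: measM; first by apply: measX2; exact: measurable_cut.
apply: measM; first exact: measurable_weight_hm1.
rewrite /re3; apply: measM.
  apply: measD; first exact: measX.
  by apply: measN; apply: measM; [apply: measM => //; exact: meas_cst|exact: measX].
by apply: measV; apply: measX; apply: measD; exact: measX.
Qed.

Lemma measurable_kern_int : measurable_fun setT kern_int.
Proof. exact: (@measurable_Rintegral _ _ _ _ R (m1 R) kern_hm1 measurable_kern_hm1). Qed.

Lemma measurable_N : measurable_fun setT (@N R).
Proof.
rewrite (_ : @N R = fun g => 8 / pi ^+ 4 * kern_int g); last exact/funext/N_kern_int.
by apply: measM; [exact: meas_cst|exact: measurable_kern_int].
Qed.

Lemma kern_bound g r : nonzero_coords g -> `|cut 0 1 r * kern g r| <= kappa6 g * kappa g.2 * kappa2 r.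
Proof.
move=> nz; have D0 : 0 <= kappa6 g * kappa g.2 by rewrite mulr_ge0 ?kappa6_ge0 ?kappa_ge0.
rewrite cutE; case: ifP => r01; last by rewrite mul0r normr0 mulr_ge0 ?kappa2_ge0.
by have := dom_re3 (lexx 0) r01 nz; rewrite addr0 mul1r [leRHS]mulrC.
Qed.

Lemma integrable_kern g : nonzero_coords g -> Lt (fun r => cut 0 1 r * kern g r).
Proof.
move=> nz; apply: (@integrable_dom R _ _ (m1 R) _ (fun r => kappa6 g * kappa g.2 * kappa2 r)).
- exact: (measurableT_comp measurable_kern_hm1 (pair1_measurable g)).
- by move=> r; exact: kern_bound.
- by apply: integrable_scale; exact: integrable_kappa2.
Qed.

Lemma kernel_integrand_integrable : \forall g \ae @haar R,
  (@lebesgue_measure R).-integrable `]0, 1[ (EFin \o kernel_integrand g).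
Proof.
apply: haar_ae; apply: ae_mono (ae_nonzero_coords R) => g nz.
apply/(integrable_ind_iff (m1 R) _ (measurable_itv _)).
rewrite (_ : (fun x => _) = (fun r => cut 0 1 r * kern g r)); first exact: integrable_kern.
apply/funext => r; rewrite -/(cut 0 1 r) cutE; case: ifP => r01; last by rewrite !mul0r.
by rewrite kernel_integrandE.
Qed.

Definition kappa2_int : R := Rintegral (m1 R) setT (@kappa2 R).

(** The majorant that makes N integrable against bounded functions of bounded
    support. *)
Lemma kern_int_bound g : nonzero_coords g -> `|kern_int g| <= kappa2_int * (kappa6 g * kappa g.2).
Proof.
move=> nz; have i1 := integrable_kern nz.
apply: (le_trans (le_normr_Rintegral measurableT i1)).
rewrite mulrC /kappa2_int -(RintegralZl (mu := m1 R) _ measurableT (integrable_kappa2 R)).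
apply: le_Rintegral => //.
- exact: (integrable_norm i1).
- by apply: integrable_scale; exact: integrable_kappa2.
- by move=> r _; exact: kern_bound.
Qed.

Lemma integrable_kern_int_mul (f : G R -> R) (C M : R) : measurable_fun setT f -> 0 < M ->
  0 <= C -> (forall g, `|f g| <= C * cube_ind M g) -> L1 (fun g => kern_int g * f g).
Proof.
move=> mf M0 C0 H.
apply: (@ae_integrable_dom _ _ R (@hm R) _ (fun g => (kappa2_int * C) * dom7 M g)).
- by apply: measM => //; exact: measurable_kern_int.
- apply: ae_mono (ae_nonzero_coords R) => g nz.
  rewrite normrM dom7E; have -> : kappa2_int * C * (kappa6 g * kappa g.2 * cube_ind M g) =
    (kappa2_int * (kappa6 g * kappa g.2)) * (C * cube_ind M g).
    by move: kappa2_int (kappa6 g) (kappa g.2) (cube_ind M g) => *; ring.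
  by apply: ler_pM => //; exact: kern_int_bound.
- by apply: integrable_scale; exact: integrable_dom7.
Qed.

Lemma integrable_N_dom (f : G R -> R) (C M : R) : measurable_fun setT f -> 0 < M ->
  0 <= C -> (forall g, `|f g| <= C * cube_ind M g) -> L1 (fun g => N g * f g).
Proof.
move=> mf M0 C0 H; have i1 := integrable_kern_int_mul mf M0 C0 H.
rewrite (_ : (fun g => N g * f g) = fun g => 8 / pi ^+ 4 * (kern_int g * f g)).
  exact: integrable_scale.
by apply/funext => g; rewrite N_kern_int mulrA.
Qed.

Lemma integrable_N_mul (f : G R -> R) : continuous f -> bsupp f -> L1 (fun g => N g * f g).
Proof.
move=> cf bf; have [C [M [C0 M0 H]]] := bsupp_dominated cf bf.
exact: (integrable_N_dom (measurable_continuous cf) M0 C0 H).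
Qed.

Lemma integrable_N_cube M : 0 < M -> L1 (fun g => N g * cube_ind M g).
Proof.
move=> M0; apply: (integrable_N_dom (measurable_L1 (integrable_cube_ind M)) M0 ler01) => g.
by rewrite mul1r ger0_norm // cube_ind_ge0.
Qed.

Lemma compact_cube_bound (K : set (G R)) : compact K -> exists2 M : R, 0 < M & K `<=` cube M.
Proof.
move=> /compact_bounded [B [_ HB]]; exists (`|B| + 1); first by rewrite ltr_wpDl.
by move=> g Kg; apply/normG_le; apply: HB Kg; rewrite (le_lt_trans (ler_norm B)) // ltrDl.
Qed.

Lemma N_loc_integrable : loc_integrable (@N R).
Proof.
split; first exact: measurable_N.
move=> K cK.
have [M M0 HM] := compact_cube_bound cK.
have i2 := integrable_N_cube M0.
apply: integrable_eq_on (haar_integrable K (measurable_L1 i2) i2); first exact: measurable_N.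
by move=> g gK; rewrite (cube_indE (HM g gK)) mulr1.
Qed.

(** The statement that N is a fundamental solution of L, in real form: apply
    Fubini to [kernel_pairing]. *)
Lemma N_pairing (f : G R -> R) : Coo f -> bsupp f -> I7 (fun g => N g * L f g) = f (axis 0).
Proof.
move=> cf bf; have cLf := Coo_cont (Coo_L cf); have bLf := bsupp_L bf.
have iK := integrable_reg_kernel (lexx 0) cLf bLf.
have := kernel_pairing cf bf; rewrite (Rintegral_prod12 iK) => E.
have [C [M [C0 M0 H]]] := bsupp_dominated cLf bLf.
have i1 := integrable_kern_int_mul (measurable_continuous cLf) M0 C0 H.
rewrite (_ : (fun g => N g * L f g) = fun g => 8 / pi ^+ 4 * (kern_int g * L f g)); last first.
  by apply/funext => g; rewrite N_kern_int mulrA.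
rewrite RintegralZ_ //.
have -> : I7 (fun g => kern_int g * L f g) = pi ^+ 4 / 8 * f (axis 0).
  rewrite -E; apply: (f_equal fine); apply: ae_eq_integral => //.
  - by have /integrableP[] := i1.
  - apply/measurable_EFinP.
    exact: (@measurable_Rintegral _ _ _ _ R (m1 R) _ (measurable_reg_kernel 0 cLf)).
  - apply: ae_mono (ae_nonzero_coords R) => g nz _; congr EFin.
    rewrite /kern_int mulrC -(RintegralZl (mu := m1 R) _ measurableT (integrable_kern nz)).
    by congr (Rintegral _ _ _); apply/funext => r; rewrite /reg_kernel /kern /quad_hm1 /= addr0; move: (cut _ _ _) (weight _) (re3 _ _) (L f g) => *; ring.
have p0 : (pi : R) != 0 by rewrite gt_eqF // pi_gt0.
move: (f _) (pi : R) p0 => y p p0; rewrite mulrA mulf_div [8 * _]mulrC divff ?mul1r //.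
by rewrite mulf_neq0 ?expf_neq0.
Qed.
End kernel.

(** * Convolution on the group *)

Lemma addr_shuffle (V : zmodType) (g u p q r : V) : g + (p - u) + (q - r) = p + q + (g - u - r).
Proof. by rewrite [RHS]addrACA [g + _]addrCA. Qed.

Section translation.
Context (R : realType).
Implicit Types (g v w : G R) (k f : G R -> R).
Notation L1 f := ((@hm R).-integrable setT (EFin \o f)).
Notation I7 f := (Rintegral (@hm R) setT f).

(** The argument of f once the convolution is written with w as the variable
    of N. *)
Definition ldiv w g : G R := mulG (invG w) g.

Lemma ldivE w g : ldiv w g = (g - w) + sympl w g *: et R.
Proof.
rewrite /ldiv eq_mulG eq_invG /= /et /sympl.
case: g => [[[[[[a1 a2] a3] a4] a5] a6] a7]; case: w => [[[[[[b1 b2] b3] b4] b5] b6] b7].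
by do 6!(congr (_, _); [|by rewrite /= /GRing.scale /=; ring]); rewrite /= /GRing.scale /=; ring.
Qed.

Lemma ldiv_affine_r w (h : R) v u : ldiv w (h *: v + u) = h *: (v + sympl w v *: et R) + ldiv w u.
Proof.
rewrite !ldivE symplD symplZ scalerDl -scalerA [h *: (v + _)]scalerDr.
by rewrite -[h *: v + u - w]addrA addrACA.
Qed.

Lemma ldiv_affine_l g (h : R) v u : ldiv (h *: v + u) g = h *: (- v - sympl g v *: et R) + ldiv u g.
Proof.
rewrite !ldivE symplC symplD symplZ [sympl u g]symplC; move: (sympl g v) (sympl g u) => a b.
rewrite !scalerDr scaleNr !scalerN scalerA scalerDl !opprD scaleNr.
exact: addr_shuffle.
Qed.

Lemma mulG_inv_ldiv w g : mulG g (invG (ldiv w g)) = w.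
Proof.
rewrite /ldiv !eq_mulG !eq_invG /=.
case: g => [[[[[[a1 a2] a3] a4] a5] a6] a7]; case: w => [[[[[[b1 b2] b3] b4] b5] b6] b7] /=.
by do 6!(congr (_, _); [|ring]); ring.
Qed.

Lemma ldiv_axis0 g : ldiv (axis 0) g = g.
Proof.
rewrite /ldiv !eq_mulG !eq_invG /axis /=.
case: g => [[[[[[a1 a2] a3] a4] a5] a6] a7] /=.
by do 6!(congr (_, _); [|ring]); ring.
Qed.

Lemma sympl_le w v (r s : R) : `|w| <= r -> `|v| <= s -> `|sympl w v| <= 8 * r * s.
Proof.
move=> wr vs; have [w1 w2 w3 [w4 _ _ _]] := normG_coords w.
have [v1 v2 v3 [v4 _ _ _]] := normG_coords v.
have T (x y : R) : `|x| <= `|w| -> `|y| <= `|v| -> `|x * y| <= r * s.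
  by move=> h1 h2; rewrite normrM; apply: ler_pM => //; [exact: le_trans wr|exact: le_trans vs].
have h1 := T _ _ w1 v2; have h2 := T _ _ w2 v1; have h3 := T _ _ w3 v4; have h4 := T _ _ w4 v3.
rewrite /sympl normrM ger0_norm // -[leRHS]mulrA.
move: h1 h2 h3 h4; move: (_ * _) (_ * _) (_ * _) (_ * _) (r * s) => a b c d m h1 h2 h3 h4.
have k1 := ler_normD (d - c) (b - a); have k2 := ler_normB d c; have k3 := ler_normB b a.
lra.
Qed.

Lemma norm_et : `|et R| <= 1.
Proof.
by apply/normG_le; rewrite /cube /= !in_itv /= oppr_le0 ler01 lexx (le_trans _ ler01) // oppr_le0.
Qed.

Lemma div_norm g h : `|mulG g (invG h)| <= `|g| + `|h| + 8 * `|g| * `|h|.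
Proof.
have -> : mulG g (invG h) = (g - h) + sympl g h *: et R.
  rewrite eq_mulG eq_invG /= /et /sympl.
  case: g => [[[[[[a1 a2] a3] a4] a5] a6] a7]; case: h => [[[[[[b1 b2] b3] b4] b5] b6] b7].
  by do 6!(congr (_, _); [|by rewrite /= /GRing.scale /=; ring]); rewrite /= /GRing.scale /=; ring.
apply: le_trans (ler_normD _ _) _; apply: lerD; first exact: ler_normB.
have e1n := norm_et.
rewrite normrZ -[leRHS]mulr1; apply: ler_pM => //; exact: sympl_le.
Qed.

(** Local integrability, tested on cubes; it is stable under multiplication by
    the coefficients that differentiation produces (locint_sympl). *)
Definition locint k : Prop :=
  measurable_fun setT k /\ forall M, 0 < M -> L1 (fun w => k w * cube_ind M w).

Lemma tuple_continuous (T : topologicalType) (a1 a2 a3 a4 a5 a6 a7 : T -> R) :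
  continuous a1 -> continuous a2 -> continuous a3 -> continuous a4 -> continuous a5 ->
  continuous a6 -> continuous a7 ->
  continuous (fun x => (a1 x, a2 x, a3 x, a4 x, a5 x, a6 x, a7 x) : G R).
Proof.
move=> h1 h2 h3 h4 h5 h6 h7 x.
have p (U V : topologicalType) (a : T -> U) (b : T -> V) : {for x, continuous a} -> {for x, continuous b} ->
    {for x, continuous (fun x => (a x, b x))} by move=> ha hb; exact: cvg_pair.
by apply/p; [|exact: h7]; apply/p; [|exact: h6]; apply/p; [|exact: h5]; apply/p; [|exact: h4];
  apply/p; [|exact: h3]; apply/p; [exact: h1|exact: h2].
Qed.

Lemma ldiv_continuous g : continuous (fun w => ldiv w g).
Proof.
have [[k1 k2 k3] [k4 k5 k6] k7] := Coo_coords R.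
have C (c : R) : Coo (fun _ : G R => c) by exact: Coo_cst.
rewrite /ldiv; under eq_fun => w do rewrite eq_mulG eq_invG /=.
apply: tuple_continuous; apply: Coo_cont; do ?[by apply: CooD => //; exact: Coo_opp].
apply: CooD; first by apply: CooD => //; exact: Coo_opp.
apply: CooM => //; apply: CooD; (apply: CooD; [|apply: Coo_opp]); apply: CooM => //; exact: Coo_opp.
Qed.

Lemma cube_indE01 M g : cube_ind M g = if `|g| <= M then 1 else 0.
Proof.
case: ifPn => [/normG_le h|h]; first exact: cube_indE.
rewrite /cube_ind /tens7 !indE; apply/eqP; apply: contraNT h => h; apply/normG_le.
rewrite /cube /= !in_itv /=; move: h.
by do 7!(case: ifP => ?; rewrite ?(mul0r, mulr0, eqxx) //).
Qed.

Lemma locint_sympl k v : locint k -> locint (fun w => k w * sympl w v).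
Proof.
move=> [cpair ik].
have mc : measurable_fun setT ((@sympl R)^~ v) by apply: measurable_continuous; apply: Coo_cont; exact: Coo_sympl.
split=> [|M M0]; first exact: measM.
apply: (@integrable_dom R _ _ (@hm R) _ (fun w => (8 * M * `|v|) * `|k w * cube_ind M w|)).
- by apply: measM; [exact: measM|apply: measurable_L1; exact: integrable_cube_ind].
- move=> w; rewrite cube_indE01; case: ifP => wM; last by rewrite !mulr0 normr0 !mulr0.
  by rewrite !mulr1 normrM mulrC; apply: ler_wpM2r => //; exact: sympl_le.
- by apply: integrable_scale; exact: (integrable_norm (ik M M0)).
Qed.

(** If w^-1 g is in the support of f and g is bounded, then w = g (w^-1 g)^-1
    is bounded. *)
Lemma ldiv_supp f (r : R) : Coo f -> bsupp f -> 0 <= r -> exists C M, [/\ 0 <= C, 0 < M &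
  forall w g, `|g| <= r -> `|f (ldiv w g)| <= C * cube_ind M w].
Proof.
move=> cf bf r0; have [C [B [C0 B0 H]]] := bsupp_dominated (Coo_cont cf) bf.
have M0 : 0 < r + B + 8 * r * B by rewrite ltr_wpDr ?ltr_wpDl // !mulr_ge0 // ltW.
exists C, (r + B + 8 * r * B); split=> // w g gr.
apply: (le_trans (H _)); apply: ler_wpM2l => //; rewrite !cube_indE01.
case: ifP => // hB; last by case: ifP.
rewrite ifT // -(mulG_inv_ldiv w g); apply: (le_trans (div_norm _ _)).
by apply: lerD; [exact: lerD|apply: ler_pM; rewrite ?mulr_ge0 // ler_wpM2l].
Qed.

(** The convolution k * f after the substitution h = w^-1 g. *)
Definition gconv k f g : R := I7 (fun w => k w * f (ldiv w g)).

Lemma gconv_integrable k f g : locint k -> Coo f -> bsupp f -> L1 (fun w => k w * f (ldiv w g)).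
Proof.
move=> [cpair ik] cf bf; have [C [M [C0 M0 H]]] := ldiv_supp cf bf (normr_ge0 g).
apply: (@integrable_dom R _ _ (@hm R) _ (fun w => C * `|k w * cube_ind M w|)).
- apply: measM => //; apply: measurable_continuous => w.
  by apply: continuous_comp; [exact: ldiv_continuous|exact: Coo_cont].
- move=> w; rewrite normrM [`|k w * cube_ind _ _|]normrM [leRHS]mulrCA; apply: ler_wpM2l => //.
  by rewrite (ger0_norm (cube_ind_ge0 _ _)); exact: H.
- by apply: integrable_scale; exact: (integrable_norm (ik M M0)).
Qed.

Lemma ldiv_derive_r f w g v : Coo f ->
  is_derive g v (fun g => f (ldiv w g)) ('D_v f (ldiv w g) + sympl w v * 'D_(et R) f (ldiv w g)).
Proof.
move=> cf; have H : is_derive g v (fun g => f (ldiv w g)) ('D_(v + sympl w v *: et R) f (ldiv w g)).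
  by apply: is_derive_affine => [|h]; [exact: Coo_derivable|exact: ldiv_affine_r].
apply: (is_derive_conv H); have c1f := Coo_C1 cf.
by rewrite derive_add // derive_scale.
Qed.

(** Differentiating f (w^-1 g) in g produces sums of functions of the same
    form, with k possibly multiplied by a coefficient; this is what makes the
    induction of gconv_Coo work. *)
Lemma gconv_derive k f g v : locint k -> Coo f -> bsupp f ->
  is_derive g v (gconv k f) (gconv k ('D_v f) g + gconv (fun w => k w * sympl w v) ('D_(et R) f) g).
Proof.
move=> lk cf bf; have lkc := locint_sympl v lk.
have cv := Coo_D v cf; have ct := Coo_D (et R) cf.
have bv := bsupp_derive v bf; have bt := bsupp_derive (et R) bf.
have r0 : 0 <= `|g| + `|v| by rewrite addr_ge0.
have [C1 [M1 [p1 q1 H1]]] := ldiv_supp cv bv r0.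
have [C2 [M2 [p2 q2 H2]]] := ldiv_supp ct bt r0.
have gs (s : R) : `|s| < 1 -> `|g + s *: v| <= `|g| + `|v|.
  move=> s1; apply: le_trans (ler_normD _ _) _; rewrite lerD2l normrZ ler_piMl //; exact: ltW.
have -> : gconv k ('D_v f) g + gconv (fun w => k w * sympl w v) ('D_(et R) f) g =
  I7 (fun w => k w * ('D_v f (ldiv w g) + sympl w v * 'D_(et R) f (ldiv w g))).
  rewrite /gconv -(RintegralD_ (gconv_integrable g lk cv bv) (gconv_integrable g lkc ct bt)).
  by congr (Rintegral _ _ _); apply/funext => w; rewrite mulrDr mulrA.
apply: (@derive_under_integral R _ _ (@hm R) _ (fun w y => k w * f (ldiv w y))
  (fun w y => k w * ('D_v f (ldiv w y) + sympl w v * 'D_(et R) f (ldiv w y))) g v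
  (fun w => C1 * `|k w * cube_ind M1 w| + C2 * `|(k w * sympl w v) * cube_ind M2 w|)).
- by move=> s _; exact: gconv_integrable.
- move=> w y; apply: (is_derive_conv (dM (dcst (k w) y v) (ldiv_derive_r w y v cf))).
  by rewrite mulr0 addr0.
- have [_ i1] := lk; have [_ i2] := lkc.
  have j1 := integrable_scale C1 (integrable_norm (i1 M1 q1)).
  have j2 := integrable_scale C2 (integrable_norm (i2 M2 q2)).
  exact: (integrableD measurableT j1 j2).
- move=> w s s1; rewrite mulrDr mulrA; apply: le_trans (ler_normD _ _) _; apply: lerD.
    rewrite normrM [`|k w * cube_ind _ _|]normrM [leRHS]mulrCA; apply: ler_wpM2l => //.
    by rewrite (ger0_norm (cube_ind_ge0 _ _)); apply: H1; exact: gs.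
  rewrite normrM [`|_ * cube_ind _ _|]normrM [leRHS]mulrCA; apply: ler_wpM2l => //.
  by rewrite (ger0_norm (cube_ind_ge0 _ _)); apply: H2; exact: gs.
Qed.

(** By the Lipschitz bound on f; for w in the cube of ldiv_supp the left
    translation by w^-1 has bounded distortion. *)
Lemma gconv_continuous k f : locint k -> Coo f -> bsupp f -> continuous (gconv k f).
Proof.
move=> lk cf bf g; have [cpair ik] := lk; have [K K0 HK] := lipschitz cf bf.
have r0 : 0 <= `|g| + 1 by rewrite addr_ge0.
have [C [M [C0 M0 H]]] := ldiv_supp cf bf r0.
pose J := I7 (fun w => `|k w * cube_ind M w|).
have J0 : 0 <= J by apply: Rintegral_ge0.
have B g' : `|g - g'| < 1 -> `|gconv k f g - gconv k f g'| <= (K * (1 + 8 * M) * J) * `|g - g'|.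
  move=> gg; have g'r : `|g'| <= `|g| + 1.
    by rewrite -[g'](subrK g) addrC (le_trans (ler_normD _ _)) // lerD2l distrC ltW.
  have gr : `|g| <= `|g| + 1 by rewrite lerDl.
  have i1 := gconv_integrable g lk cf bf; have i2 := gconv_integrable g' lk cf bf.
  have -> : gconv k f g - gconv k f g' = I7 (fun w => k w * f (ldiv w g) + (- 1) * (k w * f (ldiv w g'))).
    by rewrite (RintegralD_ i1 (integrable_scale (-1) i2)) (RintegralZ_ (-1) i2) mulN1r.
  have iv := integrable_scale (K * (1 + 8 * M) * `|g - g'|) (integrable_norm (ik M M0)).
  have -> : (K * (1 + 8 * M) * J) * `|g - g'| = I7 (fun w => (K * (1 + 8 * M) * `|g - g'|) * `|k w * cube_ind M w|).
    by rewrite (RintegralZ_ _ (integrable_norm (ik M M0))) -/J mulrAC.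
  apply: le_I7 => //; first exact: (integrableD measurableT i1 (integrable_scale (-1) i2)).
  move=> w; rewrite mulN1r -mulrBr normrM cube_indE01; case: ifPn => [wM|wM]; last first.
    have z g'' : `|g''| <= `|g| + 1 -> f (ldiv w g'') = 0.
      move=> h; have := H w _ h; rewrite cube_indE01 (negbTE wM) mulr0 normr_le0.
      by move/eqP.
    by rewrite z // z // subrr normr0 !mulr0 normr0 mulr0.
  rewrite mulr1 mulrC; apply: ler_wpM2r => //; apply: (le_trans (HK _ _)).
  rewrite -mulrA; apply: ler_wpM2l => //.
  have -> : ldiv w g - ldiv w g' = (g - g') + sympl w (g - g') *: et R.
    have := ldiv_affine_r w 1 (g - g') g'; rewrite !scale1r subrK => ->.
    by rewrite addrK.
  apply: le_trans (ler_normD _ _) _; rewrite mulrDl mul1r lerD2l normrZ.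
  have e1n := norm_et.
  by rewrite -[leRHS]mulr1; apply: ler_pM => //; exact: sympl_le.
set L0 := K * (1 + 8 * M) * J in B.
have L00 : 0 <= L0 by rewrite /L0 !mulr_ge0 // addr_ge0 // mulr_ge0 // ltW.
apply/cvgrPdist_le => e e0; near=> g'.
have h1 : `|g - g'| < 1 by near: g'; apply: cvgr_dist_lt => //; exact: cvg_id.
have h2 : `|g - g'| < e / (L0 + 1).
  by near: g'; apply: cvgr_dist_lt; [exact: cvg_id|rewrite divr_gt0 // ltr_wpDl].
apply: (le_trans (B g' h1)); apply: (@le_trans _ _ (L0 * (e / (L0 + 1)))).
  by apply: ler_wpM2l => //; exact: ltW.
rewrite mulrCA ler_piMr ?(ltW e0) // ler_pdivrMr ?ltr_wpDl // mul1r lerDl //.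
Unshelve. all: by end_near.
Qed.

Lemma gconv_Coo k f : locint k -> Coo f -> bsupp f -> Coo (gconv k f).
Proof.
move=> lk cf bf n; elim: n k f lk cf bf => [|n IH] k f lk cf bf.
  by split=> //; exact: gconv_continuous.
split; first exact: gconv_continuous.
move=> v; have D y := gconv_derive y v lk cf bf; split=> [y|]; first by apply: (is_derive_ex (D y)).
apply: Ck_ext (CkD (IH k ('D_v f) lk (Coo_D v cf) (bsupp_derive v bf))
  (IH (fun w => k w * sympl w v) ('D_(et R) f) (locint_sympl v lk) (Coo_D (et R) cf) (bsupp_derive (et R) bf))) => y /=.
by rewrite (is_deriveE (D y)).
Qed.

End translation.

(** * L inverts the convolution *)

Section inversion.
Context (R : realType).
Implicit Types (g v w : G R) (k f : G R -> R).
Notation L1 f := ((@hm R).-integrable setT (EFin \o f)).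
Notation I7 f := (Rintegral (@hm R) setT f).

Lemma N_locint : locint (@N R).
Proof. by split=> [|M M0]; [exact: measurable_N|exact: integrable_N_cube]. Qed.

(** The common value of the squares of a right-invariant field applied to
    f (w^-1 g) in w and in g. *)
Definition fld2_ldiv v f w g : R :=
  let a := ldiv w g in let c := sympl w v + sympl g v in
  'D_v ('D_v f) a + c * 'D_(et R) ('D_v f) a + c * 'D_v ('D_(et R) f) a
  + c ^+ 2 * 'D_(et R) ('D_(et R) f) a.

Lemma ldiv_derive_l f w g v : Coo f ->
  is_derive w v (fun w => f (ldiv w g)) (- ('D_v f (ldiv w g) + sympl g v * 'D_(et R) f (ldiv w g))).
Proof.
move=> cf; have H : is_derive w v (fun w => f (ldiv w g)) ('D_(- v - sympl g v *: et R) f (ldiv w g)).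
  by apply: is_derive_affine => [|h]; [exact: Coo_derivable|exact: ldiv_affine_l].
apply: (is_derive_conv H); have c1f := Coo_C1 cf.
rewrite derive_add // -[- v]scaleN1r -[- (sympl g v *: et R)]scaleNr !derive_scale //.
by move: ('D_v f _) ('D_(et R) f _) (sympl g v) => *; ring.
Qed.

Lemma fld2_left_expand (k e a b p q r : R) :
  - (- (a + e * b) + ((k + e) * - (p + e * q) + r * 0))
  + k * - (- (b + 0 * b) + ((k + e) * - (q + 0 * q) + r * 0)) =
  a + (k + e) * b + (k + e) * p + (k + e) ^+ 2 * q.
Proof. by ring. Qed.

(** Right-invariant fields generate left translations, and moving w to e w has
    the same effect on w^-1 g as moving g to e^-1 g. Hence the first-order fields
    in w and in g are opposite, and their squares agree. *)
Lemma fld2_left v f g w : Coo f -> fld2 v (fun w => f (ldiv w g)) w = fld2_ldiv v f w g.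
Proof.
move=> cf; have cv := Coo_D v cf; have ct := Coo_D (et R) cf.
have E : fld v (fun w => f (ldiv w g)) =
   fun w => - ('D_v f (ldiv w g) + (sympl w v + sympl g v) * 'D_(et R) f (ldiv w g)).
  apply/funext => u; rewrite /fld (is_deriveE (ldiv_derive_l u g v cf)).
  rewrite (is_deriveE (ldiv_derive_l u g (et R) cf)) sympl_etr.
  by move: ('D_v f _) ('D_(et R) f _) (sympl u v) (sympl g v) => *; ring.
have Dk u : is_derive w u (fun w => sympl w v + sympl g v) (sympl u v).
  by apply: (is_derive_conv (dD (sympl_derive v u w) (dcst (sympl g v) w u))); rewrite addr0.
have D u := dN (dD (ldiv_derive_l w g u cv) (dM (Dk u) (ldiv_derive_l w g u ct))).
rewrite /fld2 E /fld (is_deriveE (D v)) (is_deriveE (D (et R))).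
rewrite symplvv sympl_etl sympl_etr /fld2_ldiv.
exact: fld2_left_expand.
Qed.

Lemma gconv_derive_t k f g : locint k -> Coo f -> bsupp f ->
  is_derive g (et R) (gconv k f) (gconv k ('D_(et R) f) g).
Proof.
move=> lk cf bf; apply: (is_derive_conv (gconv_derive g (et R) lk cf bf)).
rewrite [X in _ + X](_ : _ = 0) ?addr0 // /gconv /Rintegral (eq_integral (cst 0%E)) ?integral0 // => w _.
by rewrite sympl_etr mulr0 mul0r.
Qed.

Lemma Rintegral_sum8 (c : R) (p1 p2 p3 p4 p5 p6 p7 p8 : G R -> R) :
  L1 p1 -> L1 p2 -> L1 p3 -> L1 p4 -> L1 p5 -> L1 p6 -> L1 p7 -> L1 p8 ->
  I7 (fun w => p1 w + p2 w + p3 w + p4 w + c * p5 w + c * p6 w + (2 * c) * p7 w + c ^+ 2 * p8 w) =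
  I7 p1 + I7 p2 + I7 p3 + I7 p4 + c * I7 p5 + c * I7 p6 + (2 * c) * I7 p7 + c ^+ 2 * I7 p8.
Proof.
move=> j1 j2 j3 j4 j5 j6 j7 j8.
have s5 := integrable_scale c j5; have s6 := integrable_scale c j6.
have s7 := integrable_scale (2 * c) j7; have s8 := integrable_scale (c ^+ 2) j8.
have AD (p q : G R -> R) : L1 p -> L1 q -> L1 (fun g => p g + q g).
  by move=> ip iq; exact: (integrableD measurableT ip iq).
have a2 := AD _ _ j1 j2; have a3 := AD _ _ a2 j3; have a4 := AD _ _ a3 j4.
have a5 := AD _ _ a4 s5; have a6 := AD _ _ a5 s6; have a7 := AD _ _ a6 s7.
by rewrite (RintegralD_ a7 s8) (RintegralD_ a6 s7) (RintegralD_ a5 s6) (RintegralD_ a4 s5)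
  (RintegralD_ a3 j4) (RintegralD_ a2 j3) (RintegralD_ j1 j2)
  (RintegralZ_ _ j5) (RintegralZ_ _ j6) (RintegralZ_ _ j7) (RintegralZ_ _ j8).
Qed.

Lemma fld2_ldiv_expand (k c e a b p q : R) :
  k * a + k * c * b + k * c * p + k * c * c * q + e * (k * b) + e * (k * p)
  + 2 * e * (k * c * q) + e ^+ 2 * (k * q) =
  k * (a + (c + e) * b + (c + e) * p + (c + e) ^+ 2 * q).
Proof. by ring. Qed.

Lemma gconv_expand (S0 S1 S2 S3 S4 S5 S6 S7 S8 c : R) :
  S1 + S2 + (S3 + S4) + (c * (S6 + S7) + S0 * 0) + c * (S5 + S7 + (c * S8 + S0 * 0)) =
  S1 + S2 + S3 + S4 + c * S5 + c * S6 + 2 * c * S7 + c ^+ 2 * S8.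
Proof. by ring. Qed.

(** gconv_derive, twice; the coefficient sympl g v of the field does not depend
    on w and recombines with the coefficient sympl w v under the integral. *)
Lemma fld2_right v k f g : locint k -> Coo f -> bsupp f ->
  fld2 v (gconv k f) g = I7 (fun w => k w * fld2_ldiv v f w g).
Proof.
move=> lk cf bf; have cv := Coo_D v cf; have ct := Coo_D (et R) cf.
have bv := bsupp_derive v bf; have bt := bsupp_derive (et R) bf.
have lkc := locint_sympl v lk; have lkcc := locint_sympl v lkc.
have cvv := Coo_D v cv; have ctv := Coo_D (et R) cv; have cvt := Coo_D v ct; have ctt := Coo_D (et R) ct.
have bvv := bsupp_derive v bv; have btv := bsupp_derive (et R) bv.
have bvt := bsupp_derive v bt; have btt := bsupp_derive (et R) bt.
have E : fld v (gconv k f) =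
   fun y => gconv k ('D_v f) y + gconv (fun w => k w * sympl w v) ('D_(et R) f) y + sympl y v * gconv k ('D_(et R) f) y.
  apply/funext => u; rewrite /fld (is_deriveE (gconv_derive u v lk cf bf)).
  by rewrite (is_deriveE (gconv_derive_t u lk cf bf)).
have D1 := dD (dD (gconv_derive g v lk cv bv) (gconv_derive g v lkc ct bt))
   (dM (sympl_derive v v g) (gconv_derive g v lk ct bt)).
have D2 := dD (dD (gconv_derive_t g lk cv bv) (gconv_derive_t g lkc ct bt))
   (dM (sympl_derive v (et R) g) (gconv_derive_t g lk ct bt)).
rewrite /fld2 E /fld (is_deriveE D1) (is_deriveE D2) symplvv sympl_etl.
have J k' h := fun l c b => @gconv_integrable R k' h g l c b.
have j1 := J _ _ lk cvv bvv; have j2 := J _ _ lkc ctv btv; have j3 := J _ _ lkc cvt bvt.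
have j4 := J _ _ lkcc ctt btt; have j5 := J _ _ lk ctv btv; have j6 := J _ _ lk cvt bvt.
have j7 := J _ _ lkc ctt btt; have j8 := J _ _ lk ctt btt.
apply: (etrans (gconv_expand _ _ _ _ _ _ _ _ _ _)).
apply: (etrans (esym (Rintegral_sum8 (sympl g v) j1 j2 j3 j4 j5 j6 j7 j8))).
by congr (Rintegral _ _ _); apply/funext => w; exact: fld2_ldiv_expand.
Qed.

Lemma Coo_left f g : Coo f -> Coo (fun w => f (ldiv w g)).
Proof.
move=> cf; apply: (@Coo_affine R _ f (fun w => ldiv w g) (fun v => - v - sympl g v *: et R)) => //.
  exact: ldiv_continuous.
by move=> h u v; exact: ldiv_affine_l.
Qed.

Lemma bsupp_left f g : Coo f -> bsupp f -> bsupp (fun w => f (ldiv w g)).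
Proof.
move=> cf bf; have [C [M [C0 M0 H]]] := ldiv_supp cf bf (normr_ge0 g).
exists M => w Mw; have := H w g (lexx _); rewrite cube_indE01 (lt_geF Mw) mulr0.
by rewrite normr_le0 => /eqP.
Qed.

(** Move L from g to w under the integral and use [N_pairing] for the function
    w |-> f (w^-1 g), whose value at w = 0 is f (g). *)
Lemma L_gconv f g : Coo f -> bsupp f -> L (gconv (@N R) f) g = f g.
Proof.
move=> cf bf; have cl := Coo_left g cf; have bl := bsupp_left g cf bf.
rewrite -[in RHS](ldiv_axis0 g) -(N_pairing cl bl).
have E v : I7 (fun w => N w * fld2_ldiv v f w g) = I7 (fun w => N w * fld2 v (fun w => f (ldiv w g)) w).
  by congr (Rintegral _ _ _); apply/funext => w; rewrite fld2_left.
have I v : L1 (fun w => N w * fld2 v (fun w => f (ldiv w g)) w).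
  by apply: integrable_N_mul; [apply/Coo_cont/Coo_fld2|exact: bsupp_fld2].
have FR v : fld2 v (gconv (@N R) f) g =
    I7 (fun w => N w * fld2 v (fun w => f (ldiv w g)) w).
  by rewrite fld2_right ?E //; exact: N_locint.
rewrite /L (FR (e1 R)) (FR (e2 R)) (FR (e3 R)) (FR (e4 R)) (FR (e5 R)) (FR (e6 R)) -mulNr.
rewrite -Rintegral_sum6; [|exact: I..].
congr (Rintegral _ _ _); apply/funext => w; rewrite /L.
move: (fld2 _ _ _) (fld2 _ _ _) (fld2 _ _ _) (fld2 _ _ _) (fld2 _ _ _) (fld2 _ _ _) (N w) => *.
by ring.
Qed.

End inversion.

(** * From L to the complex operators *)

Section bridge.
Context (R : realType).
Implicit Types (g v w : G R) (f h : G R -> R) (j : 'I_3).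
Notation L1 f := ((@hm R).-integrable setT (EFin \o f)).
Notation I7 f := (Rintegral (@hm R) setT f).

Lemma smooth_real_Coo f : smooth_real f -> Coo f.
Proof.
move=> sf n; rewrite -[f]/(iter_derive [::] f); elim: n [::] => [|n IH] vs.
  by split=> //; have [] := sf vs.
split; first by have [] := sf vs.
move=> v; split; first by move=> y; have [_ H] := sf vs; exact: H.
exact: (IH (v :: vs)).
Qed.

Lemma Coo_smooth_real f : Coo f -> smooth_real f.
Proof.
move=> cf vs; have C : Coo (iter_derive vs f) by elim: vs => //= v vs IH; exact: Coo_D.
by split; [exact: Coo_cont|move=> v g; exact: Coo_derivable].
Qed.

(** A complex function by its real and imaginary part, on which the complex
    operators act through real ones. *)
Definition cpair (f1 f2 : G R -> R) g : R[i] := f1 g +i* f2 g.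

Lemma cpairE (F : G R -> R[i]) : F = cpair (fun g => complex.Re (F g)) (fun g => complex.Im (F g)).
Proof. by apply/funext => g; rewrite /cpair; case: (F g). Qed.

Definition test_pair (f1 f2 : G R -> R) := [/\ Coo f1, Coo f2, bsupp f1 & bsupp f2].

Lemma test_fun_pair (F : G R -> R[i]) : test_fun F ->
  test_pair (fun g => complex.Re (F g)) (fun g => complex.Im (F g)).
Proof.
move=> [[s1 s2] cF]; have [M M0 HM] := compact_cube_bound cF.
have z g : M < `|g| -> F g = 0.
  move=> Mg; apply/eqP; apply: contraT => nz.
  have : closure [set g | F g != 0] g by exact: subset_closure.
  by move=> /HM /normG_le; rewrite leNgt Mg.
split; [exact: smooth_real_Coo|exact: smooth_real_Coo| |].
  by exists M => g /z ->.
by exists M => g /z ->.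
Qed.

Definition vx j : G R := pt (fun k => if k == j then 1 else 0) 0.
Definition vy j : G R := pt (fun k => if k == j then 'i%C else 0) 0.

Lemma I3P j : [\/ j = 0, j = 1 | j = 2].
Proof.
case: j => -[|[|[|//]]] ij; [apply: Or31|apply: Or32|apply: Or33]; exact/val_inj.
Qed.

Lemma vE : [/\ [/\ vx 0 = e1 R, vy 0 = e2 R & vx 1 = e3 R], vy 1 = e4 R, vx 2 = e5 R & vy 2 = e6 R].
Proof. by []. Qed.

Lemma etE : pt (fun=> 0) 1 = et R. Proof. by []. Qed.

Lemma sympl_vx g j : sympl g (vx j) = - (2 * (sigma R j * complex.Im (zc g j))).
Proof.
case: g => [[[[[[x1 y1] x2] y2] x3] y3] t].
by case: (I3P j) => ->; rewrite /sympl /sigma ?zc0 ?zc1 ?zc2 /=; ring.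
Qed.

Lemma sympl_vy g j : sympl g (vy j) = 2 * (sigma R j * complex.Re (zc g j)).
Proof.
case: g => [[[[[[x1 y1] x2] y2] x3] y3] t].
by case: (I3P j) => ->; rewrite /sympl /sigma ?zc0 ?zc1 ?zc2 /=; ring.
Qed.

Definition XF j := fld (vx j).
Definition YF j := fld (vy j).

Lemma half_complex : (2^-1 : R[i]) = (2^-1 : R)%:C.
Proof. by rewrite fmorphV rmorph_nat. Qed.

Lemma ZcoefE j g : Zcoef j g = (- 2^-1 * sympl g (vx j)) +i* (2^-1 * sympl g (vy j)).
Proof.
rewrite /Zcoef sympl_vx sympl_vy; case: (zc g j) => x y /=; simpc.
by congr (_ +i* _); field.
Qed.

Lemma ZbarcoefE j g : Zbarcoef j g = (2^-1 * sympl g (vx j)) +i* (2^-1 * sympl g (vy j)).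
Proof.
rewrite /Zbarcoef sympl_vx sympl_vy; case: (zc g j) => x y /=; simpc.
by congr (_ +i* _); field.
Qed.

Lemma dvE v (f1 f2 : G R -> R) g : dv v (cpair f1 f2) g = 'D_v f1 g +i* 'D_v f2 g.
Proof. by []. Qed.

Lemma dzE j f1 f2 g : dz j (cpair f1 f2) g =
  (2^-1 * ('D_(vx j) f1 g + 'D_(vy j) f2 g)) +i* (2^-1 * ('D_(vx j) f2 g - 'D_(vy j) f1 g)).
Proof.
rewrite /dz /dx /dy -/(vx j) -/(vy j) !dvE half_complex.
by move: ('D_(vx j) _ _) ('D_(vy j) _ _) ('D_(vx j) _ _) ('D_(vy j) _ _) => a b c d; simpc; congr (_ +i* _); ring.
Qed.

Lemma dzbarE j f1 f2 g : dzbar j (cpair f1 f2) g =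
  (2^-1 * ('D_(vx j) f1 g - 'D_(vy j) f2 g)) +i* (2^-1 * ('D_(vx j) f2 g + 'D_(vy j) f1 g)).
Proof.
rewrite /dzbar /dx /dy -/(vx j) -/(vy j) !dvE half_complex.
by move: ('D_(vx j) _ _) ('D_(vy j) _ _) ('D_(vx j) _ _) ('D_(vy j) _ _) => a b c d; simpc; congr (_ +i* _); ring.
Qed.

(** Real and imaginary part of Z_j and Zbar_j in terms of the right-invariant
    fields X_j and Y_j: Z_j = (X_j - i Y_j) / 2 and Zbar_j = (X_j + i Y_j) / 2. *)
Definition Zr j f1 f2 g := 2^-1 * (XF j f1 g + YF j f2 g).
Definition Zi j f1 f2 g := 2^-1 * (XF j f2 g - YF j f1 g).
Definition Br j f1 f2 g := 2^-1 * (XF j f1 g - YF j f2 g).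
Definition Bi j f1 f2 g := 2^-1 * (XF j f2 g + YF j f1 g).

Lemma ZE j f1 f2 : Z j (cpair f1 f2) = cpair (Zr j f1 f2) (Zi j f1 f2).
Proof.
apply/funext => g; rewrite /Z dzE ZcoefE /dt etE dvE /cpair /Zr /Zi /XF /YF /fld.
move: ('D_(et R) f1 g) ('D_(et R) f2 g) (sympl g (vx j)) (sympl g (vy j)) => p q m n.
by move: ('D_(vx j) f1 g) ('D_(vy j) f1 g) ('D_(vx j) f2 g) ('D_(vy j) f2 g) => a b c d; simpc; congr (_ +i* _); ring.
Qed.

Lemma ZbarE j f1 f2 : Zbar j (cpair f1 f2) = cpair (Br j f1 f2) (Bi j f1 f2).
Proof.
apply/funext => g; rewrite /Zbar dzbarE ZbarcoefE /dt etE dvE /cpair /Br /Bi /XF /YF /fld.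
move: ('D_(et R) f1 g) ('D_(et R) f2 g) (sympl g (vx j)) (sympl g (vy j)) => p q m n.
by move: ('D_(vx j) f1 g) ('D_(vy j) f1 g) ('D_(vx j) f2 g) ('D_(vy j) f2 g) => a b c d; simpc; congr (_ +i* _); ring.
Qed.

Lemma Coo_lc (a b : R) f h : Coo f -> Coo h -> Coo (fun g => a * f g + b * h g).
Proof. by move=> cf ch; apply: CooD; apply: (CooM (Coo_cst _ _)). Qed.

Lemma bsupp_lc (a b : R) f h : bsupp f -> bsupp h -> bsupp (fun g => a * f g + b * h g).
Proof. by move=> bf bh; apply: (bsuppD (f := fun g => a * f g)); [exact: (bsuppMr (fun=> a))|exact: (bsuppMr (fun=> b))]. Qed.

Lemma Coo_XF j f : Coo f -> Coo (XF j f). Proof. exact: Coo_fld. Qed.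
Lemma Coo_YF j f : Coo f -> Coo (YF j f). Proof. exact: Coo_fld. Qed.

Lemma halfD (a b : R) : 2^-1 * (a + b) = 2^-1 * a + 2^-1 * b. Proof. by rewrite mulrDr. Qed.
Lemma halfB (a b : R) : 2^-1 * (a - b) = 2^-1 * a + (- 2^-1) * b. Proof. by rewrite mulrBr mulNr. Qed.

Lemma Coo_Z j f1 f2 : Coo f1 -> Coo f2 ->
  [/\ Coo (Zr j f1 f2), Coo (Zi j f1 f2), Coo (Br j f1 f2) & Coo (Bi j f1 f2)].
Proof.
move=> k1 k2; have x1 := Coo_XF j k1; have x2 := Coo_XF j k2.
have y1 := Coo_YF j k1; have y2 := Coo_YF j k2.
split; rewrite /Zr /Zi /Br /Bi;
  [under eq_fun do rewrite halfD|under eq_fun do rewrite halfB|under eq_fun do rewrite halfB|under eq_fun do rewrite halfD]; exact: Coo_lc.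
Qed.

Lemma bsupp_Z j f1 f2 : bsupp f1 -> bsupp f2 ->
  [/\ bsupp (Zr j f1 f2), bsupp (Zi j f1 f2), bsupp (Br j f1 f2) & bsupp (Bi j f1 f2)].
Proof.
move=> k1 k2; have x1 : bsupp (XF j f1) by exact: bsupp_fld.
have x2 : bsupp (XF j f2) by exact: bsupp_fld.
have y1 : bsupp (YF j f1) by exact: bsupp_fld.
have y2 : bsupp (YF j f2) by exact: bsupp_fld.
split; rewrite /Zr /Zi /Br /Bi;
  [under eq_fun do rewrite halfD|under eq_fun do rewrite halfB|under eq_fun do rewrite halfB|under eq_fun do rewrite halfD]; exact: bsupp_lc.
Qed.

Lemma test_pair_Z j f1 f2 : test_pair f1 f2 -> test_pair (Zr j f1 f2) (Zi j f1 f2) /\ test_pair (Br j f1 f2) (Bi j f1 f2).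
Proof.
move=> [k1 k2 b1 b2]; have [? ? ? ?] := Coo_Z j k1 k2; have [? ? ? ?] := bsupp_Z j b1 b2.
by split.
Qed.

(** Only the coefficients contribute, since D_v and D_t commute. *)
Lemma fld_comm v u f g : Coo f ->
  fld v (fld u f) g - fld u (fld v f) g =
  2 * sympl v u * 'D_(et R) f g.
Proof.
move=> cf; have ct := Coo_D (et R) cf.
have D a b : is_derive g b (fld a f)
    ('D_b ('D_a f) g + (sympl g a * 'D_b ('D_(et R) f) g + 'D_(et R) f g * sympl b a)).
  have ca := Coo_D a cf.
  exact: (dD (Coo_is_derive b g ca) (dM (sympl_derive a b g) (Coo_is_derive b g ct))).
have s a b := @derive_sym _ _ f g a b (Coo_C1 cf) (Coo_C1 (Coo_D a cf)) (Coo_C1 (Coo_D b cf)).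
rewrite {1}/fld (is_deriveE (D u v)) (is_deriveE (D u (et R))).
rewrite {1}/fld (is_deriveE (D v u)) (is_deriveE (D v (et R))).
have := s v u; have := s u (et R); have := s v (et R); rewrite !sympl_etl (symplC u v).
generalize ('D_u ('D_v f) g), ('D_v ('D_u f) g), ('D_u ('D_(et R) f) g), ('D_v ('D_(et R) f) g),
  ('D_(et R) ('D_u f) g), ('D_(et R) ('D_v f) g), ('D_(et R) ('D_(et R) f) g), ('D_(et R) f g).
by move=> a1 a2 a3 a4 a5 a6 a7 a8 -> -> ->; ring.
Qed.

Lemma fld_lc v (a b : R) f h g : Coo f -> Coo h ->
  fld v (fun g => a * f g + b * h g) g =
  a * fld v f g + b * fld v h g.
Proof.
move=> cf ch; have D u : is_derive g u (fun g => a * f g + b * h g) (a * 'D_u f g + b * 'D_u h g).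
  apply: (is_derive_conv (dD (dM (dcst a g u) (Coo_is_derive u g cf)) (dM (dcst b g u) (Coo_is_derive u g ch)))).
  by rewrite !mulr0 !addr0.
rewrite /fld (is_deriveE (D v)) (is_deriveE (D (et R))).
by move: ('D_v f g) ('D_v h g) ('D_(et R) f g) ('D_(et R) h g) => *; ring.
Qed.

(** The square X_j^2 + Y_j^2, which is 2 (Z_j Zbar_j + Zbar_j Z_j). *)
Definition sumsq j f g := fld2 (vx j) f g + fld2 (vy j) f g.
(** The coefficient of D_t in [X_j, Y_j], which is 4 sigma_j. *)
Definition bracket_coef j : R := 2 * sympl (vx j) (vy j).

Lemma ZB_values j f1 f2 g : Coo f1 -> Coo f2 ->
  [/\ Zr j (Br j f1 f2) (Bi j f1 f2) g = 4^-1 * (sumsq j f1 g - bracket_coef j * 'D_(et R) f2 g),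
      Zi j (Br j f1 f2) (Bi j f1 f2) g = 4^-1 * (sumsq j f2 g + bracket_coef j * 'D_(et R) f1 g),
      Br j (Zr j f1 f2) (Zi j f1 f2) g = 4^-1 * (sumsq j f1 g + bracket_coef j * 'D_(et R) f2 g) &
      Bi j (Zr j f1 f2) (Zi j f1 f2) g = 4^-1 * (sumsq j f2 g - bracket_coef j * 'D_(et R) f1 g)].
Proof.
move=> k1 k2; have x1 := Coo_XF j k1; have x2 := Coo_XF j k2.
have y1 := Coo_YF j k1; have y2 := Coo_YF j k2.
have E1 : Zr j f1 f2 = fun g => 2^-1 * XF j f1 g + 2^-1 * YF j f2 g by apply/funext => u; exact: halfD.
have E2 : Zi j f1 f2 = fun g => 2^-1 * XF j f2 g + (- 2^-1) * YF j f1 g by apply/funext => u; exact: halfB.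
have E3 : Br j f1 f2 = fun g => 2^-1 * XF j f1 g + (- 2^-1) * YF j f2 g by apply/funext => u; exact: halfB.
have E4 : Bi j f1 f2 = fun g => 2^-1 * XF j f2 g + 2^-1 * YF j f1 g by apply/funext => u; exact: halfD.
have c1' : XF j (YF j f1) g = YF j (XF j f1) g + bracket_coef j * 'D_(et R) f1 g.
  by rewrite addrC; apply/eqP; rewrite -subr_eq; apply/eqP; exact: fld_comm.
have c2' : XF j (YF j f2) g = YF j (XF j f2) g + bracket_coef j * 'D_(et R) f2 g.
  by rewrite addrC; apply/eqP; rewrite -subr_eq; apply/eqP; exact: fld_comm.
have lX a b f h : Coo f -> Coo h -> XF j (fun g => a * f g + b * h g) g = a * XF j f g + b * XF j h g.
  by move=> *; exact: fld_lc.
have lY a b f h : Coo f -> Coo h -> YF j (fun g => a * f g + b * h g) g = a * YF j f g + b * YF j h g.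
  by move=> *; exact: fld_lc.
have E5 f : sumsq j f g = XF j (XF j f) g + YF j (YF j f) g by [].
rewrite !E5; move: (bracket_coef j * 'D_(et R) f1 g) (bracket_coef j * 'D_(et R) f2 g) c1' c2' => d1 d2 c1' c2'.
split; [rewrite /Zr E3 E4|rewrite /Zi E3 E4|rewrite /Br E1 E2|rewrite /Bi E1 E2];
  rewrite lX // lY // ?c1' ?c2';
  move: (XF j (XF j f1) g) (XF j (XF j f2) g) (YF j (YF j f1) g) (YF j (YF j f2) g) (YF j (XF j f1) g) (YF j (XF j f2) g) => *;
  by field.
Qed.

Lemma bracket_coefE : [/\ bracket_coef 0 = 4, bracket_coef 1 = 4 & bracket_coef 2 = 0].
Proof. by rewrite /bracket_coef; have [[-> -> ->] -> -> ->] := vE; rewrite /sympl /=; split; ring. Qed.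

Lemma L_sumsq f g : L f g = - (4^-1 * (sumsq 0 f g + sumsq 1 f g + sumsq 2 f g)).
Proof.
have A (a b c d e h : R) : a + b + c + d + e + h = a + b + (c + d) + (e + h) by rewrite !addrA.
congr (- (_ * _)); exact: (A (fld2 (e1 R) f g) (fld2 (e2 R) f g) (fld2 (e3 R) f g)
  (fld2 (e4 R) f g) (fld2 (e5 R) f g) (fld2 (e6 R) f g)).
Qed.

(** For k < 2, the difference D_k - D_(1-k) - D_2 is 0. *)
Lemma box_algebra (S D : 'I_3 -> R[i]) (k : 'I_3) : (k < 2)%N -> D 0 = D 1 -> D 2 = 0 ->
  - 2^-1 * (\sum_(j < 3) S j) + 2^-1 * (D k - \sum_(j < 3 | j != k) D j) =
  - 2^-1 * (S 0 + S 1 + S 2).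
Proof.
move=> k2 D01 D20; rewrite sum3 -[RHS]addr0; congr (_ + _).
rewrite [X in D k - X](_ : _ = D 1); last first.
  by rewrite big_mkcond sum3; case: (I3P k) k2 => -> //= _; rewrite ?D01 D20 ?addr0 ?add0r.
by case: (I3P k) k2 => -> // _; rewrite ?D01 subrr mulr0.
Qed.

(** Stated for an arbitrary pair of operators, because it is used both for the
    operators on functions and for their transposes on distributions. *)
Lemma box_expr_values (T : Type) (A B : 'I_3 -> (T -> R[i]) -> T -> R[i]) (k : 'I_3)
    (u : T -> R[i]) (x : T) (p q : 'I_3 -> R) (r s : R) : (k < 2)%N ->
  (forall j, A j (B j u) x = (4^-1 * (p j - bracket_coef j * s)) +i* (4^-1 * (q j + bracket_coef j * r))) ->
  (forall j, B j (A j u) x = (4^-1 * (p j + bracket_coef j * s)) +i* (4^-1 * (q j - bracket_coef j * r))) ->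
  box_expr A B k u x = (- (4^-1 * (p 0 + p 1 + p 2))) +i* (- (4^-1 * (q 0 + q 1 + q 2))).
Proof.
move=> k2 hA hB; rewrite /box_expr.
have SE j : B j (A j u) x + A j (B j u) x = (2^-1 * p j) +i* (2^-1 * q j).
  by rewrite hA hB; move: (p j) (q j) (bracket_coef j) => a b c; simpc; congr (_ +i* _); field.
have DE j : A j (B j u) x - B j (A j u) x = (- (2^-1 * (bracket_coef j * s))) +i* (2^-1 * (bracket_coef j * r)).
  by rewrite hA hB; move: (p j) (q j) (bracket_coef j) => a b c; simpc; congr (_ +i* _); field.
have [K0 K1 K2] := bracket_coefE.
under eq_bigr do rewrite SE.
under [X in _ - X]eq_bigr do rewrite DE.
rewrite DE; apply: (etrans (@box_algebra (fun j => (2^-1 * p j) +i* (2^-1 * q j))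
  (fun j => (- (2^-1 * (bracket_coef j * s))) +i* (2^-1 * (bracket_coef j * r))) k k2 _ _)).
- by rewrite K0 K1.
- by rewrite K2 !mul0r !mulr0 oppr0.
rewrite half_complex; move: (p 0) (p 1) (p 2) (q 0) (q 1) (q 2) => a b c d e f.
by simpc; congr (_ +i* _); field.
Qed.

Lemma box_cpair (k : 'I_3) f1 f2 : (k < 2)%N -> Coo f1 -> Coo f2 ->
  box k (cpair f1 f2) = cpair (L f1) (L f2).
Proof.
move=> k2 h1 h2; apply/funext => g.
apply: (etrans (@box_expr_values _ (@Z R) (@Zbar R) k (cpair f1 f2) g (fun j => sumsq j f1 g)
  (fun j => sumsq j f2 g) ('D_(et R) f1 g) ('D_(et R) f2 g) k2 _ _)) => [j|j|].
- by rewrite ZbarE ZE /cpair; have [-> -> _ _] := ZB_values j g h1 h2.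
- by rewrite ZE ZbarE /cpair; have [_ _ -> ->] := ZB_values j g h1 h2.
by rewrite /cpair !L_sumsq.
Qed.

(** The transposed operators of the definition split into several terms;
    additivity of the functional puts them together again. *)
Definition lin (T : functional R) := forall f1 f2 h1 h2, test_pair f1 f2 -> test_pair h1 h2 ->
  T (cpair (fun g => f1 g + h1 g) (fun g => f2 g + h2 g)) = T (cpair f1 f2) + T (cpair h1 h2).

Lemma coef_derive (p q : R) f1 f2 v u g : Coo f1 -> Coo f2 ->
  'D_(et R) (fun g => (p * sympl g v) * f1 g + (q * sympl g u) * f2 g) g =
  (p * sympl g v) * 'D_(et R) f1 g + (q * sympl g u) * 'D_(et R) f2 g.
Proof.
move=> h1 h2.
have K (r : R) w : is_derive g (et R) (fun g => r * sympl g w) 0.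
  by apply: (is_derive_conv (dM (dcst r g (et R)) (sympl_derive w (et R) g))); rewrite sympl_etl !mulr0 addr0.
have D := dD (dM (K p v) (Coo_is_derive (et R) g h1)) (dM (K q u) (Coo_is_derive (et R) g h2)).
by rewrite (is_deriveE D) !mulr0 !addr0.
Qed.

Definition Cr j (s : R) f1 f2 g := (s * sympl g (vx j)) * 'D_(et R) f1 g + (- 2^-1 * sympl g (vy j)) * 'D_(et R) f2 g.
Definition Ci j (s : R) f1 f2 g := (s * sympl g (vx j)) * 'D_(et R) f2 g + (2^-1 * sympl g (vy j)) * 'D_(et R) f1 g.

Lemma dtZcoef j f1 f2 : Coo f1 -> Coo f2 ->
  dt (fun g => Zcoef j g * cpair f1 f2 g) = cpair (Cr j (- 2^-1) f1 f2) (Ci j (- 2^-1) f1 f2).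
Proof.
move=> h1 h2; have -> : (fun g => Zcoef j g * cpair f1 f2 g) =
  cpair (fun g => (- 2^-1 * sympl g (vx j)) * f1 g + (- 2^-1 * sympl g (vy j)) * f2 g)
     (fun g => (- 2^-1 * sympl g (vx j)) * f2 g + (2^-1 * sympl g (vy j)) * f1 g).
  apply/funext => g; rewrite ZcoefE /cpair.
  by move: (f1 g) (f2 g) (sympl g _) (sympl g _) => *; simpc; congr (_ +i* _); ring.
by apply/funext => g; rewrite /dt etE dvE !coef_derive.
Qed.

Lemma dtZbarcoef j f1 f2 : Coo f1 -> Coo f2 ->
  dt (fun g => Zbarcoef j g * cpair f1 f2 g) = cpair (Cr j 2^-1 f1 f2) (Ci j 2^-1 f1 f2).
Proof.
move=> h1 h2; have -> : (fun g => Zbarcoef j g * cpair f1 f2 g) =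
  cpair (fun g => (2^-1 * sympl g (vx j)) * f1 g + (- 2^-1 * sympl g (vy j)) * f2 g)
     (fun g => (2^-1 * sympl g (vx j)) * f2 g + (2^-1 * sympl g (vy j)) * f1 g).
  apply/funext => g; rewrite ZbarcoefE /cpair.
  by move: (f1 g) (f2 g) (sympl g _) (sympl g _) => *; simpc; congr (_ +i* _); ring.
by apply/funext => g; rewrite /dt etE dvE !coef_derive.
Qed.

Lemma test_pair_C j s f1 f2 : test_pair f1 f2 -> test_pair (Cr j s f1 f2) (Ci j s f1 f2).
Proof.
move=> [h1 h2 b1 b2].
have c (r : R) v f : Coo f -> Coo (fun g => (r * sympl g v) * 'D_(et R) f g).
  by move=> cf; apply: CooM; [apply: (CooM (Coo_cst _ _)); exact: Coo_sympl|exact: Coo_D].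
have b (r : R) v f : bsupp f -> bsupp (fun g => (r * sympl g v) * 'D_(et R) f g).
  by move=> bf; apply: (bsuppMr (fun g => r * sympl g v)); exact: bsupp_derive.
by split; [apply: CooD; exact: c|apply: CooD; exact: c|apply: bsuppD; exact: b|apply: bsuppD; exact: b].
Qed.

(** The transpose of Z_j is - Z_j, since the coefficient of d/dt does not
    depend on t. *)
Lemma dZ_lin j (T : functional R) f1 f2 : lin T -> test_pair f1 f2 ->
  dZ j T (cpair f1 f2) = - T (Z j (cpair f1 f2)).
Proof.
move=> lT nf; have [h1 h2 b1 b2] := nf; have [nZ _] := test_pair_Z j nf.
have nC := test_pair_C j (- 2^-1) nf.
rewrite /dZ /ddz /dmul /ddt dtZcoef // ZE opprK.
have -> : dz j (cpair f1 f2) = cpair (fun g => Zr j f1 f2 g + Cr j (- 2^-1) f1 f2 g)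
    (fun g => Zi j f1 f2 g + Ci j (- 2^-1) f1 f2 g).
  apply/funext => g; rewrite dzE /cpair /Zr /Zi /Cr /Ci /XF /YF /fld.
  move: ('D_(et R) f1 g) ('D_(et R) f2 g) (sympl g (vx j)) (sympl g (vy j)) => p q m n.
  by move: ('D_(vx j) f1 g) ('D_(vy j) f1 g) ('D_(vx j) f2 g) ('D_(vy j) f2 g) => a b c d; congr (_ +i* _); ring.
by rewrite lT // opprD subrK.
Qed.

Lemma dZbar_lin j (T : functional R) f1 f2 : lin T -> test_pair f1 f2 ->
  dZbar j T (cpair f1 f2) = - T (Zbar j (cpair f1 f2)).
Proof.
move=> lT nf; have [h1 h2 b1 b2] := nf; have [_ nB] := test_pair_Z j nf.
have nC := test_pair_C j 2^-1 nf.
have nD : test_pair (fun g => 2^-1 * ('D_(vx j) f1 g - 'D_(vy j) f2 g)) (fun g => 2^-1 * ('D_(vx j) f2 g + 'D_(vy j) f1 g)).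
  have p1 := Coo_D (vx j) h1; have p2 := Coo_D (vy j) h1.
  have p3 := Coo_D (vx j) h2; have p4 := Coo_D (vy j) h2.
  have q1 := bsupp_derive (vx j) b1; have q2 := bsupp_derive (vy j) b1.
  have q3 := bsupp_derive (vx j) b2; have q4 := bsupp_derive (vy j) b2.
  have -> : (fun g => 2^-1 * ('D_(vx j) f1 g - 'D_(vy j) f2 g)) =
    fun g => 2^-1 * 'D_(vx j) f1 g + (- 2^-1) * 'D_(vy j) f2 g by apply/funext => g; exact: halfB.
  have -> : (fun g => 2^-1 * ('D_(vx j) f2 g + 'D_(vy j) f1 g)) =
    fun g => 2^-1 * 'D_(vx j) f2 g + 2^-1 * 'D_(vy j) f1 g by apply/funext => g; exact: halfD.
  split; [exact: (Coo_lc 2^-1 (- 2^-1) p1 p4)|exact: (Coo_lc 2^-1 2^-1 p3 p2)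
    |exact: (bsupp_lc 2^-1 (- 2^-1) q1 q4)|exact: (bsupp_lc 2^-1 2^-1 q3 q2)].
rewrite /dZbar /ddzbar /dmul /ddt dtZbarcoef // ZbarE.
have -> : cpair (Br j f1 f2) (Bi j f1 f2) =
   cpair (fun g => 2^-1 * ('D_(vx j) f1 g - 'D_(vy j) f2 g) + Cr j 2^-1 f1 f2 g)
      (fun g => 2^-1 * ('D_(vx j) f2 g + 'D_(vy j) f1 g) + Ci j 2^-1 f1 f2 g).
  apply/funext => g; rewrite /cpair /Br /Bi /Cr /Ci /XF /YF /fld.
  move: ('D_(et R) f1 g) ('D_(et R) f2 g) (sympl g (vx j)) (sympl g (vy j)) => p q m n.
  by move: ('D_(vx j) f1 g) ('D_(vy j) f1 g) ('D_(vx j) f2 g) ('D_(vy j) f2 g) => a b c d; congr (_ +i* _); ring.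
rewrite (lT _ _ _ _ nD nC) opprD; congr (- T _ + _); apply/funext => g; exact: dzbarE.
Qed.

Lemma fldD v f h g : Coo f -> Coo h ->
  fld v (fun g => f g + h g) g = fld v f g + fld v h g.
Proof.
move=> cf ch; have D u := dD (Coo_is_derive u g cf) (Coo_is_derive u g ch).
rewrite /fld (is_deriveE (D v)) (is_deriveE (D (et R))).
by move: ('D_v f g) ('D_v h g) ('D_(et R) f g) ('D_(et R) h g) => *; ring.
Qed.

Lemma lin_dZ j (T : functional R) : lin T -> lin (dZ j T) /\ lin (dZbar j T).
Proof.
move=> lT; split=> f1 f2 h1 h2 nf nh.
  have [cf1 cf2 bf1 bf2] := nf; have [ch1 ch2 bh1 bh2] := nh.
  have ns : test_pair (fun g => f1 g + h1 g) (fun g => f2 g + h2 g).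
    by split; [exact: CooD|exact: CooD|exact: bsuppD|exact: bsuppD].
  rewrite !dZ_lin // !ZE -opprD -lT; [|exact: (test_pair_Z j nf).1|exact: (test_pair_Z j nh).1].
  congr (- T _); apply/funext => g; rewrite /cpair /Zr /Zi /XF /YF !fldD //.
  by move: (fld _ _ _) (fld _ _ _) (fld _ _ _) (fld _ _ _) (fld _ _ _) (fld _ _ _) (fld _ _ _) (fld _ _ _) => *; congr (_ +i* _); ring.
have [cf1 cf2 bf1 bf2] := nf; have [ch1 ch2 bh1 bh2] := nh.
have ns : test_pair (fun g => f1 g + h1 g) (fun g => f2 g + h2 g).
  by split; [exact: CooD|exact: CooD|exact: bsuppD|exact: bsuppD].
rewrite !dZbar_lin // !ZbarE -opprD -lT; [|exact: (test_pair_Z j nf).2|exact: (test_pair_Z j nh).2].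
congr (- T _); apply/funext => g; rewrite /cpair /Br /Bi /XF /YF !fldD //.
by move: (fld _ _ _) (fld _ _ _) (fld _ _ _) (fld _ _ _) (fld _ _ _) (fld _ _ _) (fld _ _ _) (fld _ _ _) => *; congr (_ +i* _); ring.
Qed.

Notation TN := (functional_of (@N R)).

Lemma TNE f1 f2 : TN (cpair f1 f2) = I7 (fun g => N g * f1 g) +i* I7 (fun g => N g * f2 g).
Proof.
rewrite /functional_of intGE; congr (_ +i* _); congr (Rintegral _ _ _); apply/funext => g; rewrite /cpair /=.
  by rewrite mul0r subr0.
by rewrite mul0r addr0.
Qed.

Lemma integrable_N_test f : Coo f -> bsupp f -> L1 (fun g => N g * f g).
Proof. by move=> cf bf; apply: integrable_N_mul => //; exact: Coo_cont. Qed.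

Lemma lin_TN : lin TN.
Proof.
move=> f1 f2 h1 h2 [cf1 cf2 bf1 bf2] [ch1 ch2 bh1 bh2]; rewrite !TNE; simpc.
congr (_ +i* _); rewrite -RintegralD_; do ?[exact: integrable_N_test];
  by congr (Rintegral _ _ _); apply/funext => g; rewrite mulrDr.
Qed.

Lemma Coo_sumsq j f : Coo f -> Coo (sumsq j f).
Proof. by move=> cf; apply: CooD; exact: Coo_fld2. Qed.

Lemma bsupp_sumsq j f : bsupp f -> bsupp (sumsq j f).
Proof. by move=> bf; apply: bsuppD; exact: bsupp_fld2. Qed.

Lemma N_sumsq f : Coo f -> bsupp f ->
  - (4^-1 * (I7 (fun g => N g * sumsq 0 f g) + I7 (fun g => N g * sumsq 1 f g) + I7 (fun g => N g * sumsq 2 f g)))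
  = f (axis 0).
Proof.
move=> cf bf; rewrite -(N_pairing cf bf).
have i j := integrable_N_test (Coo_sumsq j cf) (bsupp_sumsq j bf).
have AD : L1 (fun g => N g * sumsq 0 f g + N g * sumsq 1 f g) by exact: (integrableD measurableT (i 0) (i 1)).
have AD2 : L1 (fun g => N g * sumsq 0 f g + N g * sumsq 1 f g + N g * sumsq 2 f g).
  exact: (integrableD measurableT AD (i 2)).
rewrite -(RintegralD_ (i 0) (i 1)) -(RintegralD_ AD (i 2)) -mulNr -(RintegralZ_ _ AD2).
congr (Rintegral _ _ _); apply/funext => g; rewrite L_sumsq.
by move: (sumsq 0 f g) (sumsq 1 f g) (sumsq 2 f g) (N g) => *; ring.
Qed.

Lemma pairing_values j (s : R) f h : Coo f -> bsupp f -> Coo h -> bsupp h ->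
  I7 (fun g => N g * (4^-1 * (sumsq j f g + s * h g))) =
  4^-1 * (I7 (fun g => N g * sumsq j f g) + s * I7 (fun g => N g * h g)).
Proof.
move=> cf bf ch bh; have i1 := integrable_N_test (Coo_sumsq j cf) (bsupp_sumsq j bf); have i2 := integrable_N_test ch bh.
have i3 := integrable_scale s i2.
have i4 : L1 (fun g => N g * sumsq j f g + s * (N g * h g)) by exact: (integrableD measurableT i1 i3).
rewrite -(RintegralZ_ s i2) -(RintegralD_ i1 i3) -(RintegralZ_ _ i4).
congr (Rintegral _ _ _); apply/funext => g.
by move: (sumsq j f g) (N g) (h g) => *; ring.
Qed.

Lemma dZ_dZbar_N j f1 f2 : test_pair f1 f2 ->
  dZ j (dZbar j TN) (cpair f1 f2) =
    (4^-1 * (I7 (fun g => N g * sumsq j f1 g) + bracket_coef j * I7 (fun g => N g * 'D_(et R) f2 g))) +i*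
    (4^-1 * (I7 (fun g => N g * sumsq j f2 g) + (- bracket_coef j) * I7 (fun g => N g * 'D_(et R) f1 g))).
Proof.
move=> nf; have [cf1 cf2 bf1 bf2] := nf; have [nZ nB] := test_pair_Z j nf.
have ct1 := Coo_D (et R) cf1; have ct2 := Coo_D (et R) cf2.
have bt1 := bsupp_derive (et R) bf1; have bt2 := bsupp_derive (et R) bf2.
have [l1 l2] := lin_dZ j lin_TN.
rewrite (dZ_lin j l2 nf) (ZE j f1 f2) (dZbar_lin j lin_TN nZ) opprK ZbarE TNE.
congr (_ +i* _).
  apply: (etrans _ (pairing_values j (bracket_coef j) cf1 bf1 ct2 bt2)).
  congr (Rintegral _ _ _); apply/funext => g; have [_ _ b1 b2] := ZB_values j g cf1 cf2.
  by rewrite b1.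
apply: (etrans _ (pairing_values j (- bracket_coef j) cf2 bf2 ct1 bt1)).
congr (Rintegral _ _ _); apply/funext => g; have [_ _ b1 b2] := ZB_values j g cf1 cf2.
by rewrite b2 mulNr.
Qed.

Lemma dZbar_dZ_N j f1 f2 : test_pair f1 f2 ->
  dZbar j (dZ j TN) (cpair f1 f2) =
    (4^-1 * (I7 (fun g => N g * sumsq j f1 g) + (- bracket_coef j) * I7 (fun g => N g * 'D_(et R) f2 g))) +i*
    (4^-1 * (I7 (fun g => N g * sumsq j f2 g) + bracket_coef j * I7 (fun g => N g * 'D_(et R) f1 g))).
Proof.
move=> nf; have [cf1 cf2 bf1 bf2] := nf; have [nZ nB] := test_pair_Z j nf.
have ct1 := Coo_D (et R) cf1; have ct2 := Coo_D (et R) cf2.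
have bt1 := bsupp_derive (et R) bf1; have bt2 := bsupp_derive (et R) bf2.
have [l1 l2] := lin_dZ j lin_TN.
rewrite (dZbar_lin j l1 nf) (ZbarE j f1 f2) (dZ_lin j lin_TN nB) opprK ZE TNE.
congr (_ +i* _).
  apply: (etrans _ (pairing_values j (- bracket_coef j) cf1 bf1 ct2 bt2)).
  congr (Rintegral _ _ _); apply/funext => g; have [b1 b2 _ _] := ZB_values j g cf1 cf2.
  by rewrite b1 mulNr.
apply: (etrans _ (pairing_values j (bracket_coef j) cf2 bf2 ct1 bt1)).
congr (Rintegral _ _ _); apply/funext => g; have [b1 b2 _ _] := ZB_values j g cf1 cf2.
by rewrite b2.
Qed.

(** The transposes reverse the order of Z_j and Zbar_j, which changes the sign
    of the brackets; by box_expr_values these cancel anyway. *)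
Lemma dbox_N (k : 'I_3) f1 f2 : (k < 2)%N -> test_pair f1 f2 ->
  dbox k TN (cpair f1 f2) = f1 (axis 0) +i* f2 (axis 0).
Proof.
move=> k2 nf; have [cf1 cf2 bf1 bf2] := nf.
have alg (K p q x y : R) :
    ((4^-1 * (p + K * x)) +i* (4^-1 * (q + (- K) * y)) =
     (4^-1 * (p - K * - x)) +i* (4^-1 * (q + K * - y))) *
    ((4^-1 * (p + (- K) * x)) +i* (4^-1 * (q + K * y)) =
     (4^-1 * (p + K * - x)) +i* (4^-1 * (q - K * - y))).
  by split; congr (_ +i* _); ring.
apply: (etrans (@box_expr_values _ (@dZ R) (@dZbar R) k TN (cpair f1 f2)
  (fun j => I7 (fun g => N g * sumsq j f1 g)) (fun j => I7 (fun g => N g * sumsq j f2 g))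
  (- I7 (fun g => N g * 'D_(et R) f1 g)) (- I7 (fun g => N g * 'D_(et R) f2 g)) k2 _ _)) => [j|j|].
- by apply: (etrans (dZ_dZbar_N j nf)); exact: (alg _ _ _ _ _).1.
- by apply: (etrans (dZbar_dZ_N j nf)); exact: (alg _ _ _ _ _).2.
by congr (_ +i* _); exact: N_sumsq.
Qed.

Lemma N_fundamental (k : 'I_3) : (k < 2)%N -> fundamental_solution k (@N R).
Proof.
move=> k2; split; first exact: N_loc_integrable.
move=> F tF; rewrite [F in dbox _ _ F]cpairE (dbox_N k2 (test_fun_pair tF)).
by rewrite -/(axis 0) /=; case: (F (axis 0)).
Qed.

(** The substitution w = g h^-1 preserves the measure. *)
Lemma conv_gconv (F : G R -> R[i]) : test_fun F ->
  Defs.conv (@N R) F = cpair (gconv (@N R) (fun g => complex.Re (F g))) (gconv (@N R) (fun g => complex.Im (F g))).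
Proof.
move=> tF; have [c1 c2 b1 b2] := test_fun_pair tF.
apply/funext => g; rewrite /Defs.conv intGE.
have K (f : G R -> R) : Coo f -> bsupp f ->
    I7 (fun u : G R => N (mulG g (invG u)) * f u) = gconv (@N R) f g.
  move=> cf bf; have mf := measurable_L1 (gconv_integrable g (N_locint R) cf bf).
  rewrite /gconv -[RHS](mpres_Rintegral (mpres_div g) mf).
  by congr (Rintegral _ _ _); apply/funext => u; rewrite /ldiv invG_mul.
rewrite /cpair -K // -K //; congr (_ +i* _); congr (Rintegral _ _ _); apply/funext => u; case: (F u) => a b /=.
  by rewrite mul0r subr0.
by rewrite mul0r addr0.
Qed.

Lemma box_zero j : box j (fun _ : G R => 0) = fun=> 0.
Proof.
have F0 v : fld v (fun=> 0) = fun=> 0.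
  by apply/funext => g; rewrite /fld !derive_cst mulr0 addr0.
have Z0 i : Z i (fun _ : G R => 0) = fun=> 0.
  rewrite (_ : (fun=> 0) = cpair (fun=> 0) (fun=> 0)) // ZE; congr cpair; apply/funext => g.
    by rewrite /Zr /XF /YF !F0 addr0 mulr0.
  by rewrite /Zi /XF /YF !F0 subr0 mulr0.
have B0 i : Zbar i (fun _ : G R => 0) = fun=> 0.
  rewrite (_ : (fun=> 0) = cpair (fun=> 0) (fun=> 0)) // ZbarE; congr cpair; apply/funext => g.
    by rewrite /Br /XF /YF !F0 subr0 mulr0.
  by rewrite /Bi /XF /YF !F0 addr0 mulr0.
apply/funext => g; rewrite /box /box_expr.
have E i : Z i (Zbar i (fun _ : G R => 0)) g = 0 /\ Zbar i (Z i (fun _ : G R => 0)) g = 0.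
  by rewrite B0 Z0 B0.
rewrite big1 => [|i _]; last by rewrite (E i).1 (E i).2 addr0.
rewrite big1 => [|i _]; last by rewrite (E i).1 (E i).2 subrr.
by rewrite (E j).1 (E j).2 !subrr !mulr0 addr0.
Qed.

Lemma N_solvable (k : 'I_3) : (k < 2)%N -> solvable_by_conv k (@N R).
Proof.
move=> k2 F tF; have [c1 c2 b1 b2] := test_fun_pair tF.
have s1 := gconv_Coo (N_locint R) c1 b1; have s2 := gconv_Coo (N_locint R) c2 b2.
rewrite (conv_gconv tF); split; first by split; exact: Coo_smooth_real.
apply/funext => j; rewrite /box_b /form_dzbar.
have [->|jk] := eqVneq j k; last exact: box_zero.
rewrite -[fun g => cpair _ _ g]/(cpair _ _) box_cpair //; apply/funext => g.
by rewrite /cpair !L_gconv //; case: (F g).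
Qed.

End bridge.

Theorem theorem2 (R : realType) :
  (\forall g \ae @haar R,
     (@lebesgue_measure R).-integrable `]0, 1[ (EFin \o kernel_integrand g)) /\
  (forall k : 'I_3, (k < 2)%N ->
     fundamental_solution k (@N R) /\ solvable_by_conv k (@N R)).
Proof.
split; first exact: kernel_integrand_integrable.
by move=> k k2; split; [exact: N_fundamental|exact: N_solvable].
Qed.
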